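(* Let $L\subseteq\Sigma^*$ be an unambiguous limiting ET0L language (given by an unambiguous limiting ET0L grammar). Then it is computable to find a description of the generating function $f(z)$ of $L$ as $$f(z)=g(r_1(z),r_2(z),\dots,r_k(z)),$$ where each $r_i(z)\in\mathbb N[[z]]$ is a rational power series, and $g(x_1,\dots,x_k)$ is a formal power series defined as $$g(x_1,\dots,x_k)=\lim_{n\to\infty}g_n(x_1,\dots,x_k),$$ where $g_0(x_1,\dots,x_k)\in\mathbb N[[x_1,\dots,x_k]]$ is a rational power series, and $$g_{n+1}(x_1,\dots,x_k)=g_n\bigl(q_1(x_1,\dots,x_k),q_2(x_1,\dots,x_k),\dots,q_k(x_1,\dots,x_k)\bigr)$$ for each $n\ge0$, where each $q_i(x_1,\dots,x_k)\in\mathbb N[[x_1,\dots,x_k]]$ is a rational series depending on $g_n$. Here $k$ is a constant that depends on the grammar.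
   Context: **Generating functions.** The generating function of $L\subseteq\Sigma^*$ is $f(z)=\sum_{n\ge0}|L\cap\Sigma^n|\,z^n$. Convergence $g_n\to g$ of multivariate formal power series means that, for each multi-index $(i_1,\dots,i_k)$, the coefficient of $x_1^{i_1}\cdots x_k^{i_k}$ in $g_n$ converges to that in $g$. **ET0L grammars.** Let $\Sigma$ (terminals) and $V$ (nonterminals) be disjoint finite alphabets. A table is a function $\tau$ from $\Sigma\cup V$ to the regular languages over $\Sigma\cup V$ with $\tau(\sigma)=\{\sigma\}$ for $\sigma\in\Sigma$. Write $w\to^\tau w'$ if $w=w_1\cdots w_m$ with each $w_i\in\Sigma\cup V$, and $w'=w_1'\cdots w_m'$ with each $w_i'\in\tau(w_i)$; write $w\to^{\tau_1\cdots\tau_k}w'$ if $w'$ is obtained from $w$ by successively applying $\tau_1,\dots,\tau_k$ in this way. An ET0L grammar is a tuple $E=(\Sigma,V,T,\mathcal R,S)$ where $T$ is a finite set of tables, $\mathcal R\subseteq T^*$ is a regular language (the rational control) and $S\in V$ is the start symbol. It generates the ET0L language $L(E)=\{w\in\Sigma^* : S\to^{r}w\text{ for some }r\in\mathcal R\}$. **Derivation trees.** A derivation tree labelled by $\tau_1\cdots\tau_n$ is a finite ordered rooted tree with root labelled $S$ at level $0$, in which every node at level $i-1$ ($1\le i\le n$) labelled by a nonterminal $v$ is expanded by children at level $i$ which spell from left to right a word in $\tau_i(v)$ (a single child labelled $\varepsilon$ if that word is empty), while nodes labelled by terminals or $\varepsilon$ are leaves; it is a derivation tree for the word in $(\Sigma\cup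 V)^*$ read off its leaves from left to right. **Unambiguous.** $E$ is unambiguous if for every $r\in\mathcal R$ and every $w\in(\Sigma\cup V)^*$ there is at most one derivation tree for $w$ labelled by $r$. **Limiting.** $E$ is limiting if: (1) $T=\{\alpha,\beta,\gamma\}$ consists of three tables; (2) $\mathcal R=\alpha\beta^*\gamma$; (3) $\varepsilon\notin\beta(v)$ for each $v\in V$; (4) $\gamma(v)\neq\emptyset$ for each $v\in V$; (5) if $S\to^{\rho_n}w$ for some $w\in(\Sigma\cup V)^*$, where $\rho_n=\alpha\beta^n\gamma$, then there exists $K\ge n$ such that $S\to^{\rho_k}w$ for each $k\ge K$. An unambiguous limiting ET0L language is one generated by an ET0L grammar that is both unambiguous and limiting. *)

(* Defs.v *)
From mathcomp Require Import all_boot all_order all_algebra.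
From mathcomp Require Export mpoly.
Set Implicit Arguments.
Unset Strict Implicit.
Unset Printing Implicit Defensive.

(* The total recursive functions (Kleene): basic functions, composition,
   primitive recursion and regular minimisation, here on the data types
   generated by unit, nat, products and lists rather than on nat alone, so
   that no Goedel numbering of the data is needed. *)
Inductive computable : forall A B : Type, (A -> B) -> Prop :=
| comp_id (A : Type) : @computable A A (fun x => x)
| comp_comp (A B C : Type) (f : A -> B) (g : B -> C) :
    computable f -> computable g -> computable (fun x => g (f x))
| comp_tt (A : Type) : @computable A unit (fun=> tt)
| comp_pair (A B C : Type) (f : A -> B) (g : A -> C) :
    computable f -> computable g -> computable (fun x => (f x, g x))
| comp_fst (A B : Type) : @computable (A * B) A fst
| comp_snd (A B : Type) : @computable (A * B) B snd
| comp_zero : @computable unit nat (fun=> 0)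
| comp_succ : computable S
| comp_nil (A : Type) : @computable unit (seq A) (fun=> [::])
| comp_cons (A : Type) : @computable (A * seq A) (seq A) (fun p => p.1 :: p.2)
| comp_nat_rec (P A : Type) (f : P -> A) (g : P * (nat * A) -> A) :
    computable f -> computable g ->
    @computable (P * nat) A
      (fun p => nat_rect (fun=> A) (f p.1) (fun n acc => g (p.1, (n, acc))) p.2)
| comp_list_rec (P A B : Type) (f : P -> B) (g : P * (A * (seq A * B)) -> B) :
    computable f -> computable g ->
    @computable (P * seq A) B
      (fun p => list_rect (fun=> B) (f p.1)
                  (fun x s acc => g (p.1, (x, (s, acc)))) p.2)
| comp_mu (A : Type) (f : A * nat -> nat) (g : A -> nat) :
    computable f ->
    (forall x, f (x, g x) = 0 /\ (forall m, m < g x -> f (x, m) <> 0)) ->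
    computable g
| comp_ext (A B : Type) (f g : A -> B) :
    computable f -> f =1 g -> computable g.

Definition lang (X : Type) := seq X -> Prop.

(* A deterministic automaton over the alphabet of natural numbers: entry
   [a] of row [q] of the first component is the state reached from [q] by
   reading [a] (0 where the table is undefined), 0 is the initial state and
   the second component lists the accepting states. *)
Definition dfa := (seq (seq nat) * seq nat)%type.

Definition dfa_accepts (A : dfa) (w : seq nat) : bool :=
  foldl (fun q a => nth 0 (nth [::] A.1 q) a) 0 w \in A.2.

(* Letters of a finite alphabet are numbered by [enum_rank]. *)
Definition recognizes (X : finType) (A : dfa) (L : lang X) : Prop :=
  forall w : seq X,
    L w <-> dfa_accepts A [seq nat_of_ord (enum_rank x) | x <- w].

Definition regular (X : finType) (L : lang X) : Prop :=
  exists A : dfa, recognizes A L.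

(* T indexes the set of tables; the alphabet is the disjoint union of the
   terminals [inl a] and the nonterminals [inr v]. *)
Record et0l (Sigma V T : finType) := ET0L {
  table : T -> Sigma + V -> lang (Sigma + V)%type;
  table_regular : forall t x, regular (table t x);
  table_terminal : forall t a w, table t (inl a) w <-> w = [:: inl a];
  control : lang T;
  control_regular : regular control;
  start : V }.

Inductive rewrites (X : Type) (tau : X -> lang X) : seq X -> seq X -> Prop :=
| rewrites_nil : rewrites tau [::] [::]
| rewrites_cons x u w w' :
    tau x u -> rewrites tau w w' -> rewrites tau (x :: w) (u ++ w').

Fixpoint derives (Sigma V T : finType) (E : et0l Sigma V T) (r : seq T)
    (w w' : seq (Sigma + V)) : Prop :=
  match r with
  | [::] => w = w'
  | t :: r' => exists2 u, rewrites (table E t) w u & derives E r' u w'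
  end.

Definition et0l_language (Sigma V T : finType) (E : et0l Sigma V T) :
    lang Sigma :=
  fun w => exists2 r, control E r
                    & derives E r [:: inr (start E)] [seq inl a | a <- w].

(* [Node v [::]] is an unexpanded nonterminal leaf: an expanded node has at
   least one child, namely [Eps] when the word is empty. *)
Inductive dtree (Sigma V : Type) :=
| Eps
| Term of Sigma
| Node of V & seq (dtree Sigma V).

Arguments Eps {Sigma V}.
Arguments Term {Sigma V} _.
Arguments Node {Sigma V} _ _.

(* [None] is the label epsilon *)
Definition label (Sigma V : Type) (t : dtree Sigma V) : option (Sigma + V) :=
  match t with
  | Eps => None
  | Term a => Some (inl a)
  | Node v _ => Some (inr v)
  end.

Fixpoint tree_yield (Sigma V : Type) (t : dtree Sigma V) : seq (Sigma + V) :=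
  match t with
  | Eps => [::]
  | Term a => [:: inl a]
  | Node v [::] => [:: inr v]
  | Node v ts => flatten (map (@tree_yield Sigma V) ts)
  end.

Definition child_labels (X : Type) (u : seq X) : seq (option X) :=
  if u is [::] then [:: None] else map Some u.

Fixpoint expanded_by (Sigma V T : finType) (E : et0l Sigma V T) (r : seq T)
    (t : dtree Sigma V) {struct r} : Prop :=
  match t, r with
  | Node v ts, [::] => ts = [::]
  | Node v ts, tau :: r' =>
      (exists2 u, table E tau (inr v) u
                & map (@label Sigma V) ts = child_labels u)
      /\ (forall i, i < size ts -> expanded_by E r' (nth Eps ts i))
  | _, _ => True
  end.

Definition derivation_tree (Sigma V T : finType) (E : et0l Sigma V T)
    (r : seq T) (w : seq (Sigma + V)) (t : dtree Sigma V) : Prop :=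
  [/\ label t = Some (inr (start E)), expanded_by E r t & tree_yield t = w].

Definition unambiguous (Sigma V T : finType) (E : et0l Sigma V T) : Prop :=
  forall r w t1 t2, control E r ->
    derivation_tree E r w t1 -> derivation_tree E r w t2 -> t1 = t2.

Definition limiting (Sigma V T : finType) (E : et0l Sigma V T) : Prop :=
  exists alpha beta gamma : T,
    let rho n := alpha :: nseq n beta ++ [:: gamma] in
    let S0 := [:: inr (start E)] in
    [/\ uniq [:: alpha; beta; gamma]
          /\ (forall t, t \in [:: alpha; beta; gamma]),
        forall r, control E r <-> exists n, r = rho n,
        forall v, ~ table E beta (inr v) [::],
        forall v, exists u, table E gamma (inr v) u
      & forall n w, derives E (rho n) S0 w ->
          exists2 K, n <= K & forall k, K <= k -> derives E (rho k) S0 w].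

Definition fps (R : Type) (k : nat) := 'X_{1..k} -> R.

Section Fps.
Import GRing.Theory.
Local Open Scope ring_scope.

Definition fps_mul (R : nzSemiRingType) (k : nat) (S S' : fps R k) : fps R k :=
  fun m => \sum_(h : 'X_{1..k < (mdeg m).+1, (mdeg m).+1}
                  | m == (h.1 + h.2)%MM) S h.1 * S' h.2.

Definition fps_one (R : nzSemiRingType) (k : nat) : fps R k :=
  fun m => (m == 0%MM)%:R.

(* the monomial q_1^(I_1) ... q_k^(I_k) in the series q_1, ..., q_k *)
Definition fps_monomial (R : nzSemiRingType) (k l : nat) (q : 'I_k -> fps R l)
    (I : 'X_{1..k}) : fps R l :=
  \big[@fps_mul R l/@fps_one R l]_(i < k)
    iter (I i) (fps_mul (q i)) (@fps_one R l).

(* h = g(q_1, ..., q_k).  The q_i may have nonzero constant terms, so that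
   the substitution is a partial operation: for each monomial of h only
   finitely many monomials of g may contribute. *)
Definition fps_subst (k l : nat) (g : fps nat k) (q : 'I_k -> fps nat l)
    (h : fps nat l) : Prop :=
  forall m, exists N, forall n, (N <= n)%N ->
    (\sum_(I : 'X_{1..k < n}) g I * fps_monomial q I m)%N = h m.

(* Coefficientwise convergence; a sequence in nat converges iff it is
   eventually constant. *)
Definition fps_converges (k : nat) (gs : nat -> fps nat k) (g : fps nat k) :
    Prop :=
  forall m, exists N, forall n, (N <= n)%N -> gs n m = g m.

(* Codes of polynomials over the integers: the list entry ((a, b), e) stands
   for the term (a - b) x_1^(e_1) ... x_k^(e_k). *)
Definition polycode := seq (nat * nat * seq nat).

Definition poly_of (k : nat) (c : polycode) : {mpoly int[k]} :=
  \sum_(t <- c)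
    ((t.1.1)%:Z - (t.1.2)%:Z) *: 'X_[[multinom nth 0%N t.2 i | i < k]].

(* Codes of rational series: a numerator and a denominator. *)
Definition ratcode := (polycode * polycode)%type.

Definition denotes (k : nat) (c : ratcode) (S : fps nat k) : Prop :=
  (poly_of k c.2)@_0%MM != 0 /\
  fps_mul (fun m => (poly_of k c.2)@_m) (fun m => (S m)%:Z)
    =1 (fun m => (poly_of k c.1)@_m).

End Fps.

(* For a monomial m in one variable, [mdeg m] is the exponent of z. *)
Definition generating_function (Sigma : finType) (L : lang Sigma)
    (f : fps nat 1) : Prop :=
  forall m : 'X_{1..1}, exists2 A : {set (mdeg m).-tuple Sigma},
    (forall w : (mdeg m).-tuple Sigma, w \in A <-> L w) & f m = #|A|.

(* numbers of terminals, of nonterminals and of tables, start symbol,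
   automata for the languages table t v, automaton for the control *)
Definition gcode := (nat * nat * nat * nat * seq (seq dfa) * dfa)%type.

Definition presents (Sigma V T : finType) (c : gcode) (E : et0l Sigma V T) :
    Prop :=
  let: (nS, nV, nT, s, tabs, ctl) := c in
  [/\ [/\ nS = #|Sigma|, nV = #|V| & nT = #|T|],
      s = enum_rank (start E),
      forall t v,
        recognizes (nth ([::], [::]) (nth [::] tabs (enum_rank t)) (enum_rank v))
                   (table E t (inr v))
    & recognizes ctl (control E)].

(* k, the r_i, g_0 and the q_i *)
Definition dcode := (nat * seq ratcode * ratcode * seq ratcode)%type.

(* The description d yields f; a missing list entry has denominator 0 and so
   denotes no series. *)
Definition describes (d : dcode) (f : fps nat 1) : Prop :=
  let: (k, rc, g0c, qc) := d in
  exists (r : 'I_k -> fps nat 1) (q : 'I_k -> fps nat k)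
         (gs : nat -> fps nat k) (g : fps nat k),
    [/\ forall i : 'I_k, denotes (nth ([::], [::]) rc i) (r i),
        denotes g0c (gs 0)
          /\ (forall i : 'I_k, denotes (nth ([::], [::]) qc i) (q i)),
        forall n, fps_subst (gs n) q (gs n.+1),
        fps_converges gs g
      & fps_subst g r f].

(* Main.v *)
Require Import Defs.
From mathcomp Require Import all_boot all_order all_algebra.
From mathcomp Require Import boolp.
From mathcomp Require Import ring zify.
From HB Require Import structures.
Set Implicit Arguments.
Unset Strict Implicit.
Unset Printing Implicit Defensive.
Import GRing.Theory.

Local Open Scope ring_scope.

(** The words of each length generated along alpha beta^j gamma are counted by
    the coefficients of A(B^j(C(z))), where A, B and C are the commutative images
    of the right-hand sides of the three tables and B^j is the j-fold
    substitution: derivation trees are determined by their yields. By the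
    limiting condition these coefficients are eventually constant in j, with
    those of the generating function f as limits. This suggests g_n = A(B^n),
    q = B and r = C, but then g_n need not converge to the right series.

    - Mass may escape: if beta maps a to ab and b to b, alpha starts with a,
      and gamma maps a to a terminal and b to the empty word, then g_n is the
      monomial a b^n, which tends to 0.
    - Coefficients may oscillate: if beta exchanges a and b and gamma maps both
      to the same terminal, then g_n alternates between a and b.

    The first defect is cured by erasing. A letter of a right-hand side that
    will generate the empty word is given weight 1, and the variables are
    reserved to letters that will generate a nonempty word. Then no series has
    a constant term, except for the empty word of the language itself, and all
    substitutions are finite. Which letters may be erased or kept depends on
    the remaining control beta^j gamma only through two sets of nonterminals
    ([signs]), which are a function of the sets for j - 1 and therefore
    eventually periodic in j.

    The second defect is cured by doing p steps of beta at once, where p is a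
    multiple of the period of these sets and of the factorial of the number of
    letters. A word of tokens of length d that is derived in many steps branches
    less than d times, so each of its tokens descends for a long time from
    single letters. This walk visits some letter twice, and repeating the cycle
    lengthens it by exactly the chosen number of steps. Hence the set of token
    words of length d reached after p * n steps is eventually increasing in n,
    so eventually constant ([iterate_eventually]).

    So there is one variable for each nonterminal and one for all terminals; r
    consists of the series of the nonempty words generated through beta^p
    gamma, q of the series of p steps of beta, and g_n is the series of alpha
    followed by p * n steps. Unambiguity enters through [counts_same_size] and
    [size_counts_words]: coefficients count trees, and trees with equal yields
    are equal.

    One step is rational, and computable, because the weights of the words
    accepted by an automaton solve a linear system ([kept_system]). To keep
    the matrix of this system free of constant terms, the erased letters before
    a kept one are treated as one move, and only stretches shorter than the
    number of states are used; this loses no generated word, since longer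
    stretches can be shortened ([shorten_run]), and counts none twice, by
    unambiguity. The system is then solved by Gauss-Jordan elimination on
    fractions of polynomials ([represents_kept]). As its solution is unique
    and substitution maps solutions to solutions, the identities
    g_(n+1) = g_n(q) and f = g(r) follow by induction from the periodicity of
    the sets of letters ([chain_comp]). *)

(** * Formal power series *)

(** An alias of the function type, to carry the ring structure. *)
Definition series (k : nat) := fps int k.

HB.instance Definition _ k := gen_eqMixin (series k).
HB.instance Definition _ k := gen_choiceMixin (series k).

Definition trunc k d (S : series k) : {mpoly int[k]} :=
  \sum_(m : 'X_{1..k < d}) S m *: 'X_[m].

Lemma mcoeff_trunc k d (S : series k) m :
  (trunc d S)@_m = if (mdeg m < d)%N then S m else 0.
Proof.
case: ltnP => h; first exact: mcoeff_mpoly.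
rewrite /trunc raddf_sum big1 //= => i _.
rewrite mcoeffZ mcoeffX; case: eqP => [e|]; last by rewrite mulr0.
by move: (bmdeg i); rewrite e ltnNge h.
Qed.

Definition agree k d (p q : {mpoly int[k]}) :=
  forall m, (mdeg m < d)%N -> p@_m = q@_m.

Lemma mdeg_split k (m m1 m2 : 'X_{1..k}) d : m = (m1 + m2)%MM ->
  (mdeg m < d -> (mdeg m1 < d) * (mdeg m2 < d))%N.
Proof.
by move=> ->; rewrite mdegD => h; split; apply: leq_ltn_trans h;
  rewrite ?leq_addr ?leq_addl.
Qed.

Lemma agree_mul k d (p p' q q' : {mpoly int[k]}) :
  agree d p p' -> agree d q q' -> agree d (p * q) (p' * q').
Proof.
move=> hp hq m hm; rewrite !mcoeffM; apply: eq_bigr => h /eqP e.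
by rewrite hp ?hq // (mdeg_split e hm).
Qed.

(** A coefficient of a product depends only on the coefficients of lower
    degree of the factors, so the ring laws of series follow from those of
    polynomials by truncation. *)
Lemma fps_mul_trunc k d (S S' : series k) m : (mdeg m < d)%N ->
  fps_mul S S' m = (trunc d S * trunc d S')@_m.
Proof.
move=> hm; rewrite /fps_mul mcoeffM; apply: eq_bigr => h /eqP e.
by rewrite !mcoeff_trunc !(mdeg_split e hm).
Qed.

Lemma trunc_mul k d (S S' : series k) :
  agree d (trunc d (fps_mul S S')) (trunc d S * trunc d S').
Proof. by move=> m hm; rewrite mcoeff_trunc hm; exact: fps_mul_trunc. Qed.

Definition fps_add k (S S' : series k) : series k := fun m => S m + S' m.
Definition fps_opp k (S : series k) : series k := fun m => - S m.

Lemma fps_addA k : associative (@fps_add k).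
Proof. by move=> x y z; apply: funext => m; rewrite /fps_add addrA. Qed.
Lemma fps_addC k : commutative (@fps_add k).
Proof. by move=> x y; apply: funext => m; rewrite /fps_add addrC. Qed.
Lemma fps_add0 k : left_id (fun=> 0) (@fps_add k).
Proof. by move=> x; apply: funext => m; rewrite /fps_add add0r. Qed.
Lemma fps_addN k : left_inverse (fun=> 0) (@fps_opp k) (@fps_add k).
Proof. by move=> x; apply: funext => m; rewrite /fps_add /fps_opp addNr. Qed.

HB.instance Definition _ k := GRing.isZmodule.Build (series k)
  (@fps_addA k) (@fps_addC k) (@fps_add0 k) (@fps_addN k).

Lemma scoefD k (S S' : series k) m : (S + S') m = S m + S' m. Proof. by []. Qed.
Lemma scoefN k (S : series k) m : (- S) m = - S m. Proof. by []. Qed.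
Lemma scoefB k (S S' : series k) m : (S - S') m = S m - S' m. Proof. by []. Qed.
Lemma scoef_sum k (I : Type) (r : seq I) P (F : I -> series k) m :
  (\sum_(i <- r | P i) F i) m = \sum_(i <- r | P i) F i m.
Proof. exact: (big_morph (fun S : series k => S m)). Qed.

Lemma fps_mulA k : associative (@fps_mul int k).
Proof.
move=> x y z; apply: funext => m; set d := (mdeg m).+1.
rewrite !(@fps_mul_trunc _ d) //.
rewrite (@agree_mul _ d _ (trunc d x) _ (trunc d y * trunc d z)) //; last first.
  exact: trunc_mul.
rewrite (@agree_mul _ d (trunc d (fps_mul x y)) (trunc d x * trunc d y)
  _ (trunc d z)) ?mulrA //.
exact: trunc_mul.
Qed.

Lemma fps_mulC k : commutative (@fps_mul int k).
Proof.
by move=> x y; apply: funext => m; rewrite !(@fps_mul_trunc _ (mdeg m).+1) // mulrC.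
Qed.

Lemma trunc1 k d : agree d (trunc d (@fps_one int k)) 1.
Proof. by move=> m hm; rewrite mcoeff_trunc hm mcoeff1. Qed.

Lemma fps_mul1 k : left_id (@fps_one int k) (@fps_mul int k).
Proof.
move=> x; apply: funext => m; rewrite !(@fps_mul_trunc _ (mdeg m).+1) //.
rewrite (@agree_mul _ (mdeg m).+1 _ 1 _ (trunc (mdeg m).+1 x)) ?mul1r //.
  by rewrite mcoeff_trunc ltnSn.
exact: trunc1.
Qed.

Lemma fps_mulDl k : left_distributive (@fps_mul int k) (@fps_add k).
Proof.
move=> x y z; apply: funext => m.
rewrite /fps_add /fps_mul -big_split; apply: eq_bigr => h _.
exact: mulrDl.
Qed.

Lemma fps_one_neq0 k : @fps_one int k != 0 :> series k.
Proof.
by apply/eqP => /(congr1 (fun S : series k => S 0%MM)); rewrite /fps_one eqxx.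
Qed.

HB.instance Definition _ k := GRing.Zmodule_isComNzRing.Build (series k)
  (@fps_mulA k) (@fps_mulC k) (@fps_mul1 k) (@fps_mulDl k) (@fps_one_neq0 k).

Lemma scoef1 k m : (1 : series k) m = (m == 0%MM)%:R. Proof. by []. Qed.
Lemma scoefM_trunc k d (S S' : series k) m : (mdeg m < d)%N ->
  (S * S') m = (trunc d S * trunc d S')@_m.
Proof. exact: fps_mul_trunc. Qed.
Lemma scoefM0 k (S S' : series k) : (S * S') 0%MM = S 0%MM * S' 0%MM.
Proof.
rewrite (@scoefM_trunc _ 1) ?mdeg0 // rmorphM /= !mcoeff_trunc mdeg0 //.
Qed.

Definition lowfree k d (S : series k) := forall m, (mdeg m < d)%N -> S m = 0.

Lemma lowfreeM k a b (S S' : series k) :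
  lowfree a S -> lowfree b S' -> lowfree (a + b) (S * S').
Proof.
move=> hS hS' m hm; rewrite [LHS]big1 // => h /eqP e.
case: (ltnP (mdeg h.1) a) => h1; first by rewrite hS // mul0r.
have hm' : (mdeg h.1 + mdeg h.2 < a + b)%N by rewrite -mdegD -e.
by rewrite hS' ?mulr0 // -(ltn_add2l a) (leq_ltn_trans _ hm') // leq_add2r.
Qed.

Lemma lowfreeX k (S : series k) n : lowfree 1 S -> lowfree n (S ^+ n).
Proof.
by move=> hS; elim: n => [|n IH]; [|rewrite exprS -add1n; exact: lowfreeM].
Qed.

Definition constfree k (S : series k) := S 0%MM = 0.

Lemma constfreeP k (S : series k) : constfree S -> lowfree 1 S.
Proof. by move=> hS m; rewrite ltnS leqn0 mdeg_eq0 => /eqP->. Qed.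

(** * Substitution of series without constant terms *)

Section Substitution.
Variables (k l : nat) (q : 'I_k -> series l).
Hypothesis q0 : forall i, constfree (q i).

Let ev : {mpoly int[k]} -> series l := mmap intr q.

Lemma lowfree_mmap1 m : lowfree (mdeg m) (mmap1 q m).
Proof.
rewrite mdegE /mmap1; elim/big_ind2: _ => //.
  by move=> a S b S' ha hb; exact: lowfreeM.
by move=> i _; apply: lowfreeX; exact: constfreeP.
Qed.

Lemma coef_intM (z : int) (S : series l) m : (z%:~R * S) m = z * S m.
Proof.
have -> : z%:~R * S = S *~ z by rewrite mulrzl.
case: z => n; rewrite ?NegzE.
  by elim: n => [|n IH]; rewrite ?mul0r // -addn1 PoszD mulrzDr scoefD IH mulrDl mul1r.
rewrite mulrNz scoefN mulNr; congr (- _).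
by elim: n.+1 => [|n' IH]; rewrite ?mul0r // -addn1 PoszD mulrzDr scoefD IH mulrDl mul1r.
Qed.

(** The series q i have no constant term, so monomials of degree at least d in
    them contribute only to degrees at least d. *)
Lemma ev_agree d p p' m : agree d p p' -> (mdeg m < d)%N -> ev p m = ev p' m.
Proof.
move=> h hm; apply/eqP; rewrite -subr_eq0 -scoefB -[X in X m]mmapB.
apply/eqP; rewrite /mmap scoef_sum big1 // => i _; rewrite coef_intM.
case: (ltnP (mdeg i) d) => hi.
  by rewrite mcoeffB h // subrr mul0r.
by rewrite lowfree_mmap1 ?mulr0 //; exact: leq_trans hi.
Qed.

(** The value S(q). The coefficient of m is computed from a truncation of S:
    terms of higher degree cannot reach m when the q i have no constant term. *)
Definition scomp (S : series k) : series l :=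
  fun m => ev (trunc (mdeg m).+1 S) m.

Lemma scomp_trunc d S m : (mdeg m < d)%N -> scomp S m = ev (trunc d S) m.
Proof.
move=> hm; apply: (@ev_agree (mdeg m).+1) => // i hi.
by rewrite !mcoeff_trunc hi ifT //; exact: leq_trans hm.
Qed.

Lemma ev_mul_agree d p p' (S S' : series l) m :
    (forall m, (mdeg m < d)%N -> ev p m = S m) ->
    (forall m, (mdeg m < d)%N -> ev p' m = S' m) -> (mdeg m < d)%N ->
  ev (p * p') m = (S * S') m.
Proof.
move=> h h' hm; rewrite /ev rmorphM; apply: eq_bigr => i /eqP e.
by congr (_ * _); [apply: h | apply: h']; rewrite (mdeg_split e hm).
Qed.

Lemma scompM S S' : scomp (S * S') = scomp S * scomp S'.
Proof.
apply: funext => m; set d := (mdeg m).+1.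
rewrite (@scomp_trunc d) // (@ev_agree d _ (trunc d S * trunc d S')) //.
  by apply: (@ev_mul_agree d) => // i hi; rewrite (@scomp_trunc d).
exact: trunc_mul.
Qed.

Lemma scompD S S' : scomp (S + S') = scomp S + scomp S'.
Proof.
apply: funext => m; rewrite scoefD /scomp -scoefD -[X in _ = X m]mmapD.
by apply: (@ev_agree (mdeg m).+1) => // i hi; rewrite mcoeffD !mcoeff_trunc hi.
Qed.

Lemma scomp0 : scomp 0 = 0.
Proof. by apply: (addrI (scomp 0)); rewrite -scompD !addr0. Qed.

Lemma scompN S : scomp (- S) = - scomp S.
Proof. by apply: (addrI (scomp S)); rewrite -scompD !subrr scomp0. Qed.

Lemma scomp1 : scomp 1 = 1.
Proof.
apply: funext => m; rewrite /scomp (@ev_agree (mdeg m).+1 _ 1) //.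
  by rewrite /ev rmorph1.
exact: trunc1.
Qed.

Lemma scomp_sum (I : Type) (r : seq I) P (F : I -> series k) :
  scomp (\sum_(i <- r | P i) F i) = \sum_(i <- r | P i) scomp (F i).
Proof. exact: (big_morph scomp scompD scomp0). Qed.

Lemma scomp_nat n : scomp n%:R = n%:R.
Proof.
by elim: n => [|n IH]; rewrite ?scomp0 // -addn1 !natrD scompD IH scomp1.
Qed.

Lemma scompE S m d : (mdeg m < d)%N ->
  scomp S m = \sum_(I : 'X_{1..k < d}) S I * mmap1 q I m.
Proof.
move=> hm; rewrite (scomp_trunc _ hm) /ev /trunc raddf_sum scoef_sum.
by apply: eq_bigr => I _ /=; rewrite mmapZ mmapX coef_intM.
Qed.

End Substitution.

Definition xvar k (i : 'I_k) : series k := fun m => (m == U_(i)%MM)%:R.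

Lemma xvar_poly k (i : 'I_k) (d : nat) : agree d (trunc d (xvar i)) 'X_i.
Proof. by move=> m hm; rewrite mcoeff_trunc hm mcoeffX eq_sym. Qed.

Lemma scomp_xvar k l (q : 'I_k -> series l) i :
  (forall i, constfree (q i)) -> scomp q (xvar i) = q i.
Proof.
move=> q0; apply: funext => m.
rewrite /scomp (ev_agree q0 (d := (mdeg m).+1) (p' := 'X_i)) //.
  by rewrite mmapX mmap1U.
exact: xvar_poly.
Qed.

Lemma xvar_constfree k (i : 'I_k) : constfree (xvar i).
Proof. by rewrite /constfree /xvar eq_sym mnm1_eq0. Qed.

Definition zser k (S : fps nat k) : series k := fun m => (S m)%:Z.

Lemma zser_mul k (S S' : fps nat k) :
  zser (fps_mul S S') = zser S * zser S'.
Proof.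
apply: funext => m; rewrite /zser /fps_mul.
rewrite (big_morph Posz PoszD (erefl _)).
by apply: eq_bigr => h _; rewrite PoszM.
Qed.

Lemma zser_one k : zser (@fps_one nat k) = 1.
Proof. by apply: funext => m; rewrite /zser /fps_one scoef1; case: eqP. Qed.

Lemma zser_monomial k l (q : 'I_k -> fps nat l) I :
  zser (fps_monomial q I) = mmap1 (fun i => zser (q i)) I.
Proof.
rewrite /fps_monomial /mmap1 (big_morph (@zser l) (@zser_mul l) (@zser_one l)).
apply: eq_bigr => i _; elim: (I i) => [|n IH]; first by rewrite expr0 zser_one.
by rewrite iterS zser_mul IH exprS.
Qed.

(** For series without constant terms the sums that define [fps_subst] are
    constant beyond the degree of m, with the substitution homomorphism as
    value. *)
Lemma scomp_subst k l (q : 'I_k -> fps nat l) g h :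
    (forall i, constfree (zser (q i))) ->
    zser h = scomp (fun i => zser (q i)) (zser g) -> fps_subst g q h.
Proof.
move=> q0 e m; exists (mdeg m).+1 => n hn.
have := congr1 (fun S : series l => S m) e.
rewrite (scompE q0 _ hn) {1}/zser => e1; apply/eqP; rewrite -eqz_nat e1.
rewrite (big_morph Posz PoszD (erefl _)); apply/eqP; apply: eq_bigr => I _.
by rewrite PoszM -zser_monomial.
Qed.

(** * Linear systems over series *)

Section Star.
Variables (k : nat) (S : series k).
Hypothesis S0 : constfree S.

(** The inverse of 1 - S as a geometric series, cut at the degree of the
    requested coefficient. *)
Definition star : series k := fun m => (\sum_(i < (mdeg m).+1) S ^+ i) m.

Lemma star_partial d m : (mdeg m < d)%N -> star m = (\sum_(i < d) S ^+ i) m.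
Proof.
move=> hm; rewrite /star -!(big_mkord xpredT (fun i => S ^+ i)).
rewrite (big_cat_nat (n := (mdeg m).+1) _ hm) //= scoefD.
rewrite [X in _ = _ + X]scoef_sum [X in _ = _ + X]big1_seq ?addr0 // => i.
by rewrite mem_index_iota => /andP[_ /andP[hi _]]; apply: (lowfreeX (constfreeP S0)).
Qed.

Lemma starP : (1 - S) * star = 1.
Proof.
apply: funext => m; set d := (mdeg m).+1.
transitivity (((1 - S) * \sum_(i < d) S ^+ i) m).
  apply: eq_bigr => h /eqP e; congr (_ * _); apply: star_partial.
  by rewrite (mdeg_split e (ltnSn _)).
have e : 1 - S ^+ d = (1 - S) * \sum_(i < d) S ^+ i by rewrite -opprB subrX1 -mulNr opprB.
by rewrite -e scoefB (lowfreeX (constfreeP S0)) ?subr0.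
Qed.

Lemma star_unique h t : h = t + S * h -> h = star * t.
Proof.
move=> e; have e2 : (1 - S) * h = t by rewrite mulrBl mul1r {1}e addrK.
by rewrite -e2 mulrA [star * _]mulrC starP mul1r.
Qed.

End Star.

Section Elimination.
Variable l : nat.
Implicit Type M : nat -> nat -> series l.

(** The equation for unknown k, solved for that unknown, is substituted in all
    equations. Column n of the matrix holds the inhomogeneous terms; columns
    below k become irrelevant and are not cleared. *)
Definition eliminate M k : nat -> nat -> series l :=
  fun i j => M i j + M i k * star (M k k) * M k j.

(** The coefficients of the unknowns keep a vanishing constant term during the
    elimination, so that every pivot 1 - M k k is invertible. *)
Lemma eliminateP n M (h : nat -> series l) k :
    (forall i j, (i < n)%N -> (j < n)%N -> constfree (M i j)) ->
    (forall i, (i < n)%N -> h i = M i n + \sum_(0 <= j < n) M i j * h j) ->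
    (k <= n)%N ->
  let M' := foldl eliminate M (iota 0 k) in
  (forall i j, (i < n)%N -> (j < n)%N -> constfree (M' i j)) /\
  (forall i, (i < n)%N -> h i = M' i n + \sum_(k <= j < n) M' i j * h j).
Proof.
move=> c0 e0; elim: k => [|k IH] hk //.
have [c e] := IH (ltnW hk); rewrite -addn1 iotaD add0n foldl_cat /=.
set M' := foldl _ _ _ in c e *; split=> [i j hi hj|i hi].
  rewrite /constfree /eliminate scoefD !scoefM0.
  by rewrite [M' i j _]c // [M' i k _]c // !mul0r addr0.
have ek := e k hk; rewrite big_ltn // addrCA addrC in ek.
have {}ek := star_unique (c k k hk hk) ek.
rewrite addn1 e // [in LHS]big_ltn // ek /eliminate.
under [in RHS]eq_bigr => j _ do rewrite mulrDl -[X in _ + X]mulrA.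
rewrite big_split /= -mulr_sumr; ring.
Qed.

Lemma eliminate_solve n M (h : nat -> series l) :
    (forall i j, (i < n)%N -> (j < n)%N -> constfree (M i j)) ->
    (forall i, (i < n)%N -> h i = M i n + \sum_(0 <= j < n) M i j * h j) ->
  forall i, (i < n)%N -> h i = foldl eliminate M (iota 0 n) i n.
Proof.
move=> c e i hi; have [_ /(_ i hi) ->] := eliminateP c e (leqnn n).
by rewrite big_geq // addr0.
Qed.

End Elimination.

(** * Fractions of polynomials as data *)

Definition eadd (e e' : seq nat) : seq nat :=
  [seq (nth 0 e i + nth 0 e' i)%N | i <- iota 0 (size e + size e')].
Definition tmul (t u : nat * nat * seq nat) : nat * nat * seq nat :=
  ((t.1.1 * u.1.1 + t.1.2 * u.1.2, t.1.1 * u.1.2 + t.1.2 * u.1.1)%N,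
   eadd t.2 u.2).
Definition pmul (c d : polycode) : polycode :=
  flatten [seq [seq tmul t u | u <- d] | t <- c].
Definition popp (c : polycode) : polycode :=
  [seq ((t.1.2, t.1.1), t.2) | t <- c].
Definition fadd (x y : ratcode) : ratcode :=
  (pmul x.1 y.2 ++ pmul y.1 x.2, pmul x.2 y.2).
Definition fmul (x y : ratcode) : ratcode := (pmul x.1 y.1, pmul x.2 y.2).
Definition fopp (x : ratcode) : ratcode := (popp x.1, x.2).
(** The fraction 1 / (1 - x.1 / x.2). *)
Definition fstar (x : ratcode) : ratcode := (x.2, x.2 ++ popp x.1).
Definition fnat n : ratcode := ([:: ((n, 0), [::])], [:: ((1, 0), [::])])%N.
Definition fvar i : ratcode :=
  ([:: ((1, 0), nseq i 0 ++ [:: 1])], [:: ((1, 0), [::])])%N.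
Definition fsum (s : seq ratcode) : ratcode := foldr fadd (fnat 0) s.

Lemma nth_eadd e e' i : nth 0%N (eadd e e') i = (nth 0 e i + nth 0 e' i)%N.
Proof.
rewrite /eadd; case: (ltnP i (size e + size e')) => h.
  by rewrite (nth_map 0%N) ?size_iota // nth_iota.
rewrite !nth_default ?size_map ?size_iota //; apply: leq_trans h.
  exact: leq_addl.
exact: leq_addr.
Qed.

Section Codes.
Variable k : nat.
Notation mon e := [multinom nth 0%N e i | i < k].

Definition term_of (t : nat * nat * seq nat) : {mpoly int[k]} :=
  ((t.1.1)%:Z - (t.1.2)%:Z) *: 'X_[mon t.2].

Lemma poly_ofE c : poly_of k c = \sum_(t <- c) term_of t. Proof. by []. Qed.

Lemma poly_of_cat c d : poly_of k (c ++ d) = poly_of k c + poly_of k d.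
Proof. by rewrite !poly_ofE big_cat. Qed.

Lemma poly_of_opp c : poly_of k (popp c) = - poly_of k c.
Proof.
rewrite !poly_ofE big_map -sumrN; apply: eq_bigr => t _.
by rewrite /term_of /= -scaleNr opprB.
Qed.

Lemma term_of_mul t u : term_of (tmul t u) = term_of t * term_of u.
Proof.
rewrite /term_of -scalerAl -scalerAr scalerA -mpolyXD; congr (_ *: 'X_[_]).
  by rewrite /= !PoszD !PoszM; ring.
by apply/mnmP => i; rewrite mnmDE !mnmE nth_eadd.
Qed.

Lemma poly_of_mul c d : poly_of k (pmul c d) = poly_of k c * poly_of k d.
Proof.
rewrite !poly_ofE big_flatten big_map mulr_suml; apply: eq_bigr => t _.
by rewrite big_map mulr_sumr; apply: eq_bigr => u _; rewrite term_of_mul.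
Qed.

Definition pser (p : {mpoly int[k]}) : series k := fun m => p@_m.

Lemma pserD p q : pser (p + q) = pser p + pser q.
Proof. by apply: funext => m; rewrite /pser scoefD mcoeffD. Qed.
Lemma pserN p : pser (- p) = - pser p.
Proof. by apply: funext => m; rewrite /pser scoefN mcoeffN. Qed.
Lemma pserM p q : pser (p * q) = pser p * pser q.
Proof. by apply: funext => m; rewrite /pser mcoeffM. Qed.

(** The analogue of [denotes] for integer series, which unlike series over the
    naturals are closed under the subtractions that elimination needs. *)
Definition represents (c : ratcode) (S : series k) : Prop :=
  (poly_of k c.2)@_0%MM != 0 /\ pser (poly_of k c.2) * S = pser (poly_of k c.1).

Lemma represents_denotes c S : represents c (zser S) -> denotes c S.
Proof.
by move=> [h e]; split=> // m; have /(congr1 (fun S : series k => S m)) := e.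
Qed.

Lemma represents_add x y S S' :
  represents x S -> represents y S' -> represents (fadd x y) (S + S').
Proof.
case: x y => [a b] [c d] [/= b0 e] [/= d0 e']; split=> /=.
  by rewrite poly_of_mul rmorphM mulf_neq0.
by rewrite poly_of_cat !poly_of_mul !pserD !pserM -e -e'; ring.
Qed.

Lemma represents_mul x y S S' :
  represents x S -> represents y S' -> represents (fmul x y) (S * S').
Proof.
case: x y => [a b] [c d] [/= b0 e] [/= d0 e']; split=> /=.
  by rewrite poly_of_mul rmorphM mulf_neq0.
by rewrite !poly_of_mul !pserM -e -e'; ring.
Qed.

Lemma represents_opp x S : represents x S -> represents (fopp x) (- S).
Proof.
case: x => [a b] [/= b0 e]; split=> //=.
by rewrite poly_of_opp pserN -e; ring.
Qed.

(** The numerator of a series without constant term has none either, so the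
    new denominator x.2 - x.1 has the same constant term as x.2. *)
Lemma represents_star x S : constfree S ->
  represents x S -> represents (fstar x) (star S).
Proof.
case: x => [a b] S0 [/= b0 e]; split=> /=; rewrite poly_of_cat poly_of_opp.
  have := congr1 (fun S : series k => S 0%MM) e; rewrite scoefM0 S0 mulr0 /pser.
  by rewrite mcoeffB => <-; rewrite subr0.
rewrite pserD pserN -e -[RHS]mulr1 -(starP S0); ring.
Qed.

Lemma poly_of_nat n : poly_of k [:: ((n, 0), [::])]%N = n%:R.
Proof.
rewrite poly_ofE big_seq1 /term_of /= subr0.
have -> : mon [::] = 0%MM by apply/mnmP => i; rewrite mnmE mnm0E nth_nil.
by rewrite mpolyX0 -[n%:R]mulr1 mulr_natl -scaler_nat; congr (_ *: _); rewrite natz.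
Qed.

Lemma pser1 : pser 1 = 1.
Proof. by apply: funext => m; rewrite /pser mcoeff1 scoef1. Qed.

Lemma pser_nat n : pser n%:R = n%:R.
Proof.
elim: n => [|n IH]; first by apply: funext => m; rewrite /pser mcoeff0.
by rewrite -addn1 !natrD pserD IH pser1.
Qed.

Lemma represents_nat n : represents (fnat n) n%:R.
Proof.
by split; rewrite /= !poly_of_nat ?mcoeff1 ?eqxx // pser1 mul1r pser_nat.
Qed.

Lemma represents_var (i : 'I_k) : represents (fvar i) (xvar i).
Proof.
split; rewrite /= poly_of_nat ?mcoeff1 ?eqxx // pser1 mul1r poly_ofE big_seq1.
apply: funext => m; rewrite /pser /term_of /= subr0 scale1r mcoeffX /xvar.
rewrite eq_sym; congr (_ == _)%:R; apply/mnmP => j; rewrite mnmE mnm1E.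
rewrite nth_cat size_nseq nth_nseq; case: ltnP => h.
  by case: eqP h => [->|_]; rewrite ?ltnn // if_same.
have [e|e] := eqVneq i j; first by rewrite e subnn.
by rewrite nth_default // subn_gt0 ltn_neqAle h andbT.
Qed.

Lemma represents_sum (I : eqType) (r : seq I) (c : I -> ratcode) F :
    (forall i, i \in r -> represents (c i) (F i)) ->
  represents (fsum [seq c i | i <- r]) (\sum_(i <- r) F i).
Proof.
elim: r => [|i r IH] h /=; first by rewrite big_nil; exact: represents_nat.
rewrite big_cons; apply: represents_add; first by apply: h; exact: mem_head.
by apply: IH => j hj; apply: h; rewrite inE hj orbT.
Qed.

End Codes.

Definition entry (M : seq (seq ratcode)) i j := nth ([::], [::]) (nth [::] M i) j.

Definition feliminate n (M : seq (seq ratcode)) k : seq (seq ratcode) :=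
  [seq [seq fadd (entry M i j)
              (fmul (fmul (entry M i k) (fstar (entry M k k))) (entry M k j))
       | j <- iota 0 n.+1] | i <- iota 0 n].

Lemma entry_mkseq (F : nat -> nat -> ratcode) n n' i j : (i < n)%N -> (j < n')%N ->
  entry [seq [seq F i j | j <- iota 0 n'] | i <- iota 0 n] i j = F i j.
Proof.
move=> hi hj; rewrite /entry (nth_map 0%N) ?size_iota // (nth_map 0%N) ?size_iota //.
by rewrite !nth_iota.
Qed.

Lemma feliminate_solve k n C (M : nat -> nat -> series k) (h : nat -> series k) :
    (forall i j, (i < n)%N -> (j <= n)%N -> represents (entry C i j) (M i j)) ->
    (forall i j, (i < n)%N -> (j < n)%N -> constfree (M i j)) ->
    (forall i, (i < n)%N -> h i = M i n + \sum_(0 <= j < n) M i j * h j) ->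
  forall i, (i < n)%N ->
    represents (entry (foldl (feliminate n) C (iota 0 n)) i n) (h i).
Proof.
move=> hC c e i hi; rewrite (eliminate_solve c e hi).
suff H m : (m <= n)%N -> forall i j, (i < n)%N -> (j <= n)%N ->
    represents (entry (foldl (feliminate n) C (iota 0 m)) i j)
               (foldl (@eliminate k) M (iota 0 m) i j) by exact: H.
elim: m => [|m IH] hm //.
rewrite -addn1 iotaD add0n !foldl_cat => i' j' hi' hj'.
rewrite [foldl (feliminate n) _ [:: m]]/= /feliminate entry_mkseq //.
have [c' _] := eliminateP c e (ltnW hm).
have R := IH (ltnW hm).
apply: represents_add; first exact: R.
apply: represents_mul; last exact: R.
apply: represents_mul; first by apply: R => //; exact: ltnW.
by apply: represents_star; [exact: c'|apply: R => //; exact: ltnW].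
Qed.

(** * Weighted words of an automaton with erased letters *)

Definition dstep (A : dfa) q a := nth 0%N (nth [::] A.1 q) a.
Definition drun (A : dfa) q w := foldl (dstep A) q w.
(** States are the numbers below this bound: every entry of the table is
    smaller, and undefined entries lead to state 0. *)
Definition nstates (A : dfa) := (sumn (flatten A.1)).+1.

Lemma dstep_lt A q a : (dstep A q a < nstates A)%N.
Proof.
rewrite /dstep /nstates ltnS.
have [h|h] := ltnP a (size (nth [::] A.1 q)); last by rewrite nth_default.
have [hq|hq] := ltnP q (size A.1); last by rewrite (nth_default _ hq) nth_nil.
have : nth 0%N (nth [::] A.1 q) a \in flatten A.1.
  by apply/flattenP; exists (nth [::] A.1 q); exact: mem_nth.
by elim: (flatten _) => //= x s IH; rewrite inE => /orP[/eqP->|/IH]; lia.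
Qed.

Lemma drun_lt A q w : (q < nstates A)%N -> (drun A q w < nstates A)%N.
Proof.
by elim: w q => //= a w IH q h; apply: IH; exact: dstep_lt.
Qed.

Definition words_of (T : Type) (s : seq T) i : seq (seq T) :=
  iter i (fun ws => flatten [seq [seq a :: w | w <- ws] | a <- s]) [:: [::]].
Definition words_upto (T : Type) (s : seq T) n : seq (seq T) :=
  flatten [seq words_of s i | i <- iota 0 n].

(** Words over an alphabet in which some letters (those of El) may be erased
    at weight 1, while a kept letter a has weight w a. A run is cut before
    each kept letter; only erased stretches shorter than the number of states
    are admitted, so that each coefficient is a finite sum. *)
Section Kept.
Variables (l : nat) (A : dfa) (El : seq nat) (nX : nat).
Let n := nstates A.
Let EW := words_upto El n.

Definition accepted s := count (fun x => drun A s x \in A.2) EW.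

(** The unknown h s is the weight of the words accepted from s. Such a word is
    an erased stretch that ends in an accepting state, or an erased stretch x
    followed by a kept letter a. The unknowns on the right carry a weight w a,
    which has no constant term when it is the series of the nonempty
    descendants of a letter. *)
Definition kept_system (w : nat -> series l) (h : nat -> series l) := forall s, (s < n)%N ->
  h s = (accepted s)%:R
    + \sum_(x <- EW) \sum_(a <- iota 0 nX) w a * h (dstep A (drun A s x) a).

(** The weight of the accepted words with at least one kept letter: the
    entirely erased words are subtracted. *)
Definition kept_series w (eta : series l) :=
  exists2 h, kept_system w h & eta = h 0%N - (accepted 0)%:R.

(** The matrix of the system, with its inhomogeneous part in column n. *)
Definition transfer (w : nat -> series l) s s' : series l :=
  if s' == n then (accepted s)%:R else
  \sum_(a <- flatten [seq [seq a <- iota 0 nX | dstep A (drun A s x) a == s'] | x <- EW]) w a.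

Lemma kept_system_transfer w h : kept_system w h ->
  forall s, (s < n)%N ->
    h s = transfer w s n + \sum_(0 <= s' < n) transfer w s s' * h s'.
Proof.
move=> H s hs; rewrite H // /transfer eqxx; congr (_ + _).
transitivity (\sum_(0 <= s' < n) \sum_(x <- EW)
   \sum_(a <- iota 0 nX | dstep A (drun A s x) a == s') w a * h s'); last first.
  apply: eq_big_nat => s' /andP[_ /ltn_eqF ->].
  rewrite [in RHS]mulr_suml [RHS]big_flatten [RHS]big_map. apply: eq_bigr => x _.
  by rewrite [RHS]big_filter.
rewrite [RHS]exchange_big. apply: eq_bigr => x _ /=.
rewrite [RHS](exchange_big_dep xpredT) //=. apply: eq_bigr => a _.
rewrite [RHS]big_mkcond (bigD1_seq (dstep A (drun A s x) a)) ?iota_uniq //=; last first.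
  by rewrite mem_index_iota dstep_lt.
rewrite eqxx big1 ?addr0 // => i /negPf; by rewrite eq_sym => ->.
Qed.

Lemma transfer_constfree w s s' : (forall a, constfree (w a)) ->
  (s' < n)%N -> constfree (transfer w s s').
Proof.
move=> w0 h; rewrite /constfree /transfer ltn_eqF // scoef_sum big1 // => a _.
exact: w0.
Qed.

(** Elimination expresses every solution in terms of the coefficients of the
    system alone. *)
Lemma kept_series_unique w eta eta' : (forall a, constfree (w a)) ->
  kept_series w eta -> kept_series w eta' -> eta = eta'.
Proof.
move=> w0 [h H ->] [h' H' ->]; congr (_ - _).
rewrite (eliminate_solve _ (kept_system_transfer H)) //;
  last by move=> *; exact: transfer_constfree.
by rewrite (eliminate_solve _ (kept_system_transfer H')) // => *; exact: transfer_constfree.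
Qed.

End Kept.

(** Substitution is a ring homomorphism, hence maps solutions of the system to
    solutions of the system with substituted weights. *)
Lemma kept_series_comp k l (q : 'I_k -> series l) A El nX w eta :
  (forall i, constfree (q i)) -> kept_series A El nX w eta ->
  kept_series A El nX (fun a => scomp q (w a)) (scomp q eta).
Proof.
move=> q0 [h H ->]; exists (fun s => scomp q (h s)).
  move=> s hs; rewrite H // scompD // scomp_nat // scomp_sum //.
  congr (_ + _); apply: eq_bigr => x _; rewrite scomp_sum //.
  by apply: eq_bigr => a _; rewrite scompM.
by rewrite scompD // scompN // scomp_nat.
Qed.

Definition fkept (A : dfa) (El : seq nat) nX (wt : nat -> ratcode) : ratcode :=
  let n := nstates A in
  let EW := words_upto El n in
  let t s := fnat (count (fun x => drun A s x \in A.2) EW) in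
  let m s s' := if s' == n then t s else
    fsum [seq wt a | a <- flatten
       [seq [seq a <- iota 0 nX | dstep A (drun A s x) a == s'] | x <- EW]] in
  fadd (entry (foldl (feliminate n)
                 [seq [seq m s s' | s' <- iota 0 n.+1] | s <- iota 0 n] (iota 0 n)) 0 n)
       (fopp (t 0%N)).

Lemma represents_kept k A El nX wt (w : nat -> series k) eta :
    (forall a, constfree (w a)) -> (forall a, (a < nX)%N -> represents (wt a) (w a)) ->
    kept_series A El nX w eta ->
  represents (fkept A El nX wt) eta.
Proof.
move=> w0 hw [h H ->]; apply: represents_add; last first.
  by apply: represents_opp; exact: represents_nat.
apply: (feliminate_solve (M := transfer A El nX w) (h := h)) => //.
- move=> s s' hs hs'; rewrite entry_mkseq // /transfer.
  case: eqP => _; first exact: represents_nat.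
  apply: represents_sum => a /flatten_mapP[x _]; rewrite mem_filter => /andP[_].
  by rewrite mem_iota; exact: hw.
- by move=> s s' _ hs'; exact: transfer_constfree.
- exact: kept_system_transfer.
Qed.

Local Close Scope ring_scope.

Lemma mem_words_of (Y : eqType) (s : seq Y) i w :
  (w \in words_of s i) = (size w == i) && all [in s] w.
Proof.
elim: i w => [|i IH] w /=; first by rewrite inE; case: w.
apply/flatten_mapP/andP => [[a ha /mapP[w' hw' ->]]|[]].
  by move: hw'; rewrite IH => /andP[/eqP <- h] /=; rewrite eqxx ha h.
case: w => // a w; rewrite /= eqSS => hs /andP[ha h]; exists a => //.
by rewrite map_f // IH hs.
Qed.

Lemma mem_words_upto (Y : eqType) (s : seq Y) n w :
  (w \in words_upto s n) = (size w < n) && all [in s] w.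
Proof.
apply/flatten_mapP/andP => [[i hi]|[h1 h2]].
  by rewrite mem_words_of => /andP[/eqP -> ->]; move: hi; rewrite mem_iota.
by exists (size w); rewrite ?mem_iota // mem_words_of eqxx.
Qed.

Lemma uniq_flatten_map (Y Z : eqType) (s : seq Y) (F : Y -> seq Z) :
  uniq s -> (forall y, uniq (F y)) ->
  (forall y y' z, y \in s -> y' \in s -> z \in F y -> z \in F y' -> y = y') ->
  uniq (flatten [seq F y | y <- s]).
Proof.
move=> us uF d; elim: s us d => //= y s IH /andP[ys us] d.
rewrite cat_uniq uF IH //=; last by move=> a b z ha hb; apply: d; rewrite inE (ha, hb) orbT.
rewrite andbT; apply/hasPn => z /flatten_mapP[y' hy' hz]; apply/negP => hz'.
by move: ys; rewrite (d y y' z) ?hy' // inE ?eqxx ?hy' ?orbT.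
Qed.

Lemma uniq_words_of (Y : eqType) (s : seq Y) i : uniq s -> uniq (words_of s i).
Proof.
move=> us; elim: i => //= i IH; apply: uniq_flatten_map => //.
  by move=> a; rewrite map_inj_uniq // => x y [].
by move=> a b w _ _ /mapP[x _ ->] /mapP[y _ []].
Qed.

Lemma uniq_words_upto (Y : eqType) (s : seq Y) n : uniq s -> uniq (words_upto s n).
Proof.
move=> us; apply: uniq_flatten_map; first exact: iota_uniq.
  by move=> i; exact: uniq_words_of.
by move=> i j w _ _; rewrite !mem_words_of => /andP[/eqP<- _] /andP[/eqP<- _].
Qed.

Lemma words_of_map (Y Z : Type) (f : Y -> Z) s i :
  words_of [seq f y | y <- s] i = [seq [seq f y | y <- w] | w <- words_of s i].
Proof.
elim: i => //= i IH; rewrite map_flatten -!map_comp IH; congr flatten.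
by apply: eq_map => a /=; rewrite -!map_comp.
Qed.

Lemma words_upto_map (Y Z : Type) (f : Y -> Z) s n :
  words_upto [seq f y | y <- s] n = [seq [seq f y | y <- w] | w <- words_upto s n].
Proof.
rewrite /words_upto map_flatten -map_comp; congr flatten.
by apply: eq_map => i; exact: words_of_map.
Qed.

Lemma drun_cat A s x y : drun A s (x ++ y) = drun A (drun A s x) y.
Proof. exact: foldl_cat. Qed.

(** A word at least as long as the number of states repeats a state, and the
    stretch between the repetitions can be removed. This is why bounding the length of
    erased stretches loses no derivable word. *)
Lemma shorten_run (A : dfa) (s : nat) (x : seq nat) : s < nstates A ->
  exists x', [/\ size x' < nstates A, {subset x' <= x} & drun A s x' = drun A s x].
Proof.
move=> hs; elim: {x}_.+1 {-2}x (ltnSn (size x)) => // k IH x hk.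
case: (ltnP (size x) (nstates A)) => hx; first by exists x; split.
pose st i := drun A s (take i x).
have: ~~ uniq [seq st i | i <- iota 0 (nstates A).+1].
  (* The states reached by the prefixes of x outnumber the states. *)
  apply/negP => us; have sub : {subset [seq st i | i <- iota 0 (nstates A).+1]
      <= iota 0 (nstates A)}.
    by move=> y /mapP[i _ ->]; rewrite mem_iota /= drun_lt.
  by have := uniq_leq_size us sub; rewrite size_map !size_iota ltnn.
move=> /(uniqPn 0)[i [j [ij]]]; rewrite size_map size_iota => hj.
rewrite !(nth_map 0) ?size_iota ?(ltn_trans ij hj) // !nth_iota ?(ltn_trans ij hj) //.
rewrite !add0n /st => e.
have hjx : j <= size x by rewrite (leq_trans _ hx) // -ltnS.
have [|x' [h1 h2 h3]] := IH (take i x ++ drop j x).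
  rewrite size_cat size_take size_drop ifT ?(leq_trans ij hjx) //.
  by move: hk ij hjx; clear; lia.
exists x'; split => //.
  by move=> y /h2; rewrite mem_cat => /orP[/mem_take|/mem_drop].
by rewrite h3 drun_cat e -drun_cat cat_take_drop.
Qed.

(** * Derivations and derivation trees *)

HB.instance Definition _ (Sigma V : Type) := gen_eqMixin (dtree Sigma V).

Section Grammar.
Variables (Sigma V T : finType) (E : et0l Sigma V T).
Notation X := (Sigma + V)%type.
Notation tree := (dtree Sigma V).

Definition langr (r : seq T) (a : X) (w : seq Sigma) : Prop :=
  derives E r [:: a] [seq inl b | b <- w].

Inductive spells (P : X -> seq Sigma -> Prop) : seq X -> seq Sigma -> Prop :=
| spells_nil : spells P [::] [::]
| spells_cons a u w w' : P a w -> spells P u w' -> spells P (a :: u) (w ++ w').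

Lemma rewrites_cat (Y : Type) (tau : Y -> lang Y) u1 u2 z :
  rewrites tau (u1 ++ u2) z <->
  exists z1 z2, [/\ z = z1 ++ z2, rewrites tau u1 z1 & rewrites tau u2 z2].
Proof.
elim: u1 z => [|a u1 IH] z /=.
  split=> [h|[z1 [z2 [-> h1 h2]]]]; first by exists [::], z; split => //; constructor.
  by inversion h1.
split=> [h|[z1 [z2 [-> h1 h2]]]].
  inversion h; subst; have [z1 [z2 [-> h1 h2]]] := (IH _).1 H3.
  by exists (u ++ z1), z2; split; rewrite ?catA //; constructor.
inversion h1; subst; rewrite -catA; constructor => //.
by apply/IH; exists w', z2.
Qed.

Lemma rewrites1 (Y : Type) (tau : Y -> lang Y) a z :
  rewrites tau [:: a] z <-> tau a z.
Proof.
split=> [h|h]; last by rewrite -[z]cats0; constructor => //; constructor.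
by inversion h; subst; inversion H3; subst; rewrite cats0.
Qed.

Lemma rewrites0 (Y : Type) (tau : Y -> lang Y) z :
  rewrites tau [::] z <-> z = [::].
Proof. by split=> [h|->]; [inversion h|constructor]. Qed.

Lemma derives_nil r z : derives E r [::] z <-> z = [::].
Proof.
elim: r z => [|t r IH] z /=; first by split.
split=> [[u /rewrites0 ->]|->]; first by rewrite IH.
by exists [::]; [constructor|rewrite IH].
Qed.

Lemma derives_cat r u1 u2 z : derives E r (u1 ++ u2) z <->
  exists z1 z2, [/\ z = z1 ++ z2, derives E r u1 z1 & derives E r u2 z2].
Proof.
elim: r u1 u2 z => [|t r IH] u1 u2 z /=.
  by split=> [<-|[z1 [z2 [-> -> ->]]]] //; exists u1, u2.
split=> [[y /rewrites_cat[y1 [y2 [-> h1 h2]]] /IH[z1 [z2 [-> k1 k2]]]]|].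
  by exists z1, z2; split => //; [exists y1|exists y2].
move=> [z1 [z2 [-> [y1 h1 k1] [y2 h2 k2]]]]; exists (y1 ++ y2).
  by apply/rewrites_cat; exists y1, y2.
by apply/IH; exists z1, z2.
Qed.

Lemma map_cat_inv (Y Z : Type) (f : Y -> Z) w z1 z2 : map f w = z1 ++ z2 ->
  exists w1 w2, [/\ w = w1 ++ w2, z1 = map f w1 & z2 = map f w2].
Proof.
elim: w z1 => [|a w IH] [|b z1] //=; try by [exists [::], [::]; split].
  by move=> <-; exists [::], (a :: w); split.
move=> [<- /IH[w1 [w2 [-> -> ->]]]]; by exists (a :: w1), w2.
Qed.

Lemma derives_spells r u w :
  derives E r u [seq inl b | b <- w] <-> spells (langr r) u w.
Proof.
elim: u w => [|a u IH] w.
  rewrite derives_nil; split=> [h|h]; last by inversion h.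
  by case: w h => // _; constructor.
rewrite -cat1s derives_cat; split=> [[z1 [z2 [/map_cat_inv[w1 [w2 [-> -> ->]]] h1 h2]]]|h].
  by constructor => //; apply/IH.
inversion h; subst; exists (map inl w0), (map inl w').
by split => //; [rewrite map_cat|apply/IH].
Qed.

Lemma langr_term r b w : langr r (inl b) w <-> w = [:: b].
Proof.
rewrite /langr; elim: r => [|t r IH] /=.
  by split=> [|->//]; case: w => // c [|//] [->].
rewrite -IH; split=> [[u /rewrites1/table_terminal -> //]|h].
by exists [:: inl b] => //; apply/rewrites1/table_terminal.
Qed.

Lemma langr_nil v w : ~ langr [::] (inr v) w.
Proof. by rewrite /langr /=; case: w. Qed.

Lemma langr_cons t r v w :
  langr (t :: r) (inr v) w <->
  exists2 u, table E t (inr v) u & spells (langr r) u w.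
Proof.
rewrite /langr /=; split=> [[u /rewrites1 h /derives_spells k]|[u h /derives_spells k]].
  by exists u.
by exists u => //; apply/rewrites1.
Qed.

Definition vtree r (a : X) (w : seq Sigma) (t : tree) : Prop :=
  [/\ label t = Some a, expanded_by E r t & tree_yield t = [seq inl b | b <- w]].

Definition vforest r (u : seq X) (w : seq Sigma) (f : seq tree) : Prop :=
  [/\ map (@label _ _) f = map Some u, forall t, t \in f -> expanded_by E r t
    & flatten (map (@tree_yield _ _) f) = [seq inl b | b <- w]].

Lemma vforest_nil r : vforest r [::] [::] [::].
Proof. by split. Qed.

Lemma vforest_cons r a u w w' t f :
  vtree r a w t -> vforest r u w' f -> vforest r (a :: u) (w ++ w') (t :: f).
Proof.
move=> [h1 h2 h3] [k1 k2 k3]; split; rewrite /= ?h1 ?k1 ?h3 ?k3 ?map_cat //.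
by move=> t'; rewrite inE => /orP[/eqP->|/k2].
Qed.

(** An empty expansion is recorded by the leaf [Eps]. *)
Lemma vtree_node t r v u w f : table E t (inr v) u ->
  vforest r u w f -> vtree (t :: r) (inr v) w (Node v (if f is [::] then [:: Eps] else f)).
Proof.
move=> hu [k1 k2 k3]; split => //=; last by case: f k1 k2 k3.
split.
  exists u => //; case: f k1 {k2 k3} => [|t0 f]; first by case: u {hu}.
  by case: u {hu} => [|a u] //= ->.
case: f k1 k2 k3 => [|t0 f] _ k2 _; first by case: r {k2} => [|? ?] [|[|?]].
by move=> i hi; apply: k2; exact: mem_nth.
Qed.

Lemma vtree_exists r a w : langr r a w -> exists t, vtree r a w t.
Proof.
elim: r a w => [|t r IH] [b|v] w.
- by move/langr_term => ->; exists (Term b).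
- by move/langr_nil.
- by move/langr_term => ->; exists (Term b).
move/langr_cons => [u hu hs].
suff [f hf] : exists f, vforest r u w f by eexists; exact: vtree_node hf.
elim: hs => [|a u' w1 w2 /IH[t1 h1] _ [f hf]]; first by exists [::]; exact: vforest_nil.
by exists (t1 :: f); exact: vforest_cons.
Qed.

End Grammar.

(** * Counting derivation trees *)

Definition rank (X : finType) (x : X) : nat := enum_rank x.

Lemma rank_inj (X : finType) : injective (@rank X).
Proof. by move=> x y /val_inj /enum_rank_inj. Qed.

Lemma map_rank_enum (X : finType) : [seq rank x | x <- enum X] = iota 0 #|X|.
Proof.
apply: (@eq_from_nth _ 0); first by rewrite size_map size_iota cardE.
move=> i; rewrite size_map -cardE => hi.
have x0 : X by move: hi; case: (pickP X) => [x _ //|e]; rewrite eq_card0.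
rewrite (nth_map x0) -?cardE // nth_iota // add0n /rank.
by rewrite -[i]/(val (Ordinal hi)) -(enum_val_nth x0) enum_valK.
Qed.

Lemma uniq_pairs (Y Z : eqType) (s : seq Y) (t : Y -> seq Z) :
  uniq s -> (forall y, uniq (t y)) -> uniq [seq (y, z) | y <- s, z <- t y].
Proof.
move=> us ut; apply: uniq_flatten_map => // [y|y y' p _ _ /mapP[z _ ->] /mapP[z' _ [->]] //].
by rewrite map_inj_uniq // => z z' [].
Qed.

Section Splits.
Variable l : nat.
Definition splits (m : 'X_{1..l}) : seq ('X_{1..l} * 'X_{1..l}) :=
  [seq (bmnm h.1, bmnm h.2) |
     h <- enum [pred h : 'X_{1..l < (mdeg m).+1, (mdeg m).+1} | m == (h.1 + h.2)%MM]].

Lemma mem_splits m m1 m2 : ((m1, m2) \in splits m) = (m == (m1 + m2)%MM).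
Proof.
apply/mapP/eqP => [[h]|e]; first by rewrite mem_enum inE => /eqP e [-> ->].
have h1 : mdeg m1 < (mdeg m).+1 by rewrite (mdeg_split e).
have h2 : mdeg m2 < (mdeg m).+1 by rewrite (mdeg_split e).
by exists (BMultinom h1, BMultinom h2) => //; rewrite mem_enum inE /=; apply/eqP.
Qed.

Lemma uniq_splits m : uniq (splits m).
Proof.
rewrite map_inj_uniq ?enum_uniq // => -[[a ha] [b hb]] [[c hc] [d hd]] /= [e1 e2].
by congr (_, _); apply: val_inj.
Qed.

Lemma fps_mul_splits (R : nzSemiRingType) (S S' : fps R l) m :
  fps_mul S S' m = (\sum_(h <- splits m) S h.1 * S' h.2)%R.
Proof. by rewrite /splits big_map big_enum. Qed.

End Splits.

Section Step.
Variables (Sigma V T : finType) (E : et0l Sigma V T).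
Notation X := (Sigma + V)%type.
Notation tree := (dtree Sigma V).
Variable l : nat.
Notation mon := 'X_{1..l}.

(** TL a m lists the derivation trees rooted at a whose yield has type m,
    where the predicate D says which yields are of which type. The type is the
    number of letters when series in z are wanted, and the letters alive at
    some fixed level when they are not yet expanded. Completeness asks for one
    tree only: uniqueness is a consequence of unambiguity, which holds at the
    root of full derivations but not at nonterminals that no derivation
    reaches. *)
Record counts (r : seq T) (TL : X -> mon -> seq tree)
    (D : X -> mon -> seq Sigma -> Prop) : Prop := Counts {
  counts_uniq : forall a m, uniq (TL a m);
  counts_sound : forall a m t, t \in TL a m -> exists2 w, vtree E r a w t & D a m w;
  counts_complete : forall a m w, D a m w ->
    exists2 t, t \in TL a m & tree_yield t = [seq inl b | b <- w];
  counts_disjoint : forall a m m' t, t \in TL a m -> t \in TL a m' -> m = m';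
  counts_nonempty : forall a m w, D a m w -> w <> [::] /\ m <> 0%MM }.

(** A letter of u either generates the empty word, and then contributes
    neither to the type nor to the yield, or is kept and contributes a
    nonempty word. *)
Inductive kept_spells (Ev : seq V) (D : X -> mon -> seq Sigma -> Prop) :
    seq X -> mon -> seq Sigma -> Prop :=
| kept_nil : kept_spells Ev D [::] 0%MM [::]
| kept_erase v u m w : v \in Ev -> kept_spells Ev D u m w ->
    kept_spells Ev D (inr v :: u) m w
| kept_keep a u m1 w1 m w : D a m1 w1 -> kept_spells Ev D u m w ->
    kept_spells Ev D (a :: u) (m1 + m)%MM (w1 ++ w).

Section Forests.
Variables (r : seq T) (TL : X -> mon -> seq tree) (D : X -> mon -> seq Sigma -> Prop).
Hypothesis HTL : counts r TL D.
Variables (Ev : seq V) (er : V -> tree).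
Hypothesis uEv : uniq Ev.
Hypothesis erP : forall v, v \in Ev -> vtree E r (inr v) [::] (er v).
Variable A : dfa.
Let n := nstates A.
Let EW := words_upto Ev n.
Let run s (u : seq X) := drun A s [seq rank x | x <- u].
Let runv s (x : seq V) := run s [seq inr v | v <- x].

(** A forest cut at its first tree with a nonempty yield. *)
Definition glue (p : seq V * (X * ((mon * mon) * (tree * seq tree)))) : seq tree :=
  [seq er v | v <- p.1] ++ p.2.2.2.1 :: p.2.2.2.2.

(** All choices of an erased stretch, of a kept letter, of a distribution of
    the type m, of a tree for the letter and of a forest for the rest. *)
Definition moves (F : nat -> mon -> seq (seq tree)) s m :=
  [seq (x, y) | x <- EW, y <-
    [seq (a, z) | a <- enum {: X}, z <-
      [seq (h, p) | h <- splits m, p <-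
        [seq (t, f) | t <- TL a h.1, f <- F (dstep A (runv s x) (rank a)) h.2]]]].

(** The recursion is on a bound d for the degree of m: every kept letter has a
    type different from 0. An erased letter v always gets the same tree er v. *)
Fixpoint forests d s m : seq (seq tree) :=
  if d is d'.+1 then
    (if m == 0%MM then [seq [seq er v | v <- x] | x <- EW & runv s x \in A.2] else [::])
    ++ [seq glue p | p <- moves (forests d') s m]
  else [::].

Lemma forestsS d s m : forests d.+1 s m =
  (if m == 0%MM then [seq [seq er v | v <- x] | x <- EW & runv s x \in A.2] else [::])
  ++ [seq glue p | p <- moves (forests d) s m].
Proof. by []. Qed.

Lemma mem_moves F s m x a h t f :
  (x, (a, (h, (t, f)))) \in moves F s m <->
  [/\ x \in EW, h \in splits m, t \in TL a h.1 &
      f \in F (dstep A (runv s x) (rank a)) h.2].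
Proof.
split=> [/allpairsPdep[x' [y [hx]]]|[h1 h2 h3 h4]].
  move=> /allpairsPdep[a' [z [_ /allpairsPdep[h' [p [hh /allpairsPdep[t' [f' [ht hf ->]]] ->]]] ->]]].
  by case=> -> -> -> -> ->.
apply/allpairsPdep; exists x, (a, (h, (t, f))); split => //.
apply/allpairsPdep; exists a, (h, (t, f)); split; rewrite ?mem_enum //.
apply/allpairsPdep; exists h, (t, f); split => //.
by apply/allpairsPdep; exists t, f; split.
Qed.

Lemma mem_forests d s m f : f \in forests d.+1 s m <->
  (exists x, [/\ m = 0%MM, x \in EW, runv s x \in A.2 & f = [seq er v | v <- x]]) \/
  (exists x a m1 m2 t f', [/\ x \in EW, m = (m1 + m2)%MM, t \in TL a m1,
     f' \in forests d (dstep A (runv s x) (rank a)) m2 &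
     f = [seq er v | v <- x] ++ t :: f']).
Proof.
rewrite forestsS mem_cat; split=> [/orP[]|[]].
- case: eqP => // -> /mapP[x]; rewrite mem_filter => /andP[h1 h2] ->.
  by left; exists x.
- move=> /mapP[[x [a [[m1 m2] [t f']]]]] /mem_moves[h1 h2 h3 h4] ->.
  right; exists x, a, m1, m2, t, f'; split => //.
  by apply/eqP; rewrite -mem_splits.
- move=> [x [-> h1 h2 ->]]; rewrite eqxx; apply/orP; left.
  by apply/mapP; exists x => //; rewrite mem_filter h2.
- move=> [x [a [m1 [m2 [t [f' [h1 h2 h3 h4 ->]]]]]]]; apply/orP; right.
  apply/mapP; exists (x, (a, ((m1, m2), (t, f')))) => //.
  by apply/mem_moves; split => //; rewrite mem_splits h2.
Qed.

Lemma EW_sub x : x \in EW -> {subset x <= Ev}.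
Proof. by rewrite mem_words_upto => /andP[_ /allP]. Qed.

Lemma er_spells x u m w f : {subset x <= Ev} ->
  kept_spells Ev D u m w -> vforest E r u w f ->
  kept_spells Ev D ([seq inr v | v <- x] ++ u) m w /\
  vforest E r ([seq inr v | v <- x] ++ u) w ([seq er v | v <- x] ++ f).
Proof.
elim: x => [|v x IH] //= hx h1 h2.
have [|k1 k2] := IH _ h1 h2; first by move=> y hy; apply: hx; rewrite inE hy orbT.
have hv : v \in Ev by apply: hx; rewrite inE eqxx.
by split; [constructor|rewrite -[w]cat0s; apply: vforest_cons => //; exact: erP].
Qed.

Lemma forests_sound d s m f : f \in forests d s m ->
  exists u w, [/\ run s u \in A.2, kept_spells Ev D u m w & vforest E r u w f].
Proof.
elim: d s m f => // d IH s m f /mem_forests[].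
  move=> [x [-> hx hr ->]].
  have [||k1 k2] := er_spells (EW_sub hx) (w := [::]) (u := [::]) (m := 0%MM) (f := [::]).
  - exact: kept_nil.
  - exact: vforest_nil.
  rewrite !cats0 in k1 k2; by exists [seq inr v | v <- x], [::].
move=> [x [a [m1 [m2 [t [f' [hx -> ht /IH[u [w [h1 h2 h3]]] ->]]]]]]].
have [w1 hv hD] := counts_sound HTL ht.
have [||k1 k2] := er_spells (EW_sub hx) (w := w1 ++ w) (u := a :: u)
  (m := (m1 + m2)%MM) (f := t :: f').
- exact: kept_keep.
- exact: vforest_cons.
exists ([seq inr v | v <- x] ++ a :: u), (w1 ++ w); split => //.
by rewrite /run map_cat drun_cat.
Qed.

Definition is_nonempty (t : tree) := tree_yield t != [::].

Lemma er_empty v : v \in Ev -> ~~ is_nonempty (er v).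
Proof. by case/erP => _ _ /= h; rewrite /is_nonempty h. Qed.

Lemma TL_nonempty a m t : t \in TL a m -> is_nonempty t.
Proof.
case/(counts_sound HTL) => w [_ _ h] /(counts_nonempty HTL)[h' _].
by rewrite /is_nonempty h; case: w h' {h}.
Qed.

Lemma has_er x : {subset x <= Ev} -> ~~ has is_nonempty [seq er v | v <- x].
Proof. by move=> hx; apply/hasPn => t /mapP[v /hx hv ->]; exact: er_empty. Qed.

Lemma er_map_inj x x' : {subset x <= Ev} -> {subset x' <= Ev} ->
  [seq er v | v <- x] = [seq er v | v <- x'] -> x = x'.
Proof.
elim: x x' => [|v x IH] [|v' x'] //= h h' [e1 e2].
have [|e3 _ _] := @erP v _; first by apply: h; rewrite inE eqxx.
have [|e4 _ _] := @erP v' _; first by apply: h'; rewrite inE eqxx.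
move: e3; rewrite e1 e4 => -[->]; congr cons; apply: IH => //.
  by move=> y hy; apply: h; rewrite inE hy orbT.
by move=> y hy; apply: h'; rewrite inE hy orbT.
Qed.

(** The cut is determined by the forest, because erased trees have an empty
    yield and kept trees have not. This makes the enumeration free of
    repetitions. *)
Lemma glue_inj x t f x' t' f' : {subset x <= Ev} -> {subset x' <= Ev} ->
  is_nonempty t -> is_nonempty t' ->
  [seq er v | v <- x] ++ t :: f = [seq er v | v <- x'] ++ t' :: f' ->
  [/\ x = x', t = t' & f = f'].
Proof.
move=> hx hx' ht ht' e.
have := congr1 (find is_nonempty) e.
rewrite !find_cat !(negPf (has_er _)) //= ht ht' !addn0 !size_map => es.
have e1 := congr1 (take (size x)) e; have e2 := congr1 (drop (size x)) e.
rewrite -{1}(size_map er x) take_size_cat // es -(size_map er x') take_size_cat // in e1.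
rewrite -{1}(size_map er x) drop_size_cat // es -(size_map er x') drop_size_cat // in e2.
by case: e2 => -> ->; split => //; exact: er_map_inj.
Qed.

Lemma glue_er x t f x' : {subset x' <= Ev} -> is_nonempty t ->
  [seq er v | v <- x] ++ t :: f <> [seq er v | v <- x'].
Proof.
move=> hx' ht e; have := has_er hx'; rewrite -e has_cat /= ht orbT //.
Qed.

Lemma label_TL a m t : t \in TL a m -> label t = Some a.
Proof. by case/(counts_sound HTL) => w []. Qed.

Lemma forests_disjoint d d' s s' m m' f :
  f \in forests d s m -> f \in forests d' s' m' -> m = m'.
Proof.
elim: d d' s s' m m' f => // d IH [|d'] s s' m m' f // /mem_forests[].
  move=> [x [-> hx hr ->]] /mem_forests[[x' [-> //]]|].
  move=> [x' [a [m1 [m2 [t [f' [hx' _ ht _]]]]]]] /esym e.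
  by have := glue_er (EW_sub hx) (TL_nonempty ht) e.
move=> [x [a [m1 [m2 [t [f0 [hx -> ht hf ->]]]]]]] /mem_forests[].
  move=> [x' [_ hx' _ e]]; by have := glue_er (EW_sub hx') (TL_nonempty ht) e.
move=> [x' [a' [m1' [m2' [t' [f0' [hx' -> ht' hf' e]]]]]]].
have [ex et ef] := glue_inj (EW_sub hx) (EW_sub hx') (TL_nonempty ht) (TL_nonempty ht') e.
subst x' t' f0'; have ea : a = a' by move: (label_TL ht); rewrite (label_TL ht') => -[].
subst a'; by rewrite (counts_disjoint HTL ht ht') (IH _ _ _ _ _ _ hf hf').
Qed.

Lemma forests_uniq d s m : uniq (forests d s m).
Proof.
elim: d s m => // d IH s m; rewrite forestsS cat_uniq; apply/and3P; split.
- case: eqP => // _; rewrite map_inj_in_uniq ?filter_uniq ?uniq_words_upto //.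
  move=> x x'; rewrite !mem_filter => /andP[_ /EW_sub h] /andP[_ /EW_sub h'].
  exact: er_map_inj.
- apply/hasPn => f /mapP[[x [a [h [t f']]]] /mem_moves[h1 h2 h3 h4] ->].
  apply/negP; case: eqP => // _ /mapP[x']; rewrite mem_filter => /andP[_ /EW_sub hx'].
  exact: (glue_er hx' (TL_nonempty h3)).
rewrite map_inj_in_uniq.
  apply: uniq_pairs => [|x]; first exact: uniq_words_upto.
  apply: uniq_pairs => [|a]; first exact: enum_uniq.
  apply: uniq_pairs => [|h]; first exact: uniq_splits.
  by apply: uniq_pairs => // ; exact: (counts_uniq HTL).
move=> [x [a [[m1 m2] [t f]]]] [x' [a' [[m1' m2'] [t' f']]]].
move=> /mem_moves[hx /= hh ht hf] /mem_moves[hx' /= hh' ht' hf'] e.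
have [ex et ef] := glue_inj (EW_sub hx) (EW_sub hx') (TL_nonempty ht) (TL_nonempty ht') e.
move: ex et ef => /= ex et ef.
subst x' t' f'; have ea : a = a' by move: (label_TL ht); rewrite (label_TL ht') => -[].
subst a'; have em := counts_disjoint HTL ht ht'; subst m1'.
by rewrite (forests_disjoint hf hf').
Qed.

(** An accepted word may have erased stretches too long for the enumeration.
    While the word is read, x collects the current stretch, which is replaced
    by a short one with the same effect on the state when the stretch ends. *)
Lemma forests_complete u m w : kept_spells Ev D u m w ->
  forall d s x, mdeg m < d -> s < n -> {subset x <= Ev} -> run (runv s x) u \in A.2 ->
  exists2 f, f \in forests d s m & flatten (map (@tree_yield _ _) f) = [seq inl b | b <- w].
Proof.
(* The letters of the shortened word are among those of x, so it is again
   the image of a word over Ev. *)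
have shorten s x : s < n -> {subset x <= Ev} ->
    exists2 x', x' \in EW & runv s x' = runv s x.
  move=> hs hx; have [x' [h1 h2 h3]] := shorten_run [seq rank (inr v : X) | v <- x] hs.
  have [y [ey hy]] : exists y, x' = [seq rank (inr v : X) | v <- y] /\ {subset y <= Ev}.
    elim: x' h2 {h1 h3} => [|b x' IH] h2; first by exists [::].
    have [|y [-> hy]] := IH; first by move=> c hc; apply: h2; rewrite inE hc orbT.
    have /mapP[v hv ->] := h2 b (mem_head _ _); exists (v :: y); split => // c.
    by rewrite inE => /orP[/eqP->|/hy //]; exact: hx.
  exists y; last by rewrite /runv /run -!map_comp -[in LHS]/(_ \o _) -ey h3.
  rewrite mem_words_upto; apply/andP; split; last exact/allP.
  by move: h1; rewrite ey size_map.
have erflat x f : {subset x <= Ev} ->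
    flatten (map (@tree_yield _ _) ([seq er v | v <- x] ++ f)) = flatten (map (@tree_yield _ _) f).
  elim: x => //= v x IH hx; rewrite IH; last by move=> y hy; apply: hx; rewrite inE hy orbT.
  have [|_ _ /= ->] := @erP v _ => //; by apply: hx; rewrite inE eqxx.
elim=> {u m w} [d s x hd hs hx hr|v u m w hv _ IH d s x hd hs hx hr
    |a u m1 w1 m w hD _ IH d s x hd hs hx hr].
- have [x' hx' e] := shorten s x hs hx; case: d hd => // d hd.
  exists [seq er v | v <- x'].
    by apply/mem_forests; left; exists x'; rewrite e; split.
  by rewrite -[map er x']cats0 erflat //; exact: EW_sub.
- apply: (IH d s (rcons x v)) => //.
    by move=> y; rewrite mem_rcons inE => /orP[/eqP->|/hx].
  by move: hr; rewrite /runv /run map_rcons map_rcons -cats1 drun_cat.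
have [x' hx' e] := shorten s x hs hx; case: d hd => // d hd.
have [t ht et] := counts_complete HTL hD.
have dm : mdeg m < d.
  have [_ m1n] := counts_nonempty HTL hD.
  have : 0 < mdeg m1 by rewrite lt0n mdeg_eq0; apply/eqP.
  by move: hd; rewrite mdegD; lia.
have [|||f hf ef] := IH d (dstep A (runv s x) (rank a)) [::] dm => //.
  exact: dstep_lt.
exists ([seq er v | v <- x'] ++ t :: f).
  by apply/mem_forests; right; exists x', a, m1, m, t, f; rewrite e; split.
by rewrite erflat; [rewrite /= et ef map_cat|exact: EW_sub].
Qed.

Definition forest_series s : fps nat l := fun m => size (forests (mdeg m).+1 s m).

Lemma TL0 a : TL a 0%MM = [::].
Proof.
case e : (TL a 0%MM) => [|t f] //.
have : t \in TL a 0%MM by rewrite e mem_head.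
by case/(counts_sound HTL) => w _ /(counts_nonempty HTL)[].
Qed.

Lemma size_forestsS d s m : size (forests d.+1 s m) =
  ((m == 0%MM) * count (fun x => runv s x \in A.2) EW +
  \sum_(x <- EW) \sum_(a <- enum {: X}) \sum_(h <- splits m)
    size (TL a h.1) * size (forests d (dstep A (runv s x) (rank a)) h.2))%N.
Proof.
rewrite forestsS size_cat; congr addn.
  by case: eqP; rewrite ?mul0n ?mul1n // size_map size_filter.
rewrite size_map size_allpairs_dep sumnE big_map; apply: eq_bigr => x _.
rewrite size_allpairs_dep sumnE big_map; apply: eq_bigr => a _.
rewrite size_allpairs_dep sumnE big_map; apply: eq_bigr => h _.
by rewrite size_allpairs.
Qed.

Lemma size_forests_fuel d s m : mdeg m < d -> size (forests d s m) = forest_series s m.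
Proof.
rewrite /forest_series; elim: d {-2}d (leqnn d) s m => [|k IH] [|d] // hk s m hm.
rewrite !size_forestsS; congr addn.
apply: eq_bigr => x _; apply: eq_bigr => a _.
apply: eq_big_seq => -[m1 m2]; rewrite mem_splits => /eqP e /=.
have [->|m10] := eqVneq m1 0%MM; first by rewrite TL0 !mul0n.
have hm2 : mdeg m2 < mdeg m by rewrite e mdegD -[X in X < _]add0n ltn_add2r lt0n mdeg_eq0.
congr muln; have hmd : mdeg m <= d by [].
rewrite (IH d) // ?(leq_trans hm2) // (IH (mdeg m)) //.
exact: leq_trans hmd hk.
Qed.

(** The cut at the first kept letter gives the linear system of the automaton. *)
Lemma forest_seriesE s m : forest_series s m =
  ((m == 0%MM) * count (fun x => runv s x \in A.2) EW +
  \sum_(x <- EW) \sum_(a <- enum {: X})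
    fps_mul (fun m => size (TL a m)) (forest_series (dstep A (runv s x) (rank a))) m)%N.
Proof.
rewrite /forest_series size_forestsS; congr addn.
apply: eq_bigr => x _; apply: eq_bigr => a _; rewrite fps_mul_splits.
apply: eq_big_seq => -[m1 m2]; rewrite mem_splits => /eqP e /=.
have [->|m10] := eqVneq m1 0%MM; first by rewrite TL0 mul0n mul0r.
have hm2 : mdeg m2 < mdeg m by rewrite e mdegD -[X in X < _]add0n ltn_add2r lt0n mdeg_eq0.
by rewrite size_forests_fuel.
Qed.

End Forests.
End Step.

Lemma scoef_nat l c m : ((c%:R)%R : series l) m = (c%:Z * (m == 0%MM)%:R)%R.
Proof.
elim: c => [|c IH]; first by rewrite mul0r.
by rewrite -addn1 natrD scoefD IH mulr1n scoef1 PoszD mulrDl mul1r.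
Qed.

Section StepTheorem.
Variables (Sigma V T : finType) (E : et0l Sigma V T).
Notation X := (Sigma + V)%type.
Notation tree := (dtree Sigma V).
Variable l : nat.
Notation mon := 'X_{1..l}.
Implicit Types (TL : X -> mon -> seq tree) (D : X -> mon -> seq Sigma -> Prop).

Definition tree_series TL a : series l := zser (fun m => size (TL a m)).

Definition expand tau Ev D (a : X) m w : Prop :=
  match a with
  | inl b => D (inl b) m w
  | inr v => m <> 0%MM /\ exists2 u, table E tau (inr v) u & kept_spells Ev D u m w
  end.

Lemma kept_spells_nonempty r TL D Ev u m w : counts E r TL D ->
  kept_spells Ev D u m w -> m <> 0%MM -> w <> [::].
Proof.
move=> H; elim=> {u m w} // a u m1 w1 m w hD _ _ _.
by have [h _] := counts_nonempty H hD; case: w1 h {hD}.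
Qed.

Lemma vtree_term r r' b w t : vtree E r (inl b) w t -> vtree E r' (inl b) w t.
Proof. by case: t => [|c|v ts] [] //= hl _ h; split => //; case: r'. Qed.

Lemma tree_series_constfree r TL D a : counts E r TL D -> constfree (tree_series TL a).
Proof. by move=> H; rewrite /constfree /tree_series /zser (TL0 H). Qed.

(** Prepending a table to the control transforms lists of trees of the letters
    of the right-hand sides into lists of trees of the nonterminals, and their
    generating functions by a rational operation. *)
Lemma counts_step r TL D Ev tau (A : V -> dfa) : counts E r TL D -> uniq Ev ->
    (forall v, v \in Ev -> langr E r (inr v) [::]) ->
    (forall v, recognizes (A v) (table E tau (inr v))) ->
  exists TL', [/\ counts E (tau :: r) TL' (expand tau Ev D),
    forall b m, TL' (inl b) m = TL (inl b) m &
    forall (om : nat -> series l) v, (forall a : X, om (rank a) = tree_series TL a) ->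
      kept_series (A v) [seq rank (inr v : X) | v <- Ev] #|{: X}| om
        (tree_series TL' (inr v))].
Proof.
move=> H uEv hE hA.
have [er erP] : exists er : V -> tree, forall v, v \in Ev -> vtree E r (inr v) [::] (er v).
  have /fin_all_exists[f hf] : forall v, exists t : tree, v \in Ev -> vtree E r (inr v) [::] t.
    move=> v; case: (boolP (v \in Ev)) => hv; last by exists Eps.
    by have [t ht] := vtree_exists (hE v hv); exists t.
  by exists f.
pose F v := forests TL Ev er (A v).
pose TL' (a : X) (m : mon) : seq tree := match a with
  | inl b => TL (inl b) m
  | inr v => if m == 0%MM then [::] else [seq Node v f | f <- F v (mdeg m).+1 0 m]
  end.
have mem_TL' v m t : t \in TL' (inr v) m <->
    [/\ m <> 0%MM & exists2 f, f \in F v (mdeg m).+1 0 m & t = Node v f].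
  rewrite /TL'; case: eqP => [->|hm]; first by split=> // -[].
  split=> [/mapP[f hf ->]|[_ [f hf ->]]]; first by split => //; exists f.
  by apply/mapP; exists f.
exists TL'; split=> //; first split.
- case=> [b|v] m; first exact: (counts_uniq H).
  rewrite /TL'; case: eqP => // _; rewrite map_inj_uniq ?(forests_uniq H uEv erP) //.
  by move=> x y [].
- case=> [b|v] m t.
    move=> /(counts_sound H)[w h hD]; exists w => //; exact: vtree_term h.
  move=> /mem_TL'[hm [f /(forests_sound H erP)[u [w [h1 h2 h3]]] ->]].
  exists w; last by split => //; exists u => //; apply/hA.
  have := @vtree_node _ _ _ E tau r v u w f ((hA v u).2 h1) h3.
  case: f h3 => // -[h4 _ _]; case: u h1 h2 h4 => // _ h2.
  by inversion h2; subst.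
- case=> [b|v] m w; first exact: (counts_complete H).
  move=> [hm [u hu hs]].
  have [||||f hf e] := forests_complete (A := A v) H uEv erP hs (d := (mdeg m).+1) (s := 0) (x := [::]).
  - exact: ltnSn.
  - by [].
  - by [].
  - exact: ((hA v u).1 hu).
  exists (Node v f); first by apply/mem_TL'; split => //; exists f.
  have := kept_spells_nonempty H hs hm.
  by move: e; case: f {hf} => //=; case: w {hs}.
- case=> [b|v] m m' t; first exact: (counts_disjoint H).
  move=> /mem_TL'[hm [f hf ->]] /mem_TL'[hm' [f' hf' [ef]]]; subst f'.
  exact: (forests_disjoint H erP hf hf').
- case=> [b|v] m w; first exact: (counts_nonempty H).
  by move=> [hm [u _ hs]]; split => //; exact: (kept_spells_nonempty H hs).
move=> om v hom; rewrite /kept_series.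
pose EW := words_upto Ev (nstates (A v)).
have EWE : words_upto [seq rank (inr v : X) | v <- Ev] (nstates (A v)) =
    [seq [seq rank (inr v : X) | v <- x] | x <- EW] by exact: words_upto_map.
have runE s x : drun (A v) s [seq rank x | x <- [seq (inr v : X) | v <- x]] =
    drun (A v) s [seq rank (inr v : X) | v <- x] by rewrite -map_comp.
have accE s : accepted (A v) [seq rank (inr v : X) | v <- Ev] s =
   count (fun x => drun (A v) s [seq rank x | x <- [seq (inr v : X) | v <- x]] \in (A v).2) EW.
  by rewrite /accepted EWE count_map; apply: eq_count => x /=; rewrite runE.
exists (fun s => zser (forest_series TL Ev er (A v) s)).
  move=> s hs; apply: funext => m; rewrite scoefD /zser (forest_seriesE H) PoszD.
  congr (_ + _)%R.
    rewrite accE; move: (count _ _) => c; rewrite PoszM.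
    by rewrite scoef_nat mulrC; case: eqP.
  rewrite EWE big_map scoef_sum (big_morph Posz PoszD (erefl _)).
  apply: eq_bigr => x _; rewrite -map_rank_enum scoef_sum [RHS]big_map.
  rewrite (big_morph Posz PoszD (erefl _)); apply: eq_bigr => a _.
  rewrite hom /tree_series -[(_ * _)%R]zser_mul /zser runE //.
apply: funext => m; rewrite scoefB /tree_series /zser accE.
rewrite scoef_nat /TL'; case: eqP => [->|_]; last by rewrite mulr0 subr0 size_map.
rewrite mulr1 (forest_seriesE H) eqxx mul1n big1 ?addn0 ?subrr // => x _.
rewrite big1 // => a _; rewrite fps_mul_splits big1_seq // => -[m1 m2].
rewrite mem_splits => /andP[_ /eqP/esym/eqP]; rewrite mnmD_eq0 => /andP[/eqP-> _].
by rewrite (TL0 H) mul0r.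
Qed.
End StepTheorem.

(** * Nonterminals with empty and with nonempty descendants *)

Lemma rankE (X : finType) (x : X) : rank x = index x (enum X).
Proof. by rewrite -[x in RHS](nth_enum_rank x) index_uniq ?enum_uniq // -cardE. Qed.

Lemma rank_lt (X : finType) (x : X) : rank x < #|X|.
Proof. exact: ltn_ord. Qed.

Lemma enum_sum (S V : finType) :
  enum {: S + V} = [seq inl s | s <- enum S] ++ [seq inr v | v <- enum V].
Proof. by rewrite !enumT [in LHS]Finite.enum.unlock. Qed.

Lemma rank_inl (S V : finType) (s : S) : rank (inl s : S + V) = rank s.
Proof.
rewrite !rankE enum_sum index_cat map_f ?mem_enum // index_map //.
by move=> x y [].
Qed.

Lemma rank_inr (S V : finType) (v : V) : rank (inr v : S + V) = #|S| + rank v.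
Proof.
rewrite !rankE enum_sum index_cat ifF; last by apply/mapP => -[].
by rewrite size_map -cardE index_map // => x y [].
Qed.

Lemma rank_surj (X : finType) i : i < #|X| -> exists x : X, i = rank x.
Proof.
move=> h; have : i \in [seq rank x | x <- enum X] by rewrite map_rank_enum mem_iota.
by case/mapP => x _ ->; exists x.
Qed.

Lemma map_preim (Y : Type) (Z : eqType) (f : Y -> Z) (G : Y -> Prop) (x : seq Z) :
  (forall c, c \in x -> exists2 a, c = f a & G a) ->
  exists2 u, x = map f u & List.Forall G u.
Proof.
elim: x => [|c x IH] h; first by exists [::].
have [|u -> hu] := IH; first by move=> d hd; apply: h; rewrite inE hd orbT.
have [a -> ha] := h c (mem_head _ _); by exists (a :: u) => //; constructor.
Qed.

Definition erased_letters nS (s : seq nat * seq nat) := [seq nS + i | i <- s.1].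
(** The letters that generate some nonempty terminal word. *)
Definition live_letters nS (s : seq nat * seq nat) :=
  iota 0 nS ++ [seq nS + i | i <- s.2].
Definition accepts_erased nS A s := has (fun x => drun A 0 x \in A.2)
  (words_upto (erased_letters nS s) (nstates A)).
(** Some accepted word over the letters that generate a terminal word contains
    a letter that generates a nonempty one. The parts of the word before and
    after that letter can be shortened independently. *)
Definition accepts_kept nS A s :=
  let W := words_upto (live_letters nS s ++ erased_letters nS s) (nstates A) in
  has (fun x => has (fun a => has (fun y =>
    drun A (dstep A (drun A 0 x) a) y \in A.2) W) (live_letters nS s)) W.
(** A pair holds the nonterminals that generate the empty word and those that
    generate a nonempty terminal word. The pair for tau :: r depends only on
    the pair for r, hence the sequence of these pairs along the powers of a
    table is eventually periodic. *)
Definition sign_step (nS N : nat) (A : nat -> dfa) (s : seq nat * seq nat) :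
    seq nat * seq nat :=
  ([seq i <- iota 0 N | accepts_erased nS (A i) s],
   [seq i <- iota 0 N | accepts_kept nS (A i) s]).

Section Signs.
Variables (Sigma V T : finType) (E : et0l Sigma V T).
Notation X := (Sigma + V)%type.

Definition nonempty_at r (a : X) := exists2 w, w <> [::] & langr E r a w.

(** A normal form, which makes equal sets of nonterminals equal lists and
    bounds their number. *)
Definition sublist_of_iota N (s : seq nat) := s = [seq i <- iota 0 N | i \in s].

Definition signs r (s : seq nat * seq nat) : Prop :=
  [/\ sublist_of_iota #|V| s.1, sublist_of_iota #|V| s.2,
      forall v, (rank v \in s.1) <-> langr E r (inr v) [::]
    & forall v, (rank v \in s.2) <-> nonempty_at r (inr v)].

Lemma signs_nil : signs [::] ([::], [::]).
Proof.
have nil N : sublist_of_iota N [::] by rewrite /sublist_of_iota; elim: (iota _ _).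
split; [exact: nil|exact: nil| |] => v; split=> //.
by case=> w _ /langr_nil.
Qed.

Lemma sublist_filter N p : sublist_of_iota N [seq i <- iota 0 N | p i].
Proof.
rewrite /sublist_of_iota; apply: eq_in_filter => i hi.
by rewrite mem_filter hi andbT.
Qed.

Lemma spells_erased r u : spells (langr E r) u [::] <->
  List.Forall (fun a => langr E r a [::]) u.
Proof.
split.
  move e: [::] => w h; elim: h e => // a u' w1 w2 h _ IH /esym/nilP.
  by rewrite /nilp size_cat addn_eq0 => /andP[/nilP e1 /nilP e2]; subst;
  constructor => //; exact: IH.
by elim=> [|a u' h _ IH]; [constructor|rewrite -[[::]]cat0s; constructor].
Qed.

Lemma spells_cat r u1 u2 w1 w2 : spells (langr E r) u1 w1 ->
  spells (langr E r) u2 w2 -> spells (langr E r) (u1 ++ u2) (w1 ++ w2).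
Proof. by elim=> //= a u w w' h _ IH /IH k; rewrite -catA; constructor. Qed.

Definition somehow r (a : X) := exists w, langr E r a w.

Lemma spells_somehow r u : List.Forall (somehow r) u <-> exists w, spells (langr E r) u w.
Proof.
split; first by elim=> [|a u' [w h] _ [w' h']]; [exists [::]|exists (w ++ w')]; constructor.
by case=> w; elim=> [|a u' w1 w2 h _ IH]; constructor => //; exists w1.
Qed.

Lemma spells_nonempty r u :
  (exists2 w, w <> [::] & spells (langr E r) u w) <->
  exists u1 a u2, [/\ u = u1 ++ a :: u2, List.Forall (somehow r) u1,
    nonempty_at r a & List.Forall (somehow r) u2].
Proof.
split=> [[w hw h]|[u1 [a [u2 [-> /spells_somehow[w1 h1] [w hw h] /spells_somehow[w2 h2]]]]]].
  elim: h hw => // a u' w1 w2 h hs IH hw.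
  have [e|ne] := pselect (w1 = [::]).
    have [|u1 [a' [u2 [-> h1 h2 h3]]]] := IH; first by move=> e2; apply: hw; rewrite e e2.
    by exists (a :: u1), a', u2; split => //; constructor => //; exists w1.
  exists [::], a, u'; split => //; first by exists w1.
  by apply/spells_somehow; exists w2.
exists (w1 ++ (w ++ w2)); last by apply: spells_cat => //; constructor.
by case: w1 {h1} => //; case: w hw {h}.
Qed.

Lemma signs_step r s tau (A : nat -> dfa) : signs r s ->
  (forall v, recognizes (A (rank v)) (table E tau (inr v))) ->
  signs (tau :: r) (sign_step #|Sigma| #|V| A s).
Proof.
move=> [f1 f2 hE hF] hA.
have memE c : (c \in erased_letters #|Sigma| s) <-> exists2 a : X, c = rank a & langr E r a [::].
  split=> [/mapP[i hi ->]|[[b|v] ->]].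
  - have : i < #|V| by move: hi; rewrite f1 mem_filter mem_iota => /andP[].
    by move=> /rank_surj[v ev]; exists (inr v); [rewrite rank_inr ev|apply/hE; rewrite -ev].
  - by move/langr_term.
  - by rewrite -hE rank_inr => h; apply: map_f.
have memK c : (c \in live_letters #|Sigma| s) <-> exists2 a : X, c = rank a & nonempty_at r a.
  rewrite mem_cat mem_iota add0n; split=> [/orP[|/mapP[i hi ->]]|[[b|v] ->]].
  - move=> /rank_surj[b ->]; exists (inl b); first by rewrite rank_inl.
    by exists [:: b] => //; apply/langr_term.
  - have : i < #|V| by move: hi; rewrite f2 mem_filter mem_iota => /andP[].
    by move=> /rank_surj[v ev]; exists (inr v); [rewrite rank_inr ev|apply/hF; rewrite -ev].
  - by rewrite rank_inl rank_lt.
  - by rewrite -hF rank_inr => h; rewrite map_f ?orbT.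
pose P := live_letters #|Sigma| s ++ erased_letters #|Sigma| s.
have memP c : (c \in P) <-> exists2 a : X, c = rank a & somehow r a.
  rewrite mem_cat; split=> [/orP[/memK[a -> [w _ h]]|/memE[a -> h]]|[a -> [w h]]].
  - by exists a => //; exists w.
  - by exists a => //; exists [::].
  have [e|ne] := pselect (w = [::]); apply/orP; [right|left].
    by apply/memE; exists a; rewrite -?e.
  by apply/memK; exists a => //; exists w.
have toP (G : X -> Prop) (L : seq nat) u : (forall c, (c \in L) <-> exists2 a : X, c = rank a & G a) ->
    List.Forall G u -> {subset [seq rank a | a <- u] <= L}.
  move=> hL; elim=> //= a u' ha _ IH c; rewrite inE => /orP[/eqP->|/IH //].
  by apply/hL; exists a.
have memfil i p : (i \in [seq i <- iota 0 #|V| | p i]) = p i && (i < #|V|).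
  by rewrite mem_filter mem_iota.
split; [exact: sublist_filter|exact: sublist_filter| |].
- move=> v; rewrite /sign_step [(_, _).1]/= memfil rank_lt andbT langr_cons /accepts_erased.
  set B := A (rank v).
  split=> [/hasP[x]|[u hu /spells_erased hs]].
    rewrite mem_words_upto => /andP[_ /allP hx] hacc.
    have [|u e hu] := map_preim (f := @rank X) (G := fun a => langr E r a [::]) (x := x).
      by move=> c /hx /memE.
    by exists u; [apply/(hA v); rewrite /dfa_accepts -e|apply/spells_erased].
  have [x' [h1 h2 h3]] := shorten_run (A := B) [seq rank a | a <- u] (ltn0Sn _ : 0 < nstates B).
  apply/hasP; exists x'; last by rewrite h3; exact: (hA v u).1 hu.
  rewrite mem_words_upto h1 /=; apply/allP => c /h2; exact: (toP _ _ _ memE hs).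
move=> v; rewrite /sign_step [(_, _).2]/= memfil rank_lt andbT /accepts_kept.
set B := A (rank v); set W := words_upto _ _.
have -> : nonempty_at (tau :: r) (inr v) <-> exists2 u, table E tau (inr v) u &
    exists2 w, w <> [::] & spells (langr E r) u w.
  split=> [[w hw /langr_cons[u hu hs]]|[u hu [w hw hs]]]; first by exists u => //; exists w.
  by exists w => //; apply/langr_cons; exists u.
split=> [/hasP[x]|[u hu /spells_nonempty[u1 [a [u2 [e h1 h2 h3]]]]]].
  rewrite mem_words_upto => /andP[_ /allP hx] /hasP[c /memK[a -> ha] /hasP[y]].
  rewrite mem_words_upto => /andP[_ /allP hy] hacc.
  have [|u1 e1 h1] := map_preim (f := @rank X) (G := somehow r) (x := x).
    by move=> d /hx /memP.
  have [|u2 e2 h2] := map_preim (f := @rank X) (G := somehow r) (x := y).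
    by move=> d /hy /memP.
  exists (u1 ++ a :: u2); last by apply/spells_nonempty; exists u1, a, u2.
  by apply/(hA v); rewrite /dfa_accepts map_cat foldl_cat /= -e1 -e2.
have [x [x1 x2 x3]] := shorten_run (A := B) [seq rank a | a <- u1] (ltn0Sn _ : 0 < nstates B).
have [y [y1 y2 y3]] := shorten_run (A := B) [seq rank a | a <- u2]
  (dstep_lt B (drun B 0 x) (rank a)).
apply/hasP; exists x; first by rewrite mem_words_upto x1 /=; apply/allP => c /x2; exact: (toP _ _ _ memP h1).
apply/hasP; exists (rank a); first by apply/memK; exists a.
apply/hasP; exists y; first by rewrite mem_words_upto y1 /=; apply/allP => c /y2; exact: (toP _ _ _ memP h3).
rewrite y3 x3; have := (hA v u).1 hu.
by rewrite /dfa_accepts e map_cat foldl_cat.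
Qed.

End Signs.

(** * Pumping derivations without erasure *)

Lemma eventually_all (Y : finType) (Q : nat -> Y -> Prop) :
  (forall x, exists k, forall n, k <= n -> Q n x) ->
  exists k, forall n, k <= n -> forall x, Q n x.
Proof.
move=> /fin_all_exists[k hk]; exists (\max_x k x) => n hn x.
by apply: hk; apply: leq_trans hn; exact: leq_bigmax.
Qed.

Lemma eventually_constant (Y : finType) (B : nat -> Y -> Prop) n1 :
  (forall n x, n1 <= n -> B n x -> B n.+1 x) ->
  exists n0, forall n, n0 <= n -> forall x, B n x <-> B n0 x.
Proof.
move=> h; have [x|k hk] := @eventually_all Y (fun n x => forall m, n <= m -> (B m x <-> B n x)).
  have [[n [hn b]]|no] := pselect (exists n, n1 <= n /\ B n x).
    have up m : n <= m -> B m x.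
      by move/subnK <-; elim: (m - n) => // i IH; apply: h IH; rewrite (leq_trans hn) // leq_addl.
    by exists n => m hm m' hm'; split=> _; apply: up => //; apply: leq_trans hm'.
  exists n1 => m hm m' hm'; split=> b; case: no.
    by exists m'; split=> //; apply: leq_trans hm'.
  by exists m.
by exists k => n hn x; exact: hk.
Qed.

Section Rewriting.
Variable X : Type.
Implicit Types P Q : X -> lang X.

Lemma rewrites_mono P Q u z : (forall a y, P a y -> Q a y) ->
  rewrites P u z -> rewrites Q u z.
Proof. by move=> h; elim=> [|a y u' w hp _ IH]; constructor => //; exact: h. Qed.

Lemma rewrites_comp P Q u z :
  rewrites (fun a y => exists2 y1, P a y1 & rewrites Q y1 y) u z <->
  exists2 y, rewrites P u y & rewrites Q y z.
Proof.
split.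
  elim=> [|a y u' w [y1 h1 h2] _ [y2 k1 k2]]; first by exists [::]; constructor.
  by exists (y1 ++ y2); [constructor|apply/rewrites_cat; exists y, w].
case=> y h; elim: h z => [|a y1 u' y2 h1 _ IH] z.
  by move/rewrites0 ->; constructor.
move/rewrites_cat => [z1 [z2 [-> k1 k2]]]; constructor; last exact: IH.
by exists y1.
Qed.

Definition nonerasing P := forall a y, P a y -> y <> [::].

Lemma rewrites_size P u z : nonerasing P -> rewrites P u z -> size u <= size z.
Proof.
move=> ne; elim=> //= a y u' w /ne; case: y => // b y _ _ IH.
by rewrite size_cat /= addSn ltnS (leq_trans IH) // leq_addl.
Qed.

(** A piece of z is shorter than z by at least one letter for each other
    letter of u, since no letter is erased. *)
Lemma rewrites_pieces P Q u z : nonerasing P ->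
  (forall a y, size y + (size u).-1 <= size z -> P a y -> Q a y) ->
  rewrites P u z -> rewrites Q u z.
Proof.
move=> ne h r; elim: r h => [|a y u' w hp hr IH] h; first by constructor.
have su := rewrites_size ne hr.
constructor; first by apply: h => //=; rewrite size_cat leq_add2l.
apply: IH => b y' hy'; apply: h; rewrite /= size_cat.
have := ne _ _ hp; case: y hp => // c y _ _ /=.
by case: u' hr su hy' => [|c' u'] hr /=; lia.
Qed.

Variable sigma : X -> lang X.

Fixpoint iterate n : X -> lang X :=
  if n is n'.+1 then fun a y => exists2 y1, sigma a y1 & rewrites (iterate n') y1 y
  else fun a y => y = [:: a].

Lemma iterate_add m n a y : iterate (m + n) a y <->
  exists2 y1, iterate m a y1 & rewrites (iterate n) y1 y.
Proof.
elim: m a y => [|m IH] a y.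
  split=> [h|[y1 ->]]; last by move/rewrites1.
  by exists [:: a] => //; apply/rewrites1.
split=> /= [[y1 h1 h2]|[y1 [y2 h1 h2] h3]].
  have /rewrites_comp[y2 k1 k2] : rewrites (fun a y => exists2 y1, iterate m a y1 &
      rewrites (iterate n) y1 y) y1 y by apply: rewrites_mono h2 => b z /IH.
  by exists y2 => //; exists y1.
exists y2 => //.
apply: (@rewrites_mono (fun a y => exists2 y1, iterate m a y1 & rewrites (iterate n) y1 y)).
  by move=> b z /IH.
by apply/rewrites_comp; exists y1.
Qed.

Lemma iterate_join m n a b y : iterate m a [:: b] -> iterate n b y -> iterate (m + n) a y.
Proof. by move=> h1 h2; apply/iterate_add; exists [:: b] => //; apply/rewrites1. Qed.

Lemma iterate_loop l t c : iterate l c [:: c] -> iterate (l * t) c [:: c].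
Proof.
by move=> h; elim: t => [|t IH]; rewrite ?muln0 // mulnS; exact: iterate_join IH.
Qed.

Hypothesis ne : nonerasing sigma.

Lemma iterate_nonerasing n : nonerasing (iterate n).
Proof.
elim: n => [|n IH] a y /=; first by move=> ->.
by case=> y1 /ne h /(rewrites_size IH); case: y1 h => // b y1 _; case: y.
Qed.

(** Following the single letter that descends from a, either it stays single
    for k steps, or it branches into several letters before that. *)
Lemma walk_or_branch n k a y : iterate n a y -> k <= n ->
  (exists s : nat -> X, [/\ s 0 = a, forall i, i < k -> sigma (s i) [:: s i.+1] &
     iterate (n - k) (s k) y]) \/
  (exists i b y1, [/\ i < k, iterate i a [:: b], sigma b y1, 1 < size y1 &
     rewrites (iterate (n - i.+1)) y1 y]).
Proof.
elim: k n a => [|k IH] [|n] a // h hk.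
- by left; exists (fun=> a); split => //; rewrite subn0.
- by left; exists (fun=> a); split => //; rewrite subn0.
case: h => y1 h1 h2; case: y1 h1 h2 => [|b [|c y1]] h1 h2.
- by have := ne h1.
- move/rewrites1: h2 => /IH/(_ hk)[[s [s0 hs hy]]|[i [b' [y1 [hi k1 k2 k3 k4]]]]].
    left; exists (fun i => if i is i'.+1 then s i' else a); split => // -[_|i] //=.
      by rewrite s0.
    exact: hs.
  right; exists i.+1, b', y1; split => //.
  by exists [:: b] => //; apply/rewrites1.
by right; exists 0, a, [:: b, c & y1]; split => //; rewrite subSS subn0.
Qed.

End Rewriting.

Section Pumping.
Variables (X : finType) (sigma : X -> lang X).
Hypothesis ne : nonerasing sigma.
Notation N := #|X|.
Notation P := (#|X|)`!.

(** A walk of as many steps as there are letters visits a letter twice. The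
    length of the closed part divides P, so that it can be repeated to make
    the walk P steps longer. *)
Lemma pump_walk n a y (s : nat -> X) : N <= n -> s 0 = a ->
  (forall i, i < N -> sigma (s i) [:: s i.+1]) -> iterate sigma (n - N) (s N) y ->
  iterate sigma (n + P) a y.
Proof.
move=> hn s0 hs hy.
have walk i k : i + k <= N -> iterate sigma k (s i) [:: s (i + k)].
  elim: k i => [|k IH] i h; first by rewrite addn0.
  exists [:: s i.+1]; first by apply: hs; lia.
  by apply/rewrites1; rewrite -addSnnS; apply: IH; lia.
have : ~~ uniq [seq s i | i <- iota 0 N.+1].
  apply/negP => us; have := uniq_leq_size us (fun x _ => mem_enum X x : x \in enum X).
  by rewrite size_map size_iota -cardE ltnn.
move=> /(uniqPn a)[i [j [ij]]]; rewrite size_map size_iota => hj.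
rewrite !(nth_map 0) ?size_iota ?(ltn_trans ij hj) // !nth_iota ?(ltn_trans ij hj) //.
rewrite !add0n => e.
have w1 : iterate sigma i a [:: s i] by rewrite -s0; apply: (walk 0 i); lia.
have w2 : iterate sigma (j - i) (s i) [:: s i].
  by rewrite {2}e -{2}(subnKC (ltnW ij)); apply: walk; lia.
have w3 : iterate sigma (n - i) (s i) y.
  have -> : n - i = (N - i) + (n - N) by lia.
  apply: iterate_join hy; rewrite -{2}(subnKC (_ : i <= N)); first by apply: walk; lia.
  by lia.
have /dvdnP[t et] : j - i %| P by apply: dvdn_fact; lia.
have -> : n + P = i + ((j - i) * t + (n - i)) by rewrite et mulnC; lia.
by apply: iterate_join w1 _; apply: iterate_join w3; exact: iterate_loop.
Qed.

(** Each branching shortens the words that remain to be derived, so a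
    derivation of a word of length d with d times as many steps as letters
    contains a long walk in every branch; all of them are lengthened by the
    same number P of steps. *)
Lemma pump_letter d n a y : size y <= d -> d * N <= n ->
  iterate sigma n a y -> iterate sigma (n + P) a y.
Proof.
elim: d n a y => [|d IH] n a y hy hn h.
  by have := iterate_nonerasing ne h; case: y hy {h}.
have hN : N <= n by apply: leq_trans hn; rewrite mulSn leq_addr.
case: (walk_or_branch ne h hN) => [[s [s0 hs hz]]|[i [b [y1 [hi k1 k2 k3 k4]]]]].
  exact: pump_walk hz.
have -> : n + P = i + (n - i.+1 + P).+1 by lia.
apply: iterate_join k1 _; exists y1 => //.
apply: rewrites_pieces k4; first exact: iterate_nonerasing.
move=> c z hz; apply: IH; first by lia.
by move: hn; rewrite mulSn; lia.
Qed.

Lemma pump_word d n u z : size z <= d -> d * N <= n ->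
  rewrites (iterate sigma n) u z -> rewrites (iterate sigma (n + P)) u z.
Proof.
move=> hz hn; apply: rewrites_pieces; first exact: iterate_nonerasing.
by move=> a y hy; apply: (pump_letter (d := d)) => //; lia.
Qed.

(** The words of length d reached at step P * n are, for large n, also reached
    at step P * (n + 1). Being an increasing sequence of subsets of a finite
    set, they are eventually constant. *)
Lemma iterate_eventually (I : seq X -> Prop) d :
  exists n0, forall n, n0 <= n -> forall z : d.-tuple X,
    (exists2 u, I u & rewrites (iterate sigma (P * n)) u z) <->
    (exists2 u, I u & rewrites (iterate sigma (P * n0)) u z).
Proof.
apply: (@eventually_constant _ (fun n (z : d.-tuple X) =>
  exists2 u, I u & rewrites (iterate sigma (P * n)) u z) (d * N)).
move=> n z hn [u hu h]; exists u => //; rewrite mulnSr; apply: (pump_word (d := d)) => //.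
  by rewrite size_tuple.
by apply: leq_trans hn _; rewrite leq_pmull // fact_gt0.
Qed.

End Pumping.

(** * The computed description *)

Definition weights := seq ratcode.
Definition no_code : ratcode := ([::], [::]).

(** The weights of the nonterminals come first; entry N is the common weight
    of all terminals. *)
Definition letter_weight nS N (ws : weights) a : ratcode :=
  nth no_code ws (if a < nS then N else a - nS).

Definition weight_step nS N (A : nat -> dfa) s (ws : weights) : weights :=
  [seq fkept (A i) (erased_letters nS s) (nS + N) (letter_weight nS N ws)
     | i <- iota 0 N] ++ [:: nth no_code ws N].

(** One more table in front of the control. *)
Definition joint_step nS N A (p : (seq nat * seq nat) * weights) :=
  (sign_step nS N A p.1, weight_step nS N A p.1 p.2).

Definition base_weights N (F : seq nat) (z : ratcode) : weights :=
  [seq (if i \in F then fvar i else fnat 0) | i <- iota 0 N] ++ [:: z].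

Definition triples n : seq (nat * (nat * nat)) :=
  flatten [seq flatten [seq [seq (a, (b, c)) | c <- iota 0 n] | b <- iota 0 n]
    | a <- iota 0 n].

(** The ranks of alpha, beta and gamma: the only accepted word of length three
    is alpha beta gamma. *)
Definition table_triple nT (ctl : dfa) : nat * (nat * nat) :=
  head (0, (0, 0)) [seq x <- triples nT | dfa_accepts ctl [:: x.1; x.2.1; x.2.2]].

(** There are 4 ^ N pairs of sets of nonterminals, so their eventual period
    divides the factorial of this number. *)
Definition sign_period N := (2 ^ N * 2 ^ N)`!.
(** The second factor is a multiple of the lengths of all cycles of letters. *)
Definition period nS N := sign_period N * (nS + N)`!.

Definition nth_dfa (tabs : seq (seq dfa)) t i : dfa :=
  nth ([::], [::]) (nth [::] tabs t) i.

Definition final_signs_weights nS N (tabs : seq (seq dfa)) (x : nat * (nat * nat)) :=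
  iter (period nS N) (joint_step nS N (nth_dfa tabs x.2.1))
    (joint_step nS N (nth_dfa tabs x.2.2)
       (([::], [::]), base_weights N [::] (fvar 0))).

(** The series r are those of the words derived through beta ^ p gamma, the
    series q those of p steps of beta from tokens that will still undergo beta
    ^ p gamma, and g_0 is the result of alpha applied to such tokens, plus 1
    if the empty word is generated. *)
Definition description_of nS N (start : nat) tabs x : dcode :=
  let z := final_signs_weights nS N tabs x in
  let y0 := (z.1, base_weights N z.1.2 (fvar N)) in
  let y := iter (period nS N) (joint_step nS N (nth_dfa tabs x.2.1)) y0 in
  let g := joint_step nS N (nth_dfa tabs x.1) y0 in
  (N.+1, z.2,
   fadd (nth no_code g.2 start) (if start \in g.1.1 then fnat 1 else fnat 0),
   y.2).

Definition description (c : gcode) : dcode :=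
  description_of c.1.1.1.1.1 c.1.1.1.1.2 c.1.1.2 c.1.2
    (table_triple c.1.1.1.2 c.2).

(** * Counting words *)

Lemma dependent_choice (S : Type) (P : nat -> S -> Prop) (R : nat -> S -> S -> Prop) x0 :
  P 0 x0 -> (forall n x, P n x -> exists y, P n.+1 y /\ R n x y) ->
  exists f, f 0 = x0 /\ forall n, P n (f n) /\ R n (f n) (f n.+1).
Proof.
move=> h0 hS; have : forall p : nat * S, exists y, P p.1 p.2 -> P p.1.+1 y /\ R p.1 p.2 y.
  move=> [n x] /=; have [h|h] := pselect (P n x); last by exists x.
  by have [y hy] := hS n x h; exists y.
move=> /choice[g hg]; pose f := fix f n := if n is n'.+1 then g (n', f n') else x0.
have hP n : P n (f n) by elim: n => // n IH; exact: (hg (n, f n) IH).1.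
by exists f; split => // n; split => //; exact: (hg (n, f n) (hP n)).2.
Qed.

Lemma iter_eventually_periodic (Y : eqType) (f : Y -> Y) (x : Y) (s : seq Y) :
  (forall n, iter n f x \in s) ->
  forall j, size s <= j -> iter (j + (size s)`!) f x = iter j f x.
Proof.
move=> hs.
have : ~~ uniq [seq iter i f x | i <- iota 0 (size s).+1].
  apply/negP => us; have sub : {subset [seq iter i f x | i <- iota 0 (size s).+1] <= s}.
    by move=> y /mapP[i _ ->].
  by have := uniq_leq_size us sub; rewrite size_map size_iota ltnn.
move=> /(uniqPn x)[i [k [ik]]]; rewrite size_map size_iota => hk.
rewrite !(nth_map 0) ?size_iota ?(ltn_trans ik hk) // !nth_iota ?(ltn_trans ik hk) //.
rewrite !add0n => e.
have per t j : i <= j -> iter (j + (k - i) * t) f x = iter j f x.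
  elim: t j => [|t IH] j hj; first by rewrite muln0 addn0.
  rewrite mulnS addnA IH ?(leq_trans hj) ?leq_addr //.
  by rewrite -{1}(subnK hj) -addnA (subnKC (ltnW ik)) iterD -e -iterD subnK.
move=> j hj; have /dvdnP[t ->] : k - i %| (size s)`! by apply: dvdn_fact; lia.
by rewrite mulnC per //; lia.
Qed.

Section Counting.
Variables (Sigma V T : finType) (E : et0l Sigma V T).
Notation X := (Sigma + V)%type.
Notation tree := (dtree Sigma V).

(** Trees with the same root and the same yield coincide by unambiguity, so
    the number of listed trees is the number of words. *)
Lemma counts_same_size l r r' TL TL' D D' (m m' : 'X_{1..l}) :
  unambiguous E -> control E r -> control E r' ->
  counts E r TL D -> counts E r' TL' D' ->
  (forall w, D (inr (start E)) m w <-> D' (inr (start E)) m' w) ->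
  size (TL (inr (start E)) m) = size (TL' (inr (start E)) m').
Proof.
move=> unamb cr cr' H H' e; set S := inr (start E).
have uy r0 TL0 D0 m0 : control E r0 -> counts E r0 TL0 D0 ->
    uniq [seq tree_yield t | t <- TL0 S m0].
  move=> c0 H0; rewrite map_inj_in_uniq ?(counts_uniq H0) // => t t' ht ht' ee.
  have [w [h1 h2 h3] _] := counts_sound H0 ht.
  have [w' [k1 k2 k3] _] := counts_sound H0 ht'.
  by apply: (unamb r0 (tree_yield t)).
have my r0 TL0 D0 m0 y : counts E r0 TL0 D0 ->
    (y \in [seq tree_yield t | t <- TL0 S m0]) <->
    exists2 w, D0 S m0 w & y = [seq inl b | b <- w].
  move=> H0; split=> [/mapP[t ht ->]|[w hw ->]].
    by have [w [_ _ h3] hD] := counts_sound H0 ht; exists w.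
  by have [t ht <-] := counts_complete H0 hw; apply: map_f.
rewrite -(size_map (@tree_yield _ _)) -[RHS](size_map (@tree_yield _ _)).
apply/perm_size/uniq_perm; [exact: uy cr H|exact: uy cr' H'|] => y.
apply/idP/idP => /my h.
  by apply/my; [exact: H'|have [w hw ->] := h _ _ H; exists w => //; apply/e].
by apply/my; [exact: H|have [w hw ->] := h _ _ H'; exists w => //; apply/e].
Qed.

Lemma size_counts_words l r TL D (m : 'X_{1..l}) d (A : {set d.-tuple Sigma}) :
  unambiguous E -> control E r -> counts E r TL D ->
  (forall w, D (inr (start E)) m w -> size w = d) ->
  (forall w : d.-tuple Sigma, w \in A <-> D (inr (start E)) m w) ->
  size (TL (inr (start E)) m) = #|A|.
Proof.
move=> unamb cr H hd hA; set S := inr (start E).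
have uy : uniq [seq tree_yield t | t <- TL S m].
  rewrite map_inj_in_uniq ?(counts_uniq H) // => t t' ht ht' ee.
  have [w [h1 h2 h3] _] := counts_sound H ht.
  have [w' [k1 k2 k3] _] := counts_sound H ht'.
  by apply: (unamb r (tree_yield t)).
rewrite -(size_map (@tree_yield _ _)) cardE.
rewrite -[RHS](size_map (fun w : d.-tuple Sigma => [seq (inl b : X) | b <- w])).
apply/perm_size/uniq_perm => //.
  rewrite map_inj_uniq ?enum_uniq // => w w' /inj_map e; apply: val_inj.
  by apply: e => a b [].
move=> y; apply/mapP/mapP => [[t ht ->]|[w hw ->]].
  have [w [_ _ h3] hD] := counts_sound H ht.
  have sw : size w == d by rewrite (hd _ hD).
  by exists (Tuple sw) => //; rewrite mem_enum; apply/hA.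
by rewrite mem_enum in hw; have [t ht e] := counts_complete H ((hA w).1 hw); exists t.
Qed.

(** At the level where the expansion stops, a letter is a variable. To be able
    to use unambiguity, which speaks of terminal words, each such nonterminal
    v is nevertheless represented by a complete derivation tree tr v of a
    chosen nonempty word wd v. *)
Section Base.
Variables (l : nat) (zi : 'I_l) (iv : V -> 'I_l) (r : seq T).
Variables (Fv : seq V) (wd : V -> seq Sigma) (tr : V -> tree).
Hypothesis trP : forall v, v \in Fv -> wd v <> [::] /\ vtree E r (inr v) (wd v) (tr v).

Definition base_trees (a : X) (m : 'X_{1..l}) : seq tree :=
  match a with
  | inl b => if m == U_(zi)%MM then [:: Term b] else [::]
  | inr v => if (v \in Fv) && (m == U_(iv v)%MM) then [:: tr v] else [::]
  end.

Definition base_words (a : X) (m : 'X_{1..l}) (w : seq Sigma) : Prop :=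
  match a with
  | inl b => m = U_(zi)%MM /\ w = [:: b]
  | inr v => [/\ v \in Fv, m = U_(iv v)%MM & w = wd v]
  end.

Lemma counts_base : counts E r base_trees base_words.
Proof.
split.
- by case=> [b|v] m /=; case: ifP.
- case=> [b|v] m t /=; case: ifP => //.
    by move=> /eqP ->; rewrite inE => /eqP ->; exists [:: b] => //; split => //; case: (r).
  move=> /andP[h /eqP ->]; rewrite inE => /eqP ->.
  by exists (wd v) => //; exact: (trP h).2.
- case=> [b|v] m w /=; first by case=> -> ->; rewrite eqxx; exists (Term b); rewrite ?mem_head.
  by case=> h -> ->; rewrite h eqxx; exists (tr v); rewrite ?mem_head //; have [_ []] := trP h.
- case=> [b|v] m m' t /=; case: ifP => //; last first.
    by move=> /andP[_ /eqP ->] _; case: ifP => // /andP[_ /eqP ->].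
  by move=> /eqP -> _; case: ifP => // /eqP ->.
case=> [b|v] m w /=; first by case=> -> ->; split => //; apply/eqP; rewrite mnm1_eq0.
by case=> h -> ->; split; [exact: (trP h).1|apply/eqP; rewrite mnm1_eq0].
Qed.

Lemma base_series_term b : tree_series base_trees (inl b) = xvar zi.
Proof. by apply: funext => m; rewrite /tree_series /zser /xvar /=; case: eqP. Qed.

Lemma base_series_nonterm v :
  tree_series base_trees (inr v) = (if v \in Fv then xvar (iv v) else 0)%R.
Proof.
apply: funext => m; rewrite /tree_series /zser /xvar /=.
by case: (v \in Fv) => //=; case: eqP.
Qed.
End Base.

Definition letter_series l (W : X -> series l) (a : nat) : series l :=
  (\sum_(x : X | rank x == a) W x)%R.

Lemma letter_series_rank l (W : X -> series l) x : letter_series W (rank x) = W x.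
Proof.
rewrite /letter_series (bigD1 x) //= big1 ?addr0 // => y /andP[/eqP /rank_inj ->].
by rewrite eqxx.
Qed.

Lemma letter_series_constfree l (W : X -> series l) a :
  (forall x, constfree (W x)) -> constfree (letter_series W a).
Proof.
by move=> H; rewrite /constfree /letter_series scoef_sum big1 // => x _; exact: H.
Qed.

Lemma kept_spells_langr l r (Ev : seq V) (D : X -> 'X_{1..l} -> seq Sigma -> Prop) u m w :
  (forall v, v \in Ev -> langr E r (inr v) [::]) ->
  (forall a m w, D a m w -> langr E r a w) ->
  kept_spells Ev D u m w -> spells (langr E r) u w.
Proof.
move=> hE hD; elim=> {u m w} [|v u m w hv _ IH|a u m1 w1 m w /hD h _ IH].
- exact: spells_nil.
- by rewrite -[w]cat0s; constructor => //; exact: hE.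
- by constructor.
Qed.

Lemma expand_langr l r tau (Ev : seq V) (D : X -> 'X_{1..l} -> seq Sigma -> Prop) :
  (forall v, v \in Ev -> langr E r (inr v) [::]) ->
  (forall a m w, D a m w -> langr E r a w) ->
  forall a m w, expand E tau Ev D a m w -> langr E (tau :: r) a w.
Proof.
move=> hE hD [b|v] m w /=; first by move/hD/langr_term => ->; apply/langr_term.
move=> [_ [u hu hs]]; apply/langr_cons; exists u => //; exact: kept_spells_langr hs.
Qed.

(** The types that count terminal letters: m is z to the length of w. *)
Definition length_words l (zi : 'I_l) r (a : X) (m : 'X_{1..l}) w :=
  [/\ langr E r a w, w <> [::] & m = (U_(zi) *+ size w)%MM].

Lemma mul_U_inj l (zi : 'I_l) n : (U_(zi) *+ n)%MM = 0%MM -> n = 0.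
Proof. by move/(congr1 mdeg); rewrite mdegMn mdeg1 mdeg0 mul1n. Qed.

Lemma mulmDr l (m : 'X_{1..l}) a b : (m *+ (a + b))%MM = (m *+ a + m *+ b)%MM.
Proof. by apply/mnmP => i; rewrite mnmDE !mulmnE mulnDr. Qed.

Lemma expand_length l (zi : 'I_l) r tau (Ev : seq V) D :
  (forall v, (v \in Ev) <-> langr E r (inr v) [::]) ->
  (forall a m w, D a m w <-> length_words zi r a m w) ->
  forall a m w, expand E tau Ev D a m w <-> length_words zi (tau :: r) a m w.
Proof.
move=> hE hD.
have ks u m w : kept_spells Ev D u m w <-> spells (langr E r) u w /\ m = (U_(zi) *+ size w)%MM.
  split=> [|[h ->]].
    elim=> {u m w} [|v u m w /hE hv _ [IH ->]|a u m1 w1 m w /hD[h1 h2 ->] _ [IH ->]].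
    - by split; [exact: spells_nil|rewrite mulm0n].
    - by split => //; rewrite -[w]cat0s; constructor.
    - by split; [constructor|rewrite size_cat mulmDr].
  elim: h => {u w} [|a u w w' h _ IH]; first by rewrite mulm0n; constructor.
  have [e|ne] := pselect (w = [::]).
    by case: a h => [b|v] h; [move/langr_term: h; rewrite e|
      rewrite e in h *; constructor => //; apply/hE].
  by rewrite size_cat mulmDr; constructor => //; apply/hD.
case=> [b|v] m w /=.
  rewrite hD; split; case=> /langr_term h1 h2 h3; split => //; exact/langr_term.
split=> [[hm [u hu /ks[h1 h2]]]|[/langr_cons[u hu hs] hw hm]].
  split => //; first by apply/langr_cons; exists u.
  by move=> e; apply: hm; rewrite h2 e mulm0n.
split; first by rewrite hm => /mul_U_inj/size0nil.
by exists u => //; apply/ks.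
Qed.

End Counting.

(** * Token words *)

Section Tokens.
Variables (Sigma V T : finType) (E : et0l Sigma V T) (tau : T).
Notation X := (Sigma + V)%type.

Inductive erases (Ev : seq V) : seq X -> seq X -> Prop :=
| erases_nil : erases Ev [::] [::]
| erases_drop v u y : v \in Ev -> erases Ev u y -> erases Ev (inr v :: u) y
| erases_keep a u y : erases Ev u y -> erases Ev (a :: u) (a :: y).

(** Expansion by tau of the tokens of one level, of which those that generate
    the empty word are dropped. Tokens stand for letters with nonempty
    descendants, so that at least one is left. *)
Definition token_step (Ev : seq V) (a : X) : lang X := fun y =>
  match a with
  | inl b => y = [:: inl b]
  | inr v => y <> [::] /\ exists2 u, table E tau (inr v) u & erases Ev u y
  end.

Lemma token_step_nonerasing Ev : nonerasing (token_step Ev).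
Proof. by case=> [b|v] y /=; [move=> ->|case]. Qed.

Variable Evs : nat -> seq V.

(** The index counts the remaining steps: it decreases towards the leaves, and
    Evs n tells which letters may be erased above n further steps. *)
Fixpoint tokens n : X -> lang X :=
  if n is n'.+1 then fun a y =>
    exists2 y1, token_step (Evs n') a y1 & rewrites (tokens n') y1 y
  else fun a y => y = [:: a].

Lemma tokens_nonerasing n : nonerasing (tokens n).
Proof.
elim: n => [|n IH] a y /=; first by move=> ->.
case=> y1 /token_step_nonerasing h /(rewrites_size IH).
by case: y1 h => // b y1 _; case: y.
Qed.

Lemma tokens_term n b y : tokens n (inl b) y <-> y = [:: inl b].
Proof.
elim: n y => // n IH y /=; split=> [[y1 -> /rewrites1/IH //]|->].
by exists [:: inl b] => //; apply/rewrites1/IH.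
Qed.

(** Erasure depends on the remaining steps only modulo the period, so a
    derivation can be cut after its first j steps when the number i of the
    others is a period. *)
Lemma tokens_add i j : (forall k, Evs (k + i) = Evs k) -> forall a y,
  tokens (j + i) a y <-> exists2 y1, tokens j a y1 & rewrites (tokens i) y1 y.
Proof.
move=> per; elim: j => [|j IH] a y.
  split=> [h|[y1 ->]]; last by move/rewrites1.
  by exists [:: a] => //; apply/rewrites1.
rewrite addSn /= per; split=> [[y1 h1 h2]|[y1 [y2 h1 h2] h3]].
  have /rewrites_comp[y2 k1 k2] : rewrites (fun a y => exists2 y1, tokens j a y1 &
      rewrites (tokens i) y1 y) y1 y by apply: rewrites_mono h2 => b z /IH.
  by exists y2 => //; exists y1.
exists y2 => //.
apply: (@rewrites_mono _ (fun a y => exists2 y1, tokens j a y1 & rewrites (tokens i) y1 y)).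
  by move=> b z /IH.
by apply/rewrites_comp; exists y1.
Qed.

Lemma tokens_iterate p t : (forall k, Evs (k + p) = Evs k) -> forall a y,
  tokens (p * t) a y <-> iterate (tokens p) t a y.
Proof.
move=> per; have pert s k : Evs (k + p * s) = Evs k.
  by elim: s => [|s IH]; rewrite ?muln0 ?addn0 // mulnSr addnA per.
elim: t => [|t IH] a y; first by rewrite muln0.
rewrite mulnS; split.
  move/(tokens_add _ (pert t)) => [y1 h1 h2]; exists y1 => //.
  by apply: rewrites_mono h2 => b z /IH.
case=> y1 h1 h2; apply/(tokens_add _ (pert t)); exists y1 => //.
by apply: rewrites_mono h2 => b z /IH.
Qed.

Section Words.
Variables (l : nat) (zi : 'I_l) (iv : V -> 'I_l).
Variables (Fv : seq V) (wd : V -> seq Sigma).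

Definition letter_var (a : X) : 'I_l := match a with inl _ => zi | inr v => iv v end.
Definition parikh (y : seq X) : 'X_{1..l} :=
  \big[+%MM/0%MM]_(a <- y) U_(letter_var a)%MM.
(** The yield of the derivation tree whose level of tokens is y. *)
Definition completion (y : seq X) : seq Sigma :=
  flatten [seq match a with inl b => [:: b] | inr v => wd v end | a <- y].
Definition completable (a : X) : bool := match a with inl _ => true | inr v => v \in Fv end.

Lemma parikh_cat y z : parikh (y ++ z) = (parikh y + parikh z)%MM.
Proof. exact: big_cat. Qed.

Lemma mdeg_parikh y : mdeg (parikh y) = size y.
Proof.
rewrite /parikh; elim: y => [|a y IH]; first by rewrite big_nil mdeg0.
by rewrite big_cons mdegD IH mdeg1.
Qed.

Lemma completion_cat y z : completion (y ++ z) = completion y ++ completion z.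
Proof. by rewrite /completion map_cat flatten_cat. Qed.

Definition token_words n (a : X) (m : 'X_{1..l}) (w : seq Sigma) : Prop :=
  exists y, [/\ tokens n a y, all completable y, m = parikh y & w = completion y].

Lemma token_words0 a m w : base_words zi iv Fv wd a m w <-> token_words 0 a m w.
Proof.
have p1 : parikh [:: a] = U_(letter_var a)%MM by rewrite /parikh big_seq1.
have c1 : completion [:: a] = match a with inl b => [:: b] | inr v => wd v end.
  by rewrite /completion /= cats0.
split.
  case: a p1 c1 => [b|v] p1 c1 /=; [case=> -> ->|case=> h -> ->].
    by exists [:: inl b]; rewrite p1 c1.
  by exists [:: inr v]; rewrite p1 c1 /= h.
case=> y [/= -> /andP[h _] -> ->]; rewrite p1 c1.
by case: a h {p1 c1}.
Qed.

Lemma kept_spells_tokens n Ev D u m w :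
  (forall a m w, D a m w <-> token_words n a m w) ->
  kept_spells Ev D u m w <-> exists y z, [/\ erases Ev u y, rewrites (tokens n) y z,
    all completable z, m = parikh z & w = completion z].
Proof.
move=> hD; split.
  elim=> {u m w} [|v u m w hv _ [y [z [h1 h2 h3 -> ->]]]
      |a u m1 w1 m w /hD[y1 [k1 k2 -> ->]] _ [y [z [h1 h2 h3 -> ->]]]].
  - by exists [::], [::]; split; try constructor; rewrite /parikh big_nil.
  - by exists y, z; split => //; constructor.
  - exists (a :: y), (y1 ++ z); split; rewrite ?parikh_cat ?completion_cat //.
    + exact: erases_keep.
    + by constructor.
    + by rewrite all_cat k2.
case=> y [z [h1 h2 h3 -> ->]]; elim: h1 z h2 h3 => {u y m w} [|v u y hv _ IH|a u y _ IH] z h2 h3.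
- by move/rewrites0: h2 => ->; rewrite /parikh big_nil; exact: kept_nil.
- by apply: kept_erase => //; exact: IH.
inversion h2; subst; rewrite parikh_cat completion_cat; move: h3.
rewrite all_cat => /andP[k1 k2]; constructor; last exact: IH.
by apply/hD; exists u0.
Qed.

(** The types counted after n steps from variables are the commutative images
    of the token words of n steps. *)
Lemma expand_tokens n D a m w :
  (forall a m w, D a m w <-> token_words n a m w) ->
  expand E tau (Evs n) D a m w <-> token_words n.+1 a m w.
Proof.
move=> hD; case: a => [b|v] /=.
  rewrite hD; split=> -[y [h1 h2 h3 h4]]; exists y; split => //.
    by exists [:: inl b] => //; apply/rewrites1.
  by apply/tokens_term; move/(tokens_term n.+1): h1.
split=> [[hm [u hu /(kept_spells_tokens _ _ _ _ hD)[y [z [h1 h2 h3 h4 h5]]]]]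
    |[z [[y [hy [u hu hs]] hz] h3 h4 h5]]].
  exists z; split => //; exists y => //; split; last by exists u.
  move=> e; apply: hm; rewrite h4; move: h2; rewrite e => /rewrites0 ->.
  by rewrite /parikh big_nil.
split.
  move/(congr1 mdeg); rewrite h4 mdeg_parikh mdeg0 => /size0nil e.
  by have := rewrites_size (@tokens_nonerasing n) hz; rewrite e; case: (y) hy.
by exists u => //; apply/(kept_spells_tokens _ _ _ _ hD); exists y, z.
Qed.

End Words.
End Tokens.

(** * Prepending the same table repeatedly *)

Lemma sublist_encode N (L : seq nat) : sublist_of_iota N L ->
  exists A : {set 'I_N}, L = [seq val i | i <- enum 'I_N & i \in A].
Proof.
move=> e; exists [set i | val i \in L].
rewrite {1}e -val_enum_ord filter_map; congr (map _ _).
by apply: eq_filter => i /=; rewrite inE.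
Qed.

Lemma card_set_pairs N : #|{: {set 'I_N} * {set 'I_N}}| = 2 ^ N * 2 ^ N.
Proof.
have e : #|{: {set 'I_N}}| = 2 ^ N.
  rewrite -cardsT -powersetT card_powerset cardsT card_ord //.
by rewrite card_prod e.
Qed.

Lemma leq_factorial n : n <= n`!.
Proof. by case: n => // n; apply: dvdn_leq; [exact: fact_gt0|apply: dvdn_fact; rewrite leqnn]. Qed.

Section Chains.
Variables (Sigma V T : finType) (E : et0l Sigma V T) (alpha beta gamma : T).
Notation X := (Sigma + V)%type.
Notation tree := (dtree Sigma V).
Notation nS := #|Sigma|.
Notation N := #|V|.
Variables (Aa Ab Ac : nat -> dfa).
Hypothesis hAa : forall v, recognizes (Aa (rank v)) (table E alpha (inr v)).
Hypothesis hAb : forall v, recognizes (Ab (rank v)) (table E beta (inr v)).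
Hypothesis hAc : forall v, recognizes (Ac (rank v)) (table E gamma (inr v)).

(** The control that remains after alpha and the first steps of beta. *)
Definition tail_control j : seq T := nseq j beta ++ [:: gamma].
Definition signs_at j := iter j (sign_step nS N Ab) (sign_step nS N Ac ([::], [::])).

Lemma signs_atP j : signs E (tail_control j) (signs_at j).
Proof.
elim: j => [|j IH]; first by apply: signs_step hAc; exact: signs_nil.
by apply: signs_step IH hAb.
Qed.

(** The pairs of sets of nonterminals form a finite set on which one step of
    beta acts. *)
Lemma signs_at_sign_period j : 2 ^ N * 2 ^ N <= j -> signs_at (j + sign_period N) = signs_at j.
Proof.
(* The values of signs_at lie in a list of 4 ^ N pairs of lists. *)
pose enc (p : {set 'I_N} * {set 'I_N}) :=
  ([seq val i | i <- enum 'I_N & i \in p.1], [seq val i | i <- enum 'I_N & i \in p.2]).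
have es : size [seq enc p | p <- enum {: {set 'I_N} * {set 'I_N}}] = 2 ^ N * 2 ^ N.
  by rewrite size_map -cardE card_set_pairs.
rewrite /signs_at /sign_period -es => hj.
apply: iter_eventually_periodic hj => n.
have [/sublist_encode[A1 e1] /sublist_encode[A2 e2] _ _] := signs_atP n.
apply/mapP; exists (A1, A2); first by rewrite mem_enum.
by rewrite /enc /= -e1 -e2 /signs_at; case: (iter _ _ _).
Qed.

Notation p := (period nS N).

Lemma period_ge : 2 ^ N * 2 ^ N <= p.
Proof.
apply: leq_trans (leq_factorial _) _; rewrite /period /sign_period leq_pmulr //.
exact: fact_gt0.
Qed.

Lemma signs_at_sign_period_mul j t : p <= j -> signs_at (j + sign_period N * t) = signs_at j.
Proof.
move=> hj; elim: t => [|t IH]; first by rewrite muln0 addn0.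
rewrite mulnSr addnA signs_at_sign_period // (leq_trans period_ge) // (leq_trans hj) //.
exact: leq_addr.
Qed.

Lemma signs_at_period j : p <= j -> signs_at (j + p) = signs_at j.
Proof. exact: signs_at_sign_period_mul. Qed.

Lemma signs_at_period_mul n : signs_at (p * n + p) = signs_at p.
Proof. by rewrite addnC /period -[in X in _ + X]mulnA signs_at_sign_period_mul. Qed.

Definition erasable_at j := [seq v <- enum V | rank v \in (signs_at j).1].
Definition fertile_at j := [seq v <- enum V | rank v \in (signs_at j).2].

Lemma erasable_at_uniq j : uniq (erasable_at j).
Proof. by rewrite filter_uniq ?enum_uniq. Qed.
Lemma erasable_atP j v : (v \in erasable_at j) <-> langr E (tail_control j) (inr v) [::].
Proof. by rewrite mem_filter mem_enum andbT; have [_ _ h _] := signs_atP j. Qed.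
Lemma fertile_atP j v : (v \in fertile_at j) <-> nonempty_at E (tail_control j) (inr v).
Proof. by rewrite mem_filter mem_enum andbT; have [_ _ _ h] := signs_atP j. Qed.

Definition erased_codes j := erased_letters nS (signs_at j).
Lemma erased_codesE j : erased_codes j = [seq rank (inr v : X) | v <- erasable_at j].
Proof.
rewrite /erased_codes /erased_letters; have [f _ _ _] := signs_atP j.
rewrite {1}f -map_rank_enum filter_map -map_comp.
by apply: eq_map => v /=; rewrite rank_inr.
Qed.

Section Chain.
Variables (l : nat).
Notation mon := 'X_{1..l}.
Implicit Types (TL : X -> mon -> seq tree) (D : X -> mon -> seq Sigma -> Prop).

(** The yields and types counted by n steps of beta that precede tail_control
    k. *)
Fixpoint chain_words k (D0 : X -> mon -> seq Sigma -> Prop) n :=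
  if n is n'.+1 then expand E beta (erasable_at (n' + k)) (chain_words k D0 n') else D0.

(** The series obtained by prepending beta again and again to tail_control k.
    Terminals keep the weight of one variable throughout. *)
Record series_chain k (zi : 'I_l) (W : nat -> X -> series l) : Prop := SeriesChain {
  chain_term : forall n b, W n (inl b) = xvar zi;
  chain_constfree : forall n a, constfree (W n a);
  chain_step : forall n v, kept_series (Ab (rank v)) (erased_codes (n + k)) (nS + N)
     (letter_series (W n)) (W n.+1 (inr v)) }.

Lemma chain_exists k zi TL0 D0 : counts E (tail_control k) TL0 D0 ->
  (forall b, tree_series TL0 (inl b) = xvar zi) ->
  exists Us : nat -> X -> mon -> seq tree, [/\ Us 0 = TL0,
    forall n, counts E (tail_control (n + k)) (Us n) (chain_words k D0 n) &
    series_chain k zi (fun n => tree_series (Us n))].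
Proof.
move=> c0 t0.
have [|n TL [cn tn]|Us [U0 hU]] := @dependent_choice _
  (fun n TL => counts E (tail_control (n + k)) TL (chain_words k D0 n) /\
     (forall b, tree_series TL (inl b) = xvar zi))
  (fun n TL TL' => forall v, kept_series (Ab (rank v)) (erased_codes (n + k)) (nS + N)
     (letter_series (tree_series TL)) (tree_series TL' (inr v))) TL0.
- by split.
- have [|TL' [c' t' s']] := @counts_step _ _ _ _ _ _ _ _ (erasable_at (n + k)) beta
    (fun v => Ab (rank v)) cn (erasable_at_uniq _) _ hAb.
    by move=> v /erasable_atP.
  exists TL'; split.
    by split=> // b; rewrite -(tn b); apply: funext => m; rewrite /tree_series /zser t'.
  move=> v; rewrite erased_codesE -card_sum; apply: s' => a; exact: letter_series_rank.
exists Us; split=> // [n|]; first exact: (hU n).1.1.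
split=> n a; [exact: (hU n).1.2|exact: (tree_series_constfree _ (hU n).1.1)|].
exact: (hU n).2.
Qed.

Lemma top_exists j TL D : counts E (tail_control j) TL D ->
  exists TLt, counts E (alpha :: tail_control j) TLt (expand E alpha (erasable_at j) D) /\
    kept_series (Aa (rank (start E))) (erased_codes j) (nS + N) (letter_series (tree_series TL))
       (tree_series TLt (inr (start E))).
Proof.
move=> cn; have [|TL' [c' t' s']] := @counts_step _ _ _ _ _ _ _ _ (erasable_at j) alpha
    (fun v => Aa (rank v)) cn (erasable_at_uniq _) _ hAa.
  by move=> v /erasable_atP.
exists TL'; split => //; rewrite erased_codesE -card_sum; apply: s' => a.
exact: letter_series_rank.
Qed.

Lemma chain_words_langr k D0 : (forall a m w, D0 a m w -> langr E (tail_control k) a w) ->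
  forall n a m w, chain_words k D0 n a m w -> langr E (tail_control (n + k)) a w.
Proof.
move=> h0; elim=> [|n IH] // a m w; apply: expand_langr IH _ _ _.
by move=> v /erasable_atP.
Qed.

(** The order of the variables: nonterminals by rank, then the variable for
    the terminals. *)
Definition variables_of (zi : 'I_l) (W : X -> series l) (i : 'I_N.+1) : series l :=
  if [pick v | rank v == i] is Some v then W (inr v) else xvar zi.

Definition nat_variables_of (zi : 'I_l) (TL : X -> mon -> seq tree) (i : 'I_N.+1) : fps nat l :=
  if [pick v | rank v == i] is Some v then fun m => size (TL (inr v) m)
  else fun m => nat_of_bool (m == U_(zi)%MM).

Lemma zser_variables zi TL i :
  zser (nat_variables_of zi TL i) = variables_of zi (tree_series TL) i.
Proof.
rewrite /nat_variables_of /variables_of; case: pickP => //= _.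
by apply: funext => m; rewrite /zser /xvar; case: eqP.
Qed.

Definition var_of (v : V) : 'I_N.+1 := widen_ord (leqnSn N) (enum_rank v).

Lemma variables_of_var zi W v : variables_of zi W (var_of v) = W (inr v).
Proof.
rewrite /variables_of; case: pickP => [u /eqP|/(_ v)]; last by rewrite eqxx.
by move=> e; have -> : u = v by apply: rank_inj.
Qed.

Lemma variables_of_max zi W : variables_of zi W ord_max = xvar zi.
Proof.
rewrite /variables_of; case: pickP => // u /eqP /= e.
by have := rank_lt u; rewrite e ltnn.
Qed.

Lemma variables_of_constfree zi W i :
  (forall a, constfree (W a)) -> constfree (variables_of zi W i).
Proof.
by move=> h; rewrite /variables_of; case: pickP => // _; exact: xvar_constfree.
Qed.

Lemma ord_var_or_max (i : 'I_N.+1) : (exists v, i = var_of v) \/ i = ord_max.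
Proof.
have [h|h] := ltnP i N.
  by left; have [v e] := rank_surj h; exists v; apply: val_inj.
by right; apply: val_inj; apply/eqP; rewrite eqn_leq h -ltnS ltn_ord.
Qed.

Definition coded (zi : 'I_l) (ws : weights) (W : X -> series l) :=
  forall i : 'I_N.+1, represents (nth no_code ws i) (variables_of zi W i).

Lemma coded_letters zi ws W a : coded zi ws W -> (forall b, W (inl b) = xvar zi) ->
  a < nS + N -> represents (letter_weight nS N ws a) (letter_series W a).
Proof.
move=> h t; rewrite -card_sum => /rank_surj[x ->]; rewrite letter_series_rank.
rewrite /letter_weight; case: x => [b|v].
  by rewrite rank_inl rank_lt t -(variables_of_max zi W); exact: (h ord_max).
rewrite rank_inr ltnNge leq_addr /= addKn -(variables_of_var zi W).
exact: (h (var_of v)).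
Qed.

Lemma nth_weight_step A s ws i : i < N ->
  nth no_code (weight_step nS N A s ws) i =
  fkept (A i) (erased_letters nS s) (nS + N) (letter_weight nS N ws).
Proof.
move=> h; rewrite /weight_step nth_cat size_map size_iota h.
by rewrite (nth_map 0) ?size_iota // nth_iota.
Qed.

Lemma coded_step zi A s ws W W' : coded zi ws W -> (forall b, W (inl b) = xvar zi) ->
  (forall a, constfree (W a)) ->
  (forall v, kept_series (A (rank v)) (erased_letters nS s) (nS + N)
     (letter_series W) (W' (inr v))) ->
  coded zi (weight_step nS N A s ws) W'.
Proof.
move=> h t c k i; case: (ord_var_or_max i) => [[v ->]|->].
  rewrite variables_of_var nth_weight_step; last exact: rank_lt.
  apply: represents_kept (k v); first by move=> a; exact: letter_series_constfree.
  by move=> a; exact: (coded_letters h t).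
rewrite variables_of_max /weight_step nth_cat size_map size_iota ltnn subnn /=.
by have := h ord_max; rewrite variables_of_max.
Qed.

Lemma coded_base zi zc (F : seq nat) (W : X -> series l) (iv : V -> 'I_l) :
  (forall v, rank v \in F -> rank v = iv v) -> represents zc (xvar zi) ->
  (forall v, W (inr v) = (if rank v \in F then xvar (iv v) else 0)%R) ->
  coded zi (base_weights N F zc) W.
Proof.
move=> hiv hz hW i; rewrite /base_weights nth_cat size_map size_iota.
case: (ord_var_or_max i) => [[v ->]|->].
  have e : nat_of_ord (var_of v) = rank v by [].
  rewrite variables_of_var hW e rank_lt (nth_map 0) ?size_iota ?rank_lt //.
  rewrite nth_iota ?rank_lt // add0n; case: ifP => hv.
    by rewrite hiv //; exact: represents_var.
  exact: represents_nat.
by rewrite ltnn subnn variables_of_max.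
Qed.

Lemma chain_coded k zi W ws : series_chain k zi W -> coded zi ws (W 0) ->
  forall n, let q := iter n (joint_step nS N Ab) (signs_at k, ws) in
  q.1 = signs_at (n + k) /\ coded zi q.2 (W n).
Proof.
move=> H h0; elim=> [|n [e IH]] //=; split; first by rewrite e.
apply: coded_step IH (chain_term H n) (chain_constfree H n) _ => v.
by rewrite e; exact: (chain_step H).
Qed.

End Chain.

(** By induction on n: both sides solve the same linear system, because
    substitution maps solutions to solutions and the erasable letters agree at
    levels n + p. It applies to the continuation of the chain itself, which
    gives g_(n+1) = g_n(q), and to the chain in the variable z, which gives
    g_n(r). *)
Lemma chain_comp l (zi : 'I_l) (W : nat -> X -> series N.+1) (U : nat -> X -> series l) :
  series_chain p ord_max W -> series_chain p zi U ->
  (forall v, W 0 (inr v) = (if v \in fertile_at p then xvar (var_of v) else 0)%R) ->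
  (forall v, v \notin fertile_at p -> U 0 (inr v) = 0%R) ->
  let q := variables_of zi (U 0) in
  (forall i, constfree (q i)) /\ forall n a, scomp q (W n a) = U n a.
Proof.
move=> HW HU W0 U0 q.
have q0 i : constfree (q i) by apply: variables_of_constfree; exact: (chain_constfree HU).
split=> //; elim=> [|n IH] [b|v].
- by rewrite (chain_term HW) scomp_xvar // (chain_term HU) /q variables_of_max.
- rewrite W0; case: (boolP (v \in fertile_at p)) => hv.
    by rewrite scomp_xvar // /q variables_of_var.
  by rewrite scomp0 // U0.
- by rewrite (chain_term HW) scomp_xvar // (chain_term HU) /q variables_of_max.
have k1 := kept_series_comp q0 (chain_step HW n v).
apply: (kept_series_unique _ _ (chain_step HU n v)).
  by move=> a; apply: letter_series_constfree; exact: (chain_constfree HU).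
suff -> : letter_series (U n) = (fun a => scomp q (letter_series (W n) a)) by [].
apply: funext => a; rewrite /letter_series scomp_sum //; apply: eq_bigr => x _.
by rewrite IH.
Qed.

Lemma chain_comp_letters l (W : X -> series N.+1) (U : X -> series l) q :
  (forall i, constfree (q i)) -> (forall a, scomp q (W a) = U a) ->
  (forall a, constfree (U a)) ->
  forall (A : dfa) Es eta eta',
  kept_series A Es (nS + N) (letter_series W) eta ->
  kept_series A Es (nS + N) (letter_series U) eta' -> scomp q eta = eta'.
Proof.
move=> q0 e c A Es eta eta' /(kept_series_comp q0) k1 k2.
apply: (kept_series_unique _ _ k2); first by move=> a; exact: letter_series_constfree.
suff -> : letter_series U = (fun a => scomp q (letter_series W a)) by [].
apply: funext => a; rewrite /letter_series scomp_sum //; apply: eq_bigr => x _.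
by rewrite e.
Qed.

End Chains.

(** * Correctness of the description *)

Lemma mnm_one (m : 'X_{1..1}) : m = (U_(ord0) *+ mdeg m)%MM.
Proof.
apply/mnmP => i; rewrite mulmnE mnm1E mdegE big_ord1 (ord1 i) eqxx mul1n.
by congr (fun_of_multinom m _).
Qed.

Section Description.
Variables (Sigma V T : finType) (E : et0l Sigma V T) (alpha beta gamma : T).
Notation X := (Sigma + V)%type.
Notation tree := (dtree Sigma V).
Notation nS := #|Sigma|.
Notation N := #|V|.
Notation p := (period nS N).
Variables (Aa Ab Ac : nat -> dfa).
Hypothesis hAa : forall v, recognizes (Aa (rank v)) (table E alpha (inr v)).
Hypothesis hAb : forall v, recognizes (Ab (rank v)) (table E beta (inr v)).
Hypothesis hAc : forall v, recognizes (Ac (rank v)) (table E gamma (inr v)).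
Hypothesis unamb : unambiguous E.
Notation S := (inr (start E) : X).
Notation tail_control := (tail_control beta gamma).
Notation signs_at := (signs_at Sigma V Ab Ac).
Notation erasable_at := (erasable_at Sigma V Ab Ac).
Notation fertile_at := (fertile_at Sigma V Ab Ac).
Notation erased_codes := (erased_codes Sigma V Ab Ac).
Notation chain_words := (chain_words E beta Ab Ac).
Notation series_chain := (series_chain Ab Ac).
Notation top_kept TL TLt j := (kept_series (Aa (rank (start E))) (erased_codes j) (nS + N)
  (letter_series (tree_series TL)) (tree_series TLt S)).
Hypothesis ctl : forall r, control E r <-> exists n, r = alpha :: tail_control n.

Lemma control_tail j : control E (alpha :: tail_control j).
Proof. by apply/ctl; exists j. Qed.

Definition empty_generated j := rank (start E) \in (sign_step nS N Aa (signs_at j)).1.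

Lemma empty_generatedP j : empty_generated j <-> langr E (alpha :: tail_control j) S [::].
Proof.
have [_ _ h _] := signs_step (signs_atP hAb hAc j) hAa.
exact: h.
Qed.

(** The coefficients of these series count the words that a letter generates
    through tail_control n by their length. *)
Lemma length_chain_exists :
  exists (Us : nat -> X -> 'X_{1..1} -> seq tree) D,
  [/\ forall n, counts E (tail_control n) (Us n) (D n),
      forall n a m w, D n a m w <-> length_words E (ord0 : 'I_1) (tail_control n) a m w,
      series_chain 0 (ord0 : 'I_1) (fun n => tree_series (Us n)) &
      coded ord0 (weight_step nS N Ac ([::], [::]) (base_weights N [::] (fvar 0)))
        (tree_series (Us 0))].
Proof.
pose iv0 := fun _ : V => ord0 : 'I_1; pose wd0 := fun _ : V => [::] : seq Sigma.
pose tr0 := fun _ : V => Eps : tree.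
have cb : counts E [::] (base_trees ord0 iv0 [::] tr0) (base_words ord0 iv0 [::] wd0).
  by apply: counts_base.
have [|TL0 [c0 t0 s0]] := @counts_step _ _ _ _ _ _ _ _ [::] gamma
    (fun v => Ac (rank v)) cb isT _ hAc; first by [].
have bt b : tree_series (base_trees ord0 iv0 [::] tr0) (inl b : X) = xvar ord0.
  exact: base_series_term.
have tt b : tree_series TL0 (inl b) = xvar ord0.
  by rewrite -(bt b); apply: funext => m; rewrite /tree_series /zser t0.
have [Us [U0 hU sU]] := chain_exists hAb hAc (k := 0) c0 tt.
exists Us, (chain_words 0 (expand E gamma [::] (base_words ord0 iv0 [::] wd0))).
split => //.
- by move=> n; have := hU n; rewrite addn0.
- have b0 a m w : base_words ord0 iv0 [::] wd0 a m w <-> length_words E (ord0 : 'I_1) [::] a m w.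
    case: a => [b|v] /=; last by split=> [[]|[/langr_nil]].
    split=> [[-> ->]|[/langr_term -> _ ->]]; last by rewrite mulm1n.
    by split; [exact/langr_term| |rewrite mulm1n].
  elim=> [|n IH]; first by apply: expand_length b0 => v; split => // /langr_nil.
  by apply: expand_length IH => v; rewrite addn0; exact: (erasable_atP hAb hAc).
rewrite U0; apply: (coded_step (W := tree_series (base_trees ord0 iv0 [::] tr0))) => //.
- apply: (coded_base (iv := iv0)) => //; first exact: (represents_var (ord0 : 'I_1)).
- by move=> a; exact: (tree_series_constfree _ cb).
move=> v; rewrite -card_sum; apply: (s0 _ v) => a; exact: letter_series_rank.
Qed.

(** The chain that starts from one variable for each nonterminal that
    generates a nonempty word through tail_control p. *)
Lemma token_chain_exists :
  exists (Us : nat -> X -> 'X_{1..N.+1} -> seq tree) D wd,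
  [/\ forall n, counts E (tail_control (n + p)) (Us n) (D n),
      forall n a m w, D n a m w <-> token_words E beta (fun k => erasable_at (k + p))
        ord_max (@var_of V) (fertile_at p) wd n a m w,
      forall n a m w, D n a m w -> langr E (tail_control (n + p)) a w,
      series_chain p ord_max (fun n => tree_series (Us n)) &
      forall v, tree_series (Us 0) (inr v) =
        (if v \in fertile_at p then xvar (var_of v) else 0)%R].
Proof.
have /fin_all_exists[wt hwt] : forall v : V, exists wt : seq Sigma * tree, v \in fertile_at p ->
    [/\ wt.1 <> [::], langr E (tail_control p) (inr v) wt.1 & vtree E (tail_control p) (inr v) wt.1 wt.2].
  move=> v; case: (boolP (v \in fertile_at p)) => hv; last by exists ([::], Eps).
  have /(fertile_atP hAb hAc)[w hw hl] := hv; have [t ht] := vtree_exists hl.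
  by exists (w, t).
pose wd v := (wt v).1; pose tr v := (wt v).2.
have trP v : v \in fertile_at p -> wd v <> [::] /\ vtree E (tail_control p) (inr v) (wd v) (tr v).
  by move=> /hwt[].
have cb := counts_base (ord_max : 'I_N.+1) (@var_of V) trP.
have [b|Us [U0 hU sU]] := chain_exists hAb hAc (k := p) cb (zi := ord_max).
  exact: base_series_term.
pose D0 := base_words (ord_max : 'I_N.+1) (@var_of V) (fertile_at p) wd.
exists Us, (chain_words p D0), wd; split => //.
- elim=> [|n IH] a m w; first exact: token_words0.
  by apply: expand_tokens IH.
- move=> n a m w; apply: (chain_words_langr hAb hAc) => {a m w} [[b|v]] m w /=.
    by case=> _ ->; apply/langr_term.
  by case=> /hwt[_ h _] _ ->.
- by move=> v; rewrite U0; exact: base_series_nonterm.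
Qed.

(** It suffices that every coefficient of f is, for all large j, the number of
    words of its length generated along alpha beta ^ j gamma. *)
Lemma describes_limit (f : fps nat 1) (d : dcode) :
  (forall m, exists J, forall j, J <= j ->
     exists2 A : {set (mdeg m).-tuple Sigma},
       (forall w : (mdeg m).-tuple Sigma, w \in A <-> langr E (alpha :: tail_control j) S w)
       & f m = #|A|) ->
  d = (let z := iter p (joint_step nS N Ab) (joint_step nS N Ac
       (([::], [::]), base_weights N [::] (fvar 0))) in
  let y0 := (z.1, base_weights N z.1.2 (fvar N)) in
  let y := iter p (joint_step nS N Ab) y0 in
  let g := joint_step nS N Aa y0 in
  (N.+1, z.2, fadd (nth no_code g.2 (rank (start E)))
     (if rank (start E) \in g.1.1 then fnat 1 else fnat 0), y.2)) ->
  describes d f.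
Proof.
move=> hf ->.
have [Uz [Dz [cz wz sz codez]]] := length_chain_exists.
have [Uy [Dy [wd [cy wy ly sy y0]]]] := token_chain_exists.
have [] := chain_coded sz codez p; rewrite addn0.
set z := iter p _ _ => z1 z2.
cbv zeta; rewrite z1.
have cody0 : coded ord_max (base_weights N (signs_at p).2 (fvar N)) (tree_series (Uy 0)).
  apply: (coded_base (iv := @var_of V)) => //.
    exact: (represents_var (ord_max : 'I_N.+1)).
  by move=> v; rewrite y0 mem_filter mem_enum andbT.
have [] := chain_coded sy cody0 p.
set y := iter p _ _ => y1 y2.
have /choice[Ty hTy] : forall n, exists TLt,
    counts E (alpha :: tail_control (n + p)) TLt (expand E alpha (erasable_at (n + p)) (Dy n)) /\
    top_kept (Uy n) TLt (n + p).
  by move=> n; exact: (top_exists hAa hAb hAc (cy n)).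
have /choice[Tz hTz] : forall n, exists TLt,
    counts E (alpha :: tail_control n) TLt (expand E alpha (erasable_at n) (Dz n)) /\
    top_kept (Uz n) TLt n.
  by move=> n; exact: (top_exists hAa hAb hAc (cz n)).
pose e : nat := empty_generated p.
pose gs n : fps nat N.+1 := fun m => (size (Ty (p * n) S m) + (m == 0%MM) * e)%N.
pose fs n : fps nat 1 := fun m => (size (Tz (p * n + p) S m) + (m == 0%MM) * e)%N.
have zgs n : zser (gs n) = (tree_series (Ty (p * n)%N) S + e%:R)%R.
  apply: funext => m; rewrite scoefD scoef_nat /zser /gs PoszD; congr (_ + _)%R.
  by rewrite PoszM mulrC; case: eqP.
have zfs n : zser (fs n) = (tree_series (Tz (p * n + p)%N) S + e%:R)%R.
  apply: funext => m; rewrite scoefD scoef_nat /zser /fs PoszD; congr (_ + _)%R.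
  by rewrite PoszM mulrC; case: eqP.
have ELp n : erased_codes (p * n + p) = erased_codes p by rewrite /erased_codes (signs_at_period_mul hAb hAc).
(* Nonterminals without nonempty descendants have no variable, so their
   series at level p must vanish for the substitutions to compose. *)
have Fz v : v \notin fertile_at p -> tree_series (Uz p) (inr v) = 0%R.
  move=> hv; apply: funext => m; rewrite /tree_series /zser.
  case eq : (Uz p (inr v) m) => [|t ts] //.
  have ht : t \in Uz p (inr v) m by rewrite eq mem_head.
  have [w _ /wz[h1 h2 _]] := counts_sound (cz p) ht.
  by case/negP: hv; apply/(fertile_atP hAb hAc); exists w.
have Fy v : v \notin fertile_at p -> tree_series (Uy p) (inr v) = 0%R.
  move=> hv; apply: funext => m; rewrite /tree_series /zser.
  case eq : (Uy p (inr v) m) => [|t ts] //.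
  have ht : t \in Uy p (inr v) m by rewrite eq mem_head.
  have [w _ hD] := counts_sound (cy p) ht.
  case/negP: hv; have : v \in fertile_at (p + p).
    apply/(fertile_atP hAb hAc); exists w; [exact: (counts_nonempty (cy p) hD).1|exact: ly hD].
  by rewrite !mem_filter (signs_at_period hAb hAc (leqnn p)).
have [qz0 cz'] : (forall i, constfree (variables_of ord0 (tree_series (Uz p)) i)) /\
    forall n a, scomp (variables_of ord0 (tree_series (Uz p))) (tree_series (Uy n) a) =
      tree_series (Uz (n + p)) a.
  apply: (chain_comp (U := fun n => tree_series (Uz (n + p))) sy _ y0 Fz).
  split=> n; [exact: (chain_term sz)|exact: (chain_constfree sz)|].
  by move=> v; have := chain_step sz (n + p) v; rewrite addn0.
have [qy0 cy'] : (forall i, constfree (variables_of ord_max (tree_series (Uy p)) i)) /\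
    forall n a, scomp (variables_of ord_max (tree_series (Uy p))) (tree_series (Uy n) a) =
      tree_series (Uy (n + p)) a.
  apply: (chain_comp (U := fun n => tree_series (Uy (n + p))) sy _ y0 Fy).
  split=> n; [exact: (chain_term sy)|exact: (chain_constfree sy)|].
  move=> v; have := chain_step sy (n + p) v.
  by rewrite /erased_codes (signs_at_period hAb hAc) // leq_addl.
pose r := nat_variables_of (ord0 : 'I_1) (Uz p).
pose q := nat_variables_of (ord_max : 'I_N.+1) (Uy p).
have zr : (fun i => zser (r i)) = variables_of ord0 (tree_series (Uz p)).
  by apply: funext => i; exact: zser_variables.
have zq : (fun i => zser (q i)) = variables_of ord_max (tree_series (Uy p)).
  by apply: funext => i; exact: zser_variables.
have comp_q n : zser (gs n.+1) = scomp (fun i => zser (q i)) (zser (gs n)).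
  rewrite zq !zgs scompD // scomp_nat //; congr (_ + _)%R; apply/esym.
  have [_ k1] := hTy (p * n); have [_ k2] := hTy (p * n.+1).
  rewrite ELp in k1; rewrite ELp mulnSr in k2.
  rewrite mulnSr; apply: (chain_comp_letters qy0 (cy' (p * n)) _ k1 k2).
  exact: (chain_constfree sy).
have comp_r n : zser (fs n) = scomp (fun i => zser (r i)) (zser (gs n)).
  rewrite zr zgs zfs scompD // scomp_nat //; congr (_ + _)%R; apply/esym.
  have [_ k1] := hTy (p * n); have [_ k2] := hTz (p * n + p).
  rewrite ELp in k1; rewrite ELp in k2.
  apply: (chain_comp_letters qz0 (cz' (p * n)) _ k1 k2).
  exact: (chain_constfree sz).
(* The coefficient of m counts yields of token words with commutative image
   m, which have length mdeg m and whose set is eventually constant. *)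
have conv m : exists n0, forall n, n0 <= n -> gs n m = gs n0 m.
  pose Evs k := erasable_at (k + p).
  have perE k : Evs (k + sign_period N) = Evs k.
    rewrite /Evs /erasable_at -addnA [(_ + p)%N]addnC addnA.
    have := signs_at_sign_period_mul hAb hAc (j := k + p) 1 (leq_addl _ _).
    by rewrite muln1 => ->.
  pose I y := exists2 u, table E alpha S u & erases (erasable_at p) u y.
  have topD n w : expand E alpha (erasable_at (p * n + p)) (Dy (p * n)) S m w <->
      m <> 0%MM /\ exists z : (mdeg m).-tuple X,
        [/\ exists2 y, I y & rewrites (iterate (tokens E beta Evs (sign_period N))
               (#|{: X}|`! * n)) y z,
            all (completable (fertile_at p)) z, m = parikh ord_max (@var_of V) z
          & w = completion wd z].
    have rwE yw zw : rewrites (tokens E beta Evs (p * n)) yw zw <->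
        rewrites (iterate (tokens E beta Evs (sign_period N)) (#|{: X}|`! * n)) yw zw.
      rewrite card_sum /period -mulnA; split; apply: rewrites_mono => a b.
        by move/(tokens_iterate _ _ _ perE).
      by move/(tokens_iterate _ _ _ perE).
    have -> : erasable_at (p * n + p) = erasable_at p by rewrite /erasable_at (signs_at_period_mul hAb hAc).
    rewrite /=; split=> -[hm].
      move=> [u hu /(kept_spells_tokens _ _ _ _ (wy (p * n)))[yw [x [h1 h2 h3 h4 h5]]]].
      split=> //; have sx : size x == mdeg m by rewrite h4 mdeg_parikh.
      exists (Tuple sx); split => //; exists yw; last exact/rwE.
      by exists u.
    move=> [x [[yw [u hu hy] /rwE h2] h3 h4 h5]]; split => //; exists u => //.
    by apply/(kept_spells_tokens _ _ _ _ (wy (p * n))); exists yw, x.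
  have ne := tokens_nonerasing (E := E) (tau := beta) (Evs := Evs) (n := sign_period N).
  have [n0 hn0] := iterate_eventually ne I (mdeg m).
  exists n0 => n hn; rewrite /gs; congr addn.
  apply: (counts_same_size unamb (control_tail _) (control_tail _)
    (hTy (p * n)).1 (hTy (p * n0)).1) => w.
  split=> /topD[hm [x [h1 h2 h3 h4]]]; apply/topD; split=> //; exists x; split => //.
    exact/(hn0 n hn x).
  exact/(hn0 n hn x).
have [g hg] : exists g, fps_converges gs g.
  have /choice[n0 hn0] := conv; exists (fun m => gs (n0 m) m) => m.
  by exists (n0 m); exact: hn0.
(* A derivation through p * n + p steps of beta generates the empty word
   exactly if one through p steps does, so the constant e is the right one
   for all n. *)
have fsf m : exists J, forall n, J <= n -> fs n m = f m.
  have [J hJ] := hf m; exists J => n hn.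
  have [|A hA ->] := hJ (p * n + p).
    apply: leq_trans hn _; apply: leq_trans (leq_addr _ _); rewrite leq_pmull //.
    by apply: leq_trans (period_ge Sigma V); rewrite muln_gt0 expn_gt0.
  have eE : empty_generated (p * n + p) = empty_generated p.
    by rewrite /empty_generated (signs_at_period_mul hAb hAc).
  have wordsP w : expand E alpha (erasable_at (p * n + p)) (Dz (p * n + p)) S m w <->
      length_words E (ord0 : 'I_1) (alpha :: tail_control (p * n + p)) S m w.
    apply: expand_length (wz _) _ _ _ => v; exact: (erasable_atP hAb hAc).
  rewrite /fs; have [m0|m0] := eqVneq m 0%MM.
    rewrite {1}m0 (TL0 (hTz _).1) mul1n add0n /e -eE.
    subst m; have [h|h] := boolP (empty_generated _).
      have -> : A = [set: (mdeg (0%MM : 'X_{1..1})).-tuple Sigma].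
        apply/setP => w; rewrite in_setT; apply/hA.
        have -> : val w = [::] by apply: size0nil; rewrite size_tuple mdeg0.
        exact/empty_generatedP.
      by rewrite cardsT card_tuple mdeg0 expn0.
    apply/esym/eqP; rewrite cards_eq0; apply/eqP/setP => w; rewrite in_set0.
    apply/negP => /hA; have -> : val w = [::] by apply: size0nil; rewrite size_tuple mdeg0.
    by move/empty_generatedP; exact/negP.
  rewrite mul0n addn0.
  apply: (size_counts_words unamb (control_tail _) (hTz (p * n + p)).1 (d := mdeg m)).
    by move=> w /wordsP[_ _ ->]; rewrite mdegMn mdeg1 mul1n.
  move=> w; rewrite wordsP hA; split=> [h|[]//]; split => //.
    move=> ew; case/eqP: m0; apply/eqP; rewrite -mdeg_eq0.
    by have := size_tuple w; rewrite ew /= => <-.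
  by rewrite size_tuple; exact: mnm_one.
exists r, q, gs, g; split => //.
- move=> i; apply: represents_denotes; have := z2 i.
  by rewrite -[variables_of _ _ i]zser_variables.
- split.
    apply: represents_denotes; rewrite zgs muln0; apply: represents_add; last first.
      rewrite /e /empty_generated /=; case: ifP => _; exact: represents_nat.
    rewrite nth_weight_step; last exact: rank_lt.
    have [_] := hTy 0; apply: represents_kept.
      by move=> a; apply: letter_series_constfree; exact: (chain_constfree sy 0).
    by move=> a; apply: (coded_letters cody0); exact: (chain_term sy 0).
  move=> i; apply: represents_denotes; have := y2 i.
  by rewrite -[variables_of _ _ i]zser_variables.
- move=> n; apply: scomp_subst => [i|]; last exact: comp_q.
  by rewrite -[zser (q i)]/((fun i => zser (q i)) i) zq.
apply: scomp_subst => [i|]; first by rewrite -[zser (r i)]/((fun i => zser (r i)) i) zr.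
have r0 i : constfree (zser (r i)).
  by rewrite -[zser (r i)]/((fun i => zser (r i)) i) zr.
apply: funext => m; set dg := (mdeg m).+1.
(* Only the finitely many monomials of degree at most that of m contribute
   to the coefficient of m, so some n serves both limits. *)
have [J hJ] := fsf m.
have [K hK] := @eventually_all 'X_{1..N.+1 < dg} (fun n I => gs n I = g I) (fun I => hg I).
have e1 : zser f m = zser (fs (maxn J K)) m by rewrite /zser hJ ?leq_maxl.
rewrite e1 comp_r !(@scompE _ _ _ r0 _ _ dg) //; apply: eq_bigr => I _.
by rewrite /zser hK // leq_maxr.
Qed.
End Description.

Lemma mem_triples n a b c : ((a, (b, c)) \in triples n) = [&& a < n, b < n & c < n].
Proof.
apply/flatten_mapP/and3P => [[a']|[ha hb hc]].
  rewrite mem_iota => ha /flatten_mapP[b']; rewrite mem_iota => hb /mapP[c'].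
  by rewrite mem_iota => hc [-> -> ->].
exists a; rewrite ?mem_iota //; apply/flatten_mapP; exists b; rewrite ?mem_iota //.
by apply: map_f; rewrite mem_iota.
Qed.

Lemma head_unique (Y : eqType) (x0 y : Y) s :
  y \in s -> (forall x, x \in s -> x = y) -> head x0 s = y.
Proof. by case: s => // x s _ h; apply: h; exact: mem_head. Qed.

Lemma table_triple_limiting (Sigma V T : finType) (E : et0l Sigma V T) (ctl : dfa)
    (alpha beta gamma : T) :
  recognizes ctl (control E) ->
  (forall r, control E r <-> exists n, r = alpha :: tail_control beta gamma n) ->
  table_triple #|T| ctl = (rank alpha, (rank beta, rank gamma)).
Proof.
move=> hc hr; apply: head_unique.
  rewrite mem_filter mem_triples !rank_lt !andbT.
  by apply: (hc [:: alpha; beta; gamma]).1; apply/hr; exists 1.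
move=> [a [b c]]; rewrite mem_filter mem_triples => /andP[h].
move=> /and3P[/rank_surj[ta ea] /rank_surj[tb eb] /rank_surj[tc ec]]; subst a b c.
have /hr[[|[|n]]] : control E [:: ta; tb; tc] by exact/hc.
- by [].
- by case=> -> -> ->.
- by case=> _ _ _; case: n.
Qed.

(** By the limiting condition a word is generated if and only if it is
    generated along alpha beta ^ j gamma for all large j, and there are
    finitely many words of each length. *)
Lemma description_correct (Sigma V T : finType) (E : et0l Sigma V T) (c : gcode) :
  presents c E -> unambiguous E -> limiting E ->
  exists2 f : fps nat 1,
    generating_function (et0l_language E) f & describes (description c) f.
Proof.
case: c => [[[[[nS nV] nT] s] tabs] ctl] [[-> -> ->] -> htabs hctl] unamb.
move=> [alpha [beta [gamma [_ hr _ _ hlim]]]].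
pose A (m : 'X_{1..1}) := [set w : (mdeg m).-tuple Sigma | `[< et0l_language E w >]].
have memA m (w : (mdeg m).-tuple Sigma) : w \in A m <-> et0l_language E w.
  by rewrite inE; split => /asboolP.
exists (fun m => #|A m|); first by move=> m; exists (A m) => // w; exact: memA.
apply: (@describes_limit _ _ _ E alpha beta gamma (nth_dfa tabs (rank alpha))
  (nth_dfa tabs (rank beta)) (nth_dfa tabs (rank gamma))) => //.
- by move=> v; exact: htabs.
- by move=> v; exact: htabs.
- by move=> v; exact: htabs.
- move=> m; have [w|J hJ] := @eventually_all ((mdeg m).-tuple Sigma) (fun j w =>
      et0l_language E w <-> langr E (alpha :: tail_control beta gamma j) (inr (start E)) w).
    have [[n hn]|no] := pselect (exists n,
        langr E (alpha :: tail_control beta gamma n) (inr (start E)) w).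
      have [K _ hK] := hlim n _ hn; exists K => j hj; split=> _; first exact: hK.
      by exists (alpha :: tail_control beta gamma n) => //; apply/hr; exists n.
    exists 0 => j _; split=> h; case: no; last by exists j.
    by case: h => r /hr[n ->] h; exists n.
  exists J => j hj; exists (A m) => // w.
  by rewrite memA; exact: hJ.
by rewrite /description /= (table_triple_limiting hctl hr).
Qed.

(** * Computability of the description *)

Section Computable.
Variable P : Type.

Lemma computable_const_nat n : @computable P nat (fun=> n).
Proof.
elim: n => [|n IH]; first exact: (comp_comp (comp_tt P) comp_zero).
exact: (comp_comp IH comp_succ).
Qed.

Lemma computable_fst A B (f : P -> A * B) : computable f -> computable (fun p => (f p).1).
Proof. by move=> h; exact: (comp_comp h (@comp_fst A B)). Qed.

Lemma computable_snd A B (f : P -> A * B) : computable f -> computable (fun p => (f p).2).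
Proof. by move=> h; exact: (comp_comp h (@comp_snd A B)). Qed.

Lemma computable_nil A : @computable P (seq A) (fun=> [::]).
Proof. exact: (comp_comp (comp_tt P) (@comp_nil A)). Qed.

Lemma computable_cons A (f : P -> A) s :
  computable f -> computable s -> computable (fun p => f p :: s p).
Proof. by move=> hf hs; exact: (comp_comp (comp_pair hf hs) (@comp_cons A)). Qed.

Lemma computable_S f : computable f -> computable (fun p : P => (f p).+1).
Proof. by move=> h; exact: (comp_comp h comp_succ). Qed.

Lemma computable_nat_rect A (f : P -> A) (g : P -> nat -> A -> A) n :
  computable f -> computable (fun q : P * (nat * A) => g q.1 q.2.1 q.2.2) ->
  computable n -> computable (fun p => nat_rect (fun=> A) (f p) (g p) (n p)).
Proof.
move=> hf hg hn; apply: comp_ext (comp_comp (comp_pair (comp_id P) hn) (comp_nat_rec hf hg)) _.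
by move=> p /=; elim: (n p) => //= k ->.
Qed.

Lemma computable_list_rect A B (f : P -> B) (g : P -> A -> seq A -> B -> B) s :
  computable f -> computable (fun q : P * (A * (seq A * B)) => g q.1 q.2.1 q.2.2.1 q.2.2.2) ->
  computable s -> computable (fun p => list_rect (fun=> B) (f p) (g p) (s p)).
Proof.
move=> hf hg hs; apply: comp_ext (comp_comp (comp_pair (comp_id P) hs) (comp_list_rec hf hg)) _.
by move=> p /=; elim: (s p) => //= x t ->.
Qed.

End Computable.

Ltac computable_step := cbv beta; first
  [ exact: comp_id | exact: computable_const_nat | exact: computable_nil
  | apply: computable_fst | apply: computable_snd | apply: comp_pair
  | apply: computable_cons | apply: computable_S ].
Ltac computable_tac := repeat computable_step.

Section Basic.
Variable P : Type.

Lemma computable_iter A (n : P -> nat) (g : P -> A -> A) f :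
  computable n -> computable (fun q : P * A => g q.1 q.2) -> computable f ->
  computable (fun p => iter (n p) (g p) (f p)).
Proof.
move=> hn hg hf; apply: (comp_ext (f := fun p => nat_rect (fun=> A) (f p) (fun _ => g p) (n p))).
  apply: (computable_nat_rect (g := fun p _ => g p)) => //.
  apply: (comp_comp (f := fun q : P * (nat * A) => (q.1, q.2.2)) _ hg); computable_tac.
by move=> p; elim: (n p) => //= k ->.
Qed.

Lemma computable_foldr A B (g : P -> A -> B -> B) f s :
  computable (fun q : P * (A * B) => g q.1 q.2.1 q.2.2) -> computable f -> computable s ->
  computable (fun p => foldr (g p) (f p) (s p)).
Proof.
move=> hg hf hs.
apply: (comp_ext (f := fun p => list_rect (fun=> B) (f p) (fun x _ => g p x) (s p))).
  apply: (computable_list_rect (g := fun p x _ => g p x)) => //.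
  apply: (comp_comp (f := fun q : P * (A * (seq A * B)) => (q.1, (q.2.1, q.2.2.2))) _ hg).
  computable_tac.
by move=> p; elim: (s p) => //= x t ->.
Qed.

Lemma computable_map A B (g : P -> A -> B) s :
  computable (fun q : P * A => g q.1 q.2) -> computable s ->
  computable (fun p => [seq g p x | x <- s p]).
Proof.
move=> hg hs.
apply: (comp_ext (f := fun p => foldr (fun x t => g p x :: t) [::] (s p))).
  apply: (computable_foldr (g := fun p x t => g p x :: t)) => //; computable_tac.
  by apply: (comp_comp (f := fun q : P * (A * seq B) => (q.1, q.2.1)) _ hg); computable_tac.
by move=> p; elim: (s p) => //= x t ->.
Qed.

Lemma computable_cat (A : Type) (s t : P -> seq A) :
  computable s -> computable t -> computable (fun p => s p ++ t p).
Proof.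
move=> hs ht; apply: (comp_ext (f := fun p => foldr (fun x t => x :: t) (t p) (s p))).
  by apply: (computable_foldr (g := fun _ x t => x :: t)) => //; computable_tac.
by move=> p; elim: (s p) => //= x u ->.
Qed.

End Basic.

(** Closure under composition for a function of two arguments given in curried
    form, the form in which the higher-order lemmas below state their
    hypotheses. *)
Lemma computable_app P A B C (g : A -> B -> C) (f : P -> A) (h : P -> B) :
  computable (fun q : A * B => g q.1 q.2) -> computable f -> computable h ->
  computable (fun p => g (f p) (h p)).
Proof. by move=> hg hf hh; exact: (comp_comp (comp_pair hf hh) hg). Qed.

Lemma computable_flatten P A (s : P -> seq (seq A)) :
  computable s -> computable (fun p => flatten (s p)).
Proof.
move=> hs; apply: (computable_foldr (g := fun _ => cat)) => //; last exact: computable_nil.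
by apply: computable_cat; computable_tac.
Qed.

Lemma computable_rev P A (s : P -> seq A) : computable s -> computable (fun p => rev (s p)).
Proof.
move=> hs; apply: (comp_ext (f := fun p => foldr (fun x t => t ++ [:: x]) [::] (s p))).
  apply: (computable_foldr (g := fun _ x t => t ++ [:: x])) => //; last exact: computable_nil.
  by apply: computable_cat; computable_tac.
by move=> p; elim: (s p) => //= x t ->; rewrite rev_cons cats1.
Qed.

(** A left fold is a right fold over the reversed list. *)
Lemma computable_foldl P A B (g : P -> B -> A -> B) f s :
  computable (fun q : P * (B * A) => g q.1 q.2.1 q.2.2) -> computable f -> computable s ->
  computable (fun p => foldl (g p) (f p) (s p)).
Proof.
move=> hg hf hs.
apply: (comp_ext (f := fun p => foldr (fun x z => g p z x) (f p) (rev (s p)))).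
  apply: (computable_foldr (g := fun p x z => g p z x)) => //; last exact: computable_rev.
  apply: (comp_comp (f := fun q : P * (A * B) => (q.1, (q.2.2, q.2.1))) _ hg).
  by computable_tac.
by move=> p; rewrite -foldl_rev revK.
Qed.

Lemma computable_size P A (s : P -> seq A) : computable s -> computable (fun p => size (s p)).
Proof.
move=> hs; apply: (comp_ext (f := fun p => foldr (fun _ n => n.+1) 0 (s p))).
  by apply: (computable_foldr (g := fun _ _ n => n.+1)) => //; computable_tac.
by move=> p; elim: (s p) => //= x t ->.
Qed.

Lemma computable_head P A (x0 : P -> A) s :
  computable x0 -> computable s -> computable (fun p => head (x0 p) (s p)).
Proof.
move=> h0 hs; apply: (comp_ext (f := fun p => list_rect (fun=> A) (x0 p) (fun x _ _ => x) (s p))).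
  by apply: (computable_list_rect (g := fun _ x _ _ => x)) => //; computable_tac.
by move=> p; case: (s p).
Qed.

Lemma computable_behead P A (s : P -> seq A) :
  computable s -> computable (fun p => behead (s p)).
Proof.
move=> hs; apply: (comp_ext (f := fun p => list_rect (fun=> seq A) [::] (fun _ t _ => t) (s p))).
  by apply: (computable_list_rect (g := fun _ _ t _ => t)) => //; computable_tac.
by move=> p; case: (s p).
Qed.

Lemma computable_nth P A (x0 : P -> A) s i : computable x0 -> computable s ->
  computable i -> computable (fun p => nth (x0 p) (s p) (i p)).
Proof.
move=> h0 hs hi.
apply: (comp_ext (f := fun p => head (x0 p) (iter (i p) behead (s p)))).
  apply: computable_head => //; apply: (computable_iter (g := fun _ => behead)) => //.
  by apply: computable_behead; computable_tac.
move=> p; elim: (i p) (s p) => [|n IH] t; first by case: t.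
by rewrite iterSr IH; case: t => //=; rewrite nth_nil.
Qed.

Lemma computable_iota P n : computable n -> computable (fun p : P => iota 0 (n p)).
Proof.
move=> hn.
apply: (comp_ext (f := fun p => nat_rect (fun=> seq nat) [::] (fun k t => t ++ [:: k]) (n p))).
  apply: (computable_nat_rect (g := fun _ k t => t ++ [:: k])) => //; first exact: computable_nil.
  by apply: computable_cat; computable_tac.
by move=> p; elim: (n p) => // k /= ->; rewrite -[RHS]/(iota 0 k.+1) -addn1 iotaD.
Qed.

Lemma computable_nseq P A n (x : P -> A) :
  computable n -> computable x -> computable (fun p => nseq (n p) (x p)).
Proof.
move=> hn hx; apply: (comp_ext (f := fun p => [seq x p | _ <- iota 0 (n p)])).
  apply: (computable_map (g := fun p _ => x p)); last exact: computable_iota.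
  exact: (comp_comp (comp_fst _ _) hx).
by move=> p; elim: (n p) 0 => //= k IH i; rewrite IH.
Qed.

Lemma computable_addn P m n : computable m -> computable n ->
  computable (fun p : P => m p + n p).
Proof.
move=> hm hn; apply: (comp_ext (f := fun p => iter (n p) S (m p))).
  by apply: (computable_iter (g := fun _ => S)) => //; computable_tac.
by move=> p; rewrite iter_succn.
Qed.

Lemma computable_predn P n : computable n -> computable (fun p : P => (n p).-1).
Proof.
move=> hn; apply: (comp_ext (f := fun p => nat_rect (fun=> nat) 0 (fun k _ => k) (n p))).
  by apply: (computable_nat_rect (g := fun _ k _ => k)) => //; computable_tac.
by move=> p; case: (n p).
Qed.

Lemma computable_subn P m n : computable m -> computable n ->
  computable (fun p : P => m p - n p).
Proof.
move=> hm hn; apply: (comp_ext (f := fun p => iter (n p) predn (m p))).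
  apply: (computable_iter (g := fun _ => predn)) => //.
  by apply: computable_predn; computable_tac.
by move=> p; elim: (n p) => [|k IH]; rewrite ?subn0 //= IH subnS.
Qed.

Lemma computable_muln P m n : computable m -> computable n ->
  computable (fun p : P => m p * n p).
Proof.
move=> hm hn; apply: (comp_ext (f := fun p => iter (n p) (addn (m p)) 0)).
  apply: (computable_iter (g := fun p => addn (m p))) => //; last exact: computable_const_nat.
  apply: computable_addn; last by computable_tac.
  exact: (comp_comp (comp_fst _ _) hm).
by move=> p; rewrite iter_addn_0.
Qed.

Lemma computable_expn P m n : computable m -> computable n ->
  computable (fun p : P => m p ^ n p).
Proof.
move=> hm hn; apply: (comp_ext (f := fun p => iter (n p) (muln (m p)) 1)).
  apply: (computable_iter (g := fun p => muln (m p))) => //; last exact: computable_const_nat.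
  apply: computable_muln; last by computable_tac.
  exact: (comp_comp (comp_fst _ _) hm).
by move=> p; rewrite iter_muln_1.
Qed.

Lemma computable_factorial P n : computable n -> computable (fun p : P => (n p)`!).
Proof.
move=> hn; apply: (comp_ext (f := fun p => nat_rect (fun=> nat) 1 (fun k a => k.+1 * a) (n p))).
  apply: (computable_nat_rect (g := fun _ k a => k.+1 * a)) => //; first exact: computable_const_nat.
  by apply: computable_muln; computable_tac.
by move=> p; elim: (n p) => //= k ->; rewrite factS.
Qed.

Lemma computable_sumn P s : computable s -> computable (fun p : P => sumn (s p)).
Proof.
move=> hs; apply: (computable_foldr (g := fun _ => addn)) => //; last exact: computable_const_nat.
by apply: computable_addn; computable_tac.
Qed.

Lemma computable_if P A (b : P -> bool) (f g : P -> A) :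
  computable (fun p => nat_of_bool (b p)) -> computable f -> computable g ->
  computable (fun p => if b p then f p else g p).
Proof.
move=> hb hf hg.
apply: (comp_ext (f := fun p => nat_rect (fun=> A) (g p) (fun _ _ => f p) (nat_of_bool (b p)))).
  apply: (computable_nat_rect (g := fun p _ _ => f p)) => //.
  exact: (comp_comp (comp_fst _ _) hf).
by move=> p; case: (b p).
Qed.

Lemma computable_leq P m n : computable m -> computable n ->
  computable (fun p : P => nat_of_bool (m p <= n p)).
Proof.
move=> hm hn; apply: (comp_ext (f := fun p => 1 - (m p - n p))).
  apply: computable_subn; first exact: computable_const_nat.
  exact: computable_subn.
by move=> p; rewrite -subn_eq0; case: (m p - n p) => [|k] //; rewrite subSS sub0n.
Qed.

Lemma computable_eqn P (m n : P -> nat) : computable m -> computable n ->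
  computable (fun p : P => nat_of_bool (m p == n p)).
Proof.
move=> hm hn; apply: (comp_ext (f := fun p => (m p <= n p) * (n p <= m p))).
  by apply: computable_muln; exact: computable_leq.
by move=> p; rewrite mulnb eqn_leq.
Qed.

Lemma computable_has P A (a : P -> A -> bool) s :
  computable (fun q : P * A => nat_of_bool (a q.1 q.2)) -> computable s ->
  computable (fun p => nat_of_bool (has (a p) (s p))).
Proof.
move=> ha hs.
apply: (comp_ext (f := fun p => foldr (fun x n => if a p x then 1 else n) 0 (s p))).
  apply: (computable_foldr (g := fun p x n => if a p x then 1 else n)) => //;
    last exact: computable_const_nat.
  apply: computable_if; computable_tac.
  apply: (comp_comp (f := fun q : P * (A * nat) => (q.1, q.2.1)) _ ha); computable_tac.
by move=> p; elim: (s p) => //= x t ->; case: (a p x).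
Qed.

Lemma computable_mem P (x : P -> nat) (s : P -> seq nat) : computable x -> computable s ->
  computable (fun p => nat_of_bool (x p \in s p)).
Proof.
move=> hx hs; apply: (comp_ext (f := fun p => nat_of_bool (has (fun y => y == x p) (s p)))).
  apply: (computable_has (a := fun p y => y == x p)) => //.
  by apply: computable_eqn; [computable_tac|exact: (comp_comp (comp_fst _ _) hx)].
by move=> p; rewrite has_pred1.
Qed.

Lemma computable_count P A (a : P -> A -> bool) s :
  computable (fun q : P * A => nat_of_bool (a q.1 q.2)) -> computable s ->
  computable (fun p => count (a p) (s p)).
Proof.
move=> ha hs; apply: (comp_ext (f := fun p => foldr (fun x n => a p x + n) 0 (s p))).
  apply: (computable_foldr (g := fun p x n => a p x + n)) => //; last exact: computable_const_nat.
  apply: computable_addn; last by computable_tac.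
  apply: (comp_comp (f := fun q : P * (A * nat) => (q.1, q.2.1)) _ ha); computable_tac.
by move=> p; elim: (s p) => //= x t ->.
Qed.

Lemma computable_filter P A (a : P -> A -> bool) s :
  computable (fun q : P * A => nat_of_bool (a q.1 q.2)) -> computable s ->
  computable (fun p => [seq x <- s p | a p x]).
Proof.
move=> ha hs.
apply: (comp_ext (f := fun p => foldr (fun x t => if a p x then x :: t else t) [::] (s p))).
  apply: (computable_foldr (g := fun p x t => if a p x then x :: t else t)) => //;
    last exact: computable_nil.
  apply: computable_if; computable_tac.
  apply: (comp_comp (f := fun q : P * (A * seq A) => (q.1, q.2.1)) _ ha); computable_tac.
by move=> p; elim: (s p) => //= x t ->; case: (a p x).
Qed.

(** Tests with a boolean result come before conditionals, since the coercion
    of a boolean to a number is itself a conditional. *)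
Ltac computable_step ::= cbv beta; first
  [ assumption | exact: comp_id | exact: computable_const_nat | exact: computable_nil
  | apply: computable_fst | apply: computable_snd | apply: comp_pair
  | apply: computable_has | apply: computable_mem | apply: computable_eqn
  | apply: computable_leq | apply: computable_if | apply: computable_flatten
  | apply: computable_cat | apply: computable_map | apply: computable_filter
  | apply: computable_count | apply: computable_nth | apply: computable_iota
  | apply: computable_nseq | apply: computable_size | apply: computable_head
  | apply: computable_sumn | apply: computable_factorial | apply: computable_expn
  | apply: computable_addn | apply: computable_subn | apply: computable_muln
  | apply: computable_foldl | apply: computable_foldr | apply: computable_iter
  | apply: computable_cons | apply: computable_S ].

Ltac computable_function := fail.
Ltac computable_hyp := match goal with
  | H : @computable _ _ ?x |- @computable _ _ (fun q => ?x (@?f q)) =>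
      apply: (@comp_comp _ _ _ f x _ H)
  | H : @computable _ _ (fun q => ?g (fst q) (snd q)) |-
      @computable _ _ (fun p => ?g (@?a p) (@?b p)) =>
      apply: (@computable_app _ _ _ _ g a b H)
  end.
Ltac computable_auto :=
  repeat first [computable_hyp | computable_function | computable_step].

Lemma computable_dstep P (A : P -> dfa) q a : computable A -> computable q -> computable a ->
  computable (fun p => dstep (A p) (q p) (a p)).
Proof. by move=> hA hq ha; rewrite /dstep; computable_auto. Qed.

Lemma computable_drun P (A : P -> dfa) q w : computable A -> computable q -> computable w ->
  computable (fun p => drun (A p) (q p) (w p)).
Proof.
move=> hA hq hw; apply: (computable_foldl (g := fun p => dstep (A p))) => //.
by apply: computable_dstep; computable_auto.
Qed.

Lemma computable_nstates P (A : P -> dfa) : computable A ->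
  computable (fun p => nstates (A p)).
Proof. by move=> hA; rewrite /nstates; computable_auto. Qed.

Lemma computable_words_upto P A (s : P -> seq A) n : computable s -> computable n ->
  computable (fun p => words_upto (s p) (n p)).
Proof. by move=> hs hn; rewrite /words_upto /words_of; computable_auto. Qed.

Ltac computable_function ::= first [ apply: computable_dstep
  | apply: computable_drun | apply: computable_nstates
  | apply: computable_words_upto ].

Lemma computable_pmul P (c d : P -> polycode) : computable c -> computable d ->
  computable (fun p => pmul (c p) (d p)).
Proof. by move=> hc hd; rewrite /pmul /tmul /eadd; computable_auto. Qed.

Lemma computable_popp P (c : P -> polycode) : computable c -> computable (fun p => popp (c p)).
Proof. by move=> hc; rewrite /popp; computable_auto. Qed.

Lemma computable_fadd P (x y : P -> ratcode) : computable x -> computable y ->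
  computable (fun p => fadd (x p) (y p)).
Proof.
move=> hx hy; rewrite /fadd; apply: comp_pair; first apply: computable_cat;
  by apply: computable_pmul; computable_auto.
Qed.

Lemma computable_fmul P (x y : P -> ratcode) : computable x -> computable y ->
  computable (fun p => fmul (x p) (y p)).
Proof.
by move=> hx hy; rewrite /fmul; apply: comp_pair; apply: computable_pmul; computable_auto.
Qed.

Lemma computable_fopp P (x : P -> ratcode) : computable x -> computable (fun p => fopp (x p)).
Proof.
move=> hx; rewrite /fopp; apply: comp_pair; first apply: computable_popp; computable_auto.
Qed.

Lemma computable_fstar P (x : P -> ratcode) : computable x -> computable (fun p => fstar (x p)).
Proof.
move=> hx; rewrite /fstar; apply: comp_pair; last apply: computable_cat; computable_auto.
Qed.

Lemma computable_fnat P (n : P -> nat) : computable n -> computable (fun p => fnat (n p)).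
Proof. by move=> hn; rewrite /fnat; computable_auto. Qed.

Lemma computable_fvar P (n : P -> nat) : computable n -> computable (fun p => fvar (n p)).
Proof. by move=> hn; rewrite /fvar; computable_auto. Qed.

Lemma computable_fsum P (s : P -> seq ratcode) : computable s ->
  computable (fun p => fsum (s p)).
Proof.
move=> hs; apply: (computable_foldr (g := fun _ => fadd)) => //.
  by apply: computable_fadd; computable_auto.
by apply: computable_fnat; computable_auto.
Qed.

Lemma computable_entry P (M : P -> seq (seq ratcode)) i j : computable M ->
  computable i -> computable j -> computable (fun p => entry (M p) (i p) (j p)).
Proof. by move=> hM hi hj; rewrite /entry; computable_auto. Qed.

Ltac computable_function ::= first [ apply: computable_dstep
  | apply: computable_drun | apply: computable_nstates
  | apply: computable_words_upto | apply: computable_fadd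
  | apply: computable_fmul | apply: computable_fopp | apply: computable_fstar
  | apply: computable_fnat | apply: computable_fvar | apply: computable_fsum
  | apply: computable_entry ].

Lemma computable_feliminate P n (M : P -> seq (seq ratcode)) k : computable n ->
  computable M -> computable k -> computable (fun p => feliminate (n p) (M p) (k p)).
Proof. by move=> hn hM hk; rewrite /feliminate; computable_auto. Qed.

Lemma computable_fkept P (A : P -> dfa) El nX (wt : P -> nat -> ratcode) :
  computable A -> computable El -> computable nX ->
  computable (fun q : P * nat => wt q.1 q.2) ->
  computable (fun p => fkept (A p) (El p) (nX p) (wt p)).
Proof.
move=> hA hE hX hw; rewrite /fkept; cbv zeta.
apply: computable_fadd; last by computable_auto.
apply: computable_entry; [|by computable_auto|by computable_auto].
apply: (computable_foldl (g := fun p => feliminate (nstates (A p)))).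
- by apply: computable_feliminate; computable_auto.
- by computable_auto.
- by computable_auto.
Qed.

Ltac computable_function ::= first [ apply: computable_dstep
  | apply: computable_drun | apply: computable_nstates
  | apply: computable_words_upto | apply: computable_fadd
  | apply: computable_fmul | apply: computable_fopp | apply: computable_fstar
  | apply: computable_fnat | apply: computable_fvar | apply: computable_fsum
  | apply: computable_entry | apply: computable_fkept ].

Lemma computable_no_code P : @computable P ratcode (fun=> no_code).
Proof. by rewrite /no_code; computable_auto. Qed.

Lemma computable_letter_weight P nS N (ws : P -> weights) a : computable nS ->
  computable N -> computable ws -> computable a ->
  computable (fun p => letter_weight (nS p) (N p) (ws p) (a p)).
Proof.
move=> hS hN hw ha; rewrite /letter_weight; apply: computable_nth => //.
  exact: computable_no_code.
by computable_auto.
Qed.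

Lemma computable_letters P nS (s : P -> seq nat * seq nat) : computable nS -> computable s ->
  computable (fun p => erased_letters (nS p) (s p)) /\
  computable (fun p => live_letters (nS p) (s p)).
Proof.
by move=> hS hs; rewrite /erased_letters /live_letters; split; computable_auto.
Qed.

Lemma computable_weight_step P nS N (A : P -> nat -> dfa) s ws : computable nS ->
  computable N -> computable (fun q : P * nat => A q.1 q.2) -> computable s -> computable ws ->
  computable (fun p => weight_step (nS p) (N p) (A p) (s p) (ws p)).
Proof.
move=> hS hN hA hs hw; have [hE _] := computable_letters hS hs.
rewrite /weight_step; apply: computable_cat.
  apply: (computable_map (g := fun p i => fkept (A p i) (erased_letters (nS p) (s p))
     (nS p + N p) (letter_weight (nS p) (N p) (ws p)))); last exact: computable_iota.
  apply: (computable_fkept (A := fun q => A q.1 q.2)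
    (wt := fun q => letter_weight (nS q.1) (N q.1) (ws q.1))) => //.
  - exact: (comp_comp (comp_fst _ _) hE).
  - by computable_auto.
  - by apply: computable_letter_weight; computable_auto.
apply: computable_cons; last exact: computable_nil.
by apply: computable_nth => //; exact: computable_no_code.
Qed.

Lemma computable_accepts P nS (A : P -> dfa) s : computable nS -> computable A -> computable s ->
  computable (fun p => nat_of_bool (accepts_erased (nS p) (A p) (s p))) /\
  computable (fun p => nat_of_bool (accepts_kept (nS p) (A p) (s p))).
Proof.
move=> hS hA hs; have [hE hK] := computable_letters hS hs.
rewrite /accepts_erased /accepts_kept; cbv zeta.
have hL : computable (fun p => live_letters (nS p) (s p) ++ erased_letters (nS p) (s p)).
  exact: computable_cat.
have hW : computable (fun p => words_upto (live_letters (nS p) (s p) ++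
    erased_letters (nS p) (s p)) (nstates (A p))).
  by apply: computable_words_upto => //; exact: computable_nstates.
have hV : computable (fun p => words_upto (erased_letters (nS p) (s p)) (nstates (A p))).
  by apply: computable_words_upto => //; exact: computable_nstates.
split; first by apply: computable_has => //; computable_auto.
apply: (computable_has (a := fun p x => has (fun a => has (fun y =>
    drun (A p) (dstep (A p) (drun (A p) 0 x) a) y \in (A p).2) (words_upto
      (live_letters (nS p) (s p) ++ erased_letters (nS p) (s p)) (nstates (A p))))
    (live_letters (nS p) (s p)))) => //.
apply: (computable_has (a := fun q a => has (fun y =>
    drun (A q.1) (dstep (A q.1) (drun (A q.1) 0 q.2) a) y \in (A q.1).2) (words_upto
      (live_letters (nS q.1) (s q.1) ++ erased_letters (nS q.1) (s q.1)) (nstates (A q.1))))).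
  apply: (computable_has (a := fun q y =>
    drun (A q.1.1) (dstep (A q.1.1) (drun (A q.1.1) 0 q.1.2) q.2) y \in (A q.1.1).2)).
    by computable_auto.
  exact: (comp_comp (f := fun q : (P * seq nat) * nat => q.1.1)
    (computable_fst (comp_fst _ _)) hW).
exact: (comp_comp (comp_fst _ _) hK).
Qed.

Lemma computable_joint_step P nS N (A : P -> nat -> dfa) z : computable nS ->
  computable N -> computable (fun q : P * nat => A q.1 q.2) -> computable z ->
  computable (fun p => joint_step (nS p) (N p) (A p) (z p)).
Proof.
move=> hS hN hA hz; rewrite /joint_step; apply: comp_pair; last first.
  by apply: computable_weight_step => //; computable_auto.
have hS' : computable (fun q : P * nat => nS q.1) by computable_auto.
have hz' : computable (fun q : P * nat => (z q.1).1) by computable_auto.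
have [h1 h2] := computable_accepts hS' hA hz'.
rewrite /sign_step; apply: comp_pair.
  by apply: (computable_filter (a := fun p i => accepts_erased (nS p) (A p i) (z p).1)) => //;
    exact: computable_iota.
by apply: (computable_filter (a := fun p i => accepts_kept (nS p) (A p i) (z p).1)) => //;
  exact: computable_iota.
Qed.

Lemma computable_base_weights P N (F : P -> seq nat) z : computable N -> computable F ->
  computable z -> computable (fun p => base_weights (N p) (F p) (z p)).
Proof. by move=> hN hF hz; rewrite /base_weights; computable_auto. Qed.

Lemma computable_table_triple P nT (ctl : P -> dfa) : computable nT -> computable ctl ->
  computable (fun p => table_triple (nT p) (ctl p)).
Proof.
move=> hT hc; rewrite /table_triple /triples; apply: computable_head; first by computable_auto.
apply: computable_filter; last by computable_auto.
change (computable (fun q : P * (nat * (nat * nat)) => nat_of_bool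
  (drun (ctl q.1) 0 [:: q.2.1; q.2.2.1; q.2.2.2] \in (ctl q.1).2))).
by computable_auto.
Qed.

Lemma computable_period P nS N : computable nS -> computable N ->
  computable (fun p : P => period (nS p) (N p)).
Proof. by move=> hS hN; rewrite /period /sign_period; computable_auto. Qed.

Lemma computable_nth_dfa P (tabs : P -> seq (seq dfa)) t i : computable tabs ->
  computable t -> computable i -> computable (fun p => nth_dfa (tabs p) (t p) (i p)).
Proof. by move=> h ht hi; rewrite /nth_dfa; computable_auto. Qed.

Lemma computable_joint_iter P nS N (A : P -> nat -> dfa) z : computable nS ->
  computable N -> computable (fun q : P * nat => A q.1 q.2) -> computable z ->
  computable (fun p => iter (period (nS p) (N p)) (joint_step (nS p) (N p) (A p)) (z p)).
Proof.
move=> hS hN hA hz.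
apply: (computable_iter (g := fun p => joint_step (nS p) (N p) (A p))) => //.
  exact: computable_period.
apply: (computable_joint_step (A := fun q => A q.1)); try by computable_auto.
Qed.

Lemma computable_description_of P nS N (start : P -> nat) tabs x : computable nS ->
  computable N -> computable start -> computable tabs -> computable x ->
  computable (fun p => description_of (nS p) (N p) (start p) (tabs p) (x p)).
Proof.
move=> hS hN hs ht hx.
have hz : computable (fun p => final_signs_weights (nS p) (N p) (tabs p) (x p)).
  apply: (computable_joint_iter (A := fun p => nth_dfa (tabs p) (x p).2.1)) => //.
    by apply: computable_nth_dfa; computable_auto.
  apply: (computable_joint_step (A := fun p => nth_dfa (tabs p) (x p).2.2)) => //.
    by apply: computable_nth_dfa; computable_auto.
  apply: comp_pair; first by computable_auto.
  by apply: computable_base_weights; computable_auto.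
have hy0 : computable (fun p => ((final_signs_weights (nS p) (N p) (tabs p) (x p)).1,
    base_weights (N p) (final_signs_weights (nS p) (N p) (tabs p) (x p)).1.2 (fvar (N p)))).
  apply: comp_pair; first exact: computable_fst.
  apply: computable_base_weights => //; last exact: computable_fvar.
  by apply: computable_snd; exact: computable_fst.
have hg : computable (fun p => joint_step (nS p) (N p) (nth_dfa (tabs p) (x p).1)
   ((final_signs_weights (nS p) (N p) (tabs p) (x p)).1,
    base_weights (N p) (final_signs_weights (nS p) (N p) (tabs p) (x p)).1.2 (fvar (N p)))).
  apply: (computable_joint_step (A := fun p => nth_dfa (tabs p) (x p).1)) => //.
  by apply: computable_nth_dfa; computable_auto.
rewrite /description_of; cbv zeta.
apply: comp_pair; [apply: comp_pair; [apply: comp_pair|]|].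
- exact: computable_S.
- exact: computable_snd.
- apply: computable_fadd.
    apply: computable_nth => //; first exact: computable_no_code.
    exact: computable_snd.
  apply: computable_if; [|exact: computable_fnat (computable_const_nat _ _)
    |exact: computable_fnat (computable_const_nat _ _)].
  by apply: computable_mem => //; apply: computable_fst; exact: computable_fst.
apply: computable_snd.
apply: (computable_joint_iter (A := fun p => nth_dfa (tabs p) (x p).2.1)) => //.
by apply: computable_nth_dfa; computable_auto.
Qed.

Lemma computable_description : computable description.
Proof.
have hx : computable (fun c : gcode => table_triple c.1.1.1.2 c.2).
  by apply: computable_table_triple; computable_auto.
by apply: computable_description_of => //; computable_auto.
Qed.

Theorem theorem3p12 :
  exists2 F : gcode -> dcode,
    computable F
  & forall (Sigma V T : finType) (E : et0l Sigma V T) (c : gcode),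
      presents c E -> unambiguous E -> limiting E ->
      exists2 f : fps nat 1,
        generating_function (et0l_language E) f & describes (F c) f.
Proof.
exists description; first exact: computable_description.
by move=> Sigma V T E c; exact: description_correct.
Qed.
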